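(* Let $m,n\ge 1$ be integers, $a_1<a_2$ real, $a=a_2-a_1$, and let $\nu_1<\dots<\nu_{n+m}$ be real numbers with $\nu_j<0$ for $1\le j\le n$ and $\nu_j>0$ for $n<j\le n+m$. Let $\mathcal{L}_{K,m,n}$ (for $K\in\mathbb{Z}_{\ge1}$) and $\mathcal{L}_{m,n}$ be the kernels defined in the context. Then for all $s,t\in(0,1)$ and $u,v\in\mathbb{R}$, $$\lim_{K\to\infty}\mathcal{L}_{K,m,n}(s,u,t,v;\nu)=\mathcal{L}_{m,n}(s,u,t,v;\nu).$$
   Context: Setting: $N=n+m$; $s,t\in(0,1)$; $u,v\in\mathbb{R}$; $d_1,d_2$ are arbitrary fixed nonzero real numbers (the functions $L_{m,n},\hat L_{m,n}$ below do not depend on their choice). Prelimit kernel. $p_t(x,y)=\frac1{\sqrt{2\pi t}}e^{-(x-y)^2/2t}$ if $t>0$ and $p_t(x,y)=0$ if $t\le0$. For $K\ge 1$ put $\mu_j=a_1+a(j-1)/K$ for $1\le j\le n$ and $\mu_j=a_2+a(j-1)/K$ for $n<j\le n+m$; $A=(p_1(\mu_i,\nu_j))_{1\le i,j\le N}$ (which is invertible), and $$\tilde{\mathcal L}_{K,m,n}(s,u,t,v;\nu)=-p_{t-s}(u,v)+\sum_{j,k=1}^N p_{1-s}(u,\nu_k)(A^{-1})_{kj}p_t(\mu_j,v),$$ $$\mathcal L_{K,m,n}(s,u,t,v;\nu)=\exp\Big(\frac{u^2}{2(1-s)}-\frac{v^2}{2(1-t)}\Big)\tilde{\mathcal L}_{K,m,n}(s,u,t,v;\nu),$$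 $$q(s,u,t,v)=\exp\Big(\frac{u^2}{2(1-s)}-\frac{v^2}{2(1-t)}\Big)p_{t-s}(u,v).$$ Contours. $\Gamma_c$ is the vertical line $\tau\mapsto c+i\tau$, $\tau\in\mathbb{R}$, oriented upwards. $\gamma_1$ is a simple closed contour in the open left half plane containing $\nu_1,\dots,\nu_n$ in its interior; $\gamma_2$ is a simple closed contour in the open right half plane containing $\nu_{n+1},\dots,\nu_{n+m}$ in its interior; both are counterclockwise. For functions $f,g$, $f\otimes g$ denotes the rank one operator with kernel $f(x)g(y)$; determinants are Fredholm determinants. Functions (for $x,y\ge1$): $$\mathcal B_{v,t}(x)=\frac{d_2\sqrt a}{(2\pi i)^2\sqrt{1-t}}\int_{\Gamma_c}dw\int_{\gamma_1}d\zeta\, e^{\frac{t}{2(1-t)}w^2+a_1w-\frac{vw}{1-t}}\prod_{j=1}^n\frac{w/\nu_j-1}{\zeta/\nu_j-1}\prod_{j=1}^m(1-\zeta/\nu_{n+j})\frac{e^{ax\zeta}}{\zeta-w}\quad(c\ge0),$$ $$\beta_{v,t}(x)=\frac{d_2\sqrt a}{2\pi i\sqrt{1-t}}\int_{\Gamma_0}dw\,e^{\frac{t}{2(1-t)}w^2+a_1w-\frac{vw}{1-t}+axw}\prod_{j=1}^m(1-w/\nu_{n+j}),$$ $$\mathcal C_{u,s}(y)=\frac{d_1\sqrt a}{(2\pi i)^2\sqrt{1-s}}\int_{\gamma_1}dz\int_{\gamma_2}d\omega\,e^{-\frac{s}{2(1-s)}z^2-a_1z+\frac{uz}{1-s}}\prod_{j=1}^n\frac{\omega/\nu_j-1}{z/\nu_j-1}\prod_{j=1}^m\frac1{1-\omega/\nu_{n+j}}\frac{e^{-ay\omega}}{\omega-z},$$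 $$M_0(x,y)=\frac a{(2\pi i)^2}\int_{\gamma_1}d\zeta\int_{\gamma_2}d\omega\,\frac{e^{ax\zeta-ay\omega}}{\zeta-\omega}\prod_{j=1}^n\frac{1-\omega/\nu_j}{1-\zeta/\nu_j}\prod_{j=1}^m\frac{1-\zeta/\nu_{n+j}}{1-\omega/\nu_{n+j}},$$ $$\hat{\mathcal B}_{v,t}(x)=\frac{d_2\sqrt a}{(2\pi i)^2\sqrt{1-t}}\int_{\Gamma_c}dw\int_{\gamma_2}d\zeta\, e^{\frac{t}{2(1-t)}w^2+a_2w-\frac{vw}{1-t}}\prod_{j=1}^m\frac{w/\nu_{n+j}-1}{\zeta/\nu_{n+j}-1}\prod_{j=1}^n(\zeta/\nu_j-1)\frac{e^{-ax\zeta}}{\zeta-w}\quad(c\le0),$$ $$\hat\beta_{v,t}(x)=\frac{d_2\sqrt a}{2\pi i\sqrt{1-t}}\int_{\Gamma_0}dw\,e^{\frac{t}{2(1-t)}w^2+a_2w-\frac{vw}{1-t}-axw}\prod_{j=1}^n(w/\nu_j-1),$$ $$\hat{\mathcal C}_{u,s}(y)=\frac{d_1\sqrt a}{(2\pi i)^2\sqrt{1-s}}\int_{\gamma_2}dz\int_{\gamma_1}d\omega\,e^{-\frac{s}{2(1-s)}z^2-a_2z+\frac{uz}{1-s}}\prod_{j=1}^m\frac{1-\omega/\nu_{n+j}}{1-z/\nu_{n+j}}\prod_{j=1}^n\frac1{\omega/\nu_j-1}\frac{e^{ay\omega}}{z-\omega},$$ $$\hat M_0(x,y)=\frac a{(2\pi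 i)^2}\int_{\gamma_2}d\zeta\int_{\gamma_1}d\omega\,\frac{e^{-ax\zeta+ay\omega}}{\omega-\zeta}\prod_{j=1}^m\frac{1-\omega/\nu_{n+j}}{1-\zeta/\nu_{n+j}}\prod_{j=1}^n\frac{1-\zeta/\nu_j}{1-\omega/\nu_j}.$$ $M_0,\hat M_0$ are finite rank on $L^2[1,\infty)$ and $\det(I-M_0)_{L^2[1,\infty)},\det(I-\hat M_0)_{L^2[1,\infty)}>0$. Limiting kernel. $L_{m,n}$ and $\hat L_{m,n}$ are defined by $$d_1d_2L_{m,n}(s,u,t,v;\nu)=\frac{d_1d_2}{(2\pi i)^2\sqrt{(1-s)(1-t)}}\int_{\Gamma_0}dw\int_{\gamma_1}dz\,\frac{1}{w-z}e^{-\frac{s}{2(1-s)}z^2-a_1z+\frac{uz}{1-s}+\frac t{2(1-t)}w^2+a_1w-\frac{vw}{1-t}}\prod_{j=1}^n\frac{1-w/\nu_j}{1-z/\nu_j}$$ $$+\frac{\det(I-M_0+(\mathcal B_{v,t}+\beta_{v,t})\otimes\mathcal C_{u,s})_{L^2[1,\infty)}}{\det(I-M_0)_{L^2[1,\infty)}}-1,$$ $$d_1d_2\hat L_{m,n}(s,u,t,v;\nu)=\frac{d_1d_2}{(2\pi i)^2\sqrt{(1-s)(1-t)}}\int_{\Gamma_0}dw\int_{\gamma_2}dz\,\frac{1}{w-z}e^{-\frac{s}{2(1-s)}z^2-a_2z+\frac{uz}{1-s}+\frac t{2(1-t)}w^2+a_2w-\frac{vw}{1-t}}\prod_{j=1}^m\frac{1-w/\nu_{n+j}}{1-z/\nu_{n+j}}$$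 $$+\frac{\det(I-\hat M_0+(\hat{\mathcal B}_{v,t}+\hat\beta_{v,t})\otimes\hat{\mathcal C}_{u,s})_{L^2[1,\infty)}}{\det(I-\hat M_0)_{L^2[1,\infty)}}-1,$$ and $\mathcal L_{m,n}(s,u,t,v;\nu)=L_{m,n}(s,u,t,v;\nu)+\hat L_{m,n}(s,u,t,v;\nu)-q(s,u,t,v)$. *)

(* Defs.v *)
From HB Require Import structures.
From mathcomp Require Import all_boot all_order all_algebra.
From mathcomp Require Import all_classical all_reals all_analysis.
From mathcomp Require Export complex.

Set Implicit Arguments.
Unset Strict Implicit.
Unset Printing Implicit Defensive.

Import Order.TTheory GRing.Theory Num.Theory.
Import numFieldNormedType.Exports.

Local Open Scope classical_set_scope.
Local Open Scope ring_scope.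
Local Open Scope complex_scope.

(* The topology on R[i] is the one of its regular module R[i]^o. *)

(* [Re] and [Im] would otherwise denote the closed-field operations Num.Re, Num.Im. *)
Local Notation Re := complex.Re.
Local Notation Im := complex.Im.

Section ComplexIntegration.
Context {R : realType}.

Definition cexp (z : R[i]) : R[i] :=
  (expR (Re z))%:C * (cos (Im z) +i* sin (Im z)).

Definition Cintegral (D : set R) (f : R -> R[i]) : R[i] :=
  (\int[lebesgue_measure]_(x in D) Re (f x)) +i*
  (\int[lebesgue_measure]_(x in D) Im (f x)).

Definition Cderive (g : R -> R[i]) (x : R) : R[i] :=
  derive1 (fun y => Re (g y)) x +i* derive1 (fun y => Im (g y)) x.

Definition C1_on (g : R -> R[i]) (p q : R) : Prop :=
  (forall x, x \in `]p, q[ -> derivable (fun y => Re (g y)) x 1 /\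
                             derivable (fun y => Im (g y)) x 1) /\
  exists2 g' : R -> R[i]^o, {within `[p, q], continuous g'} &
    forall x, x \in `]p, q[ -> Cderive g x = g' x.

Definition piecewise_C1 (g : R -> R[i]) : Prop :=
  exists s : seq R, [/\ path <%R 0 s, last 0 s = 1 &
    forall i, (i < size s)%N -> C1_on g (nth 0 (0 :: s) i) (nth 0 s i)].

Record simple_closed_contour (g : R -> R[i]) : Prop := SimpleClosedContour {
  contour_continuous : {within `[0, 1], continuous (g : R -> R[i]^o)};
  contour_piecewise_C1 : piecewise_C1 g;
  contour_closed : g 0 = g 1;
  contour_simple : {in `[0, 1[ &, injective g} }.

Definition trace (g : R -> R[i]) : set R[i]^o := g @` `[0, 1].

(* [z] lies in the interior of the Jordan curve [g], i.e. in a bounded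
   connected component of the complement of its trace. *)
Definition inside (g : R -> R[i]) (z : R[i]^o) : Prop :=
  ~ trace g z /\ bounded_set (connected_component (~` trace g) z).

Definition contour_integral (g : R -> R[i]) (f : R[i] -> R[i]) : R[i] :=
  Cintegral `[0, 1] (fun x => f (g x) * Cderive g x).

Definition twopii : R[i] := 0 +i* (2 * pi).

Definition counterclockwise (g : R -> R[i]) : Prop :=
  forall z : R[i], inside g z ->
    contour_integral g (fun w => (w - z)^-1) = twopii.

(* integral along tau |-> c + i tau, for which dw = i dtau *)
Definition vline_integral (c : R) (f : R[i] -> R[i]) : R[i] :=
  (0 +i* 1) * Cintegral setT (fun tau => f (c +i* tau)).

(* integral over D^k, written as an iterated integral *)
Fixpoint iterated_integral (D : set R) (k : nat) :
    (k.-tuple R -> R[i]) -> R[i] :=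
  if k is k'.+1
  then fun F => Cintegral D (fun x =>
         iterated_integral D (fun y : k'.-tuple R => F [tuple of x :: y]))
  else fun F => F [tuple].

(* det(I + K) on L^2(D): Fredholm's series *)
Definition fredholm_det (D : set R) (K : R -> R -> R[i]) : R[i]^o :=
  limn (series (fun k : nat => k`!%:R^-1 *
    iterated_integral D (fun x : k.-tuple R =>
      \det (\matrix_(i < k, j < k) K (tnth x i) (tnth x j))) : R[i]^o)).

End ComplexIntegration.

Section PrelimitKernel.
Context {R : realType}.

(* p_t(x, y) *)
Definition heat (t x y : R) : R :=
  if 0 < t then (Num.sqrt (2 * pi * t))^-1 * expR (- (x - y) ^+ 2 / (2 * t))
  else 0.

Definition conj_factor (s u t v : R) : R :=
  expR (u ^+ 2 / (2 * (1 - s)) - v ^+ 2 / (2 * (1 - t))).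

Definition q_kernel (s u t v : R) : R := conj_factor s u t v * heat (t - s) u v.

Context {n m : nat}.
Variables (a1 a2 : R) (nu : 'I_(n + m) -> R).

(* indices start at 0 here, so that the j - 1 of the usual formula is i *)
Definition mu (K : nat) (i : 'I_(n + m)) : R :=
  (if (i < n)%N then a1 else a2) + (a2 - a1) * i%:R / K%:R.

Definition A_mx (K : nat) : 'M[R]_(n + m) :=
  \matrix_(i, j) heat 1 (mu K i) (nu j).

Definition LK_tilde (K : nat) (s u t v : R) : R :=
  - heat (t - s) u v +
  \sum_(j < n + m) \sum_(k < n + m)
    heat (1 - s) u (nu k) * invmx (A_mx K) k j * heat t (mu K j) v.

Definition LK_kernel (K : nat) (s u t v : R) : R :=
  conj_factor s u t v * LK_tilde K s u t v.

End PrelimitKernel.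

Section LimitKernel.
Context {R : realType} {n m : nat}.
Variables (a1 a2 : R) (nu : 'I_(n + m) -> R).
Variables (gamma1 gamma2 : R -> R[i]) (d1 d2 : R).

Local Notation a := (a2 - a1).
Local Notation nul j := ((nu (lshift m j))%:C).
Local Notation nur j := ((nu (rshift n j))%:C).
Local Notation half_line := `[(1 : R), +oo[%classic.

(* the two exponential weights occurring in all kernels, with b = a1 or a2 *)
Definition weight_w (b t v : R) (w : R[i]) : R[i] :=
  cexp ((t / (2 * (1 - t)))%:C * w ^+ 2 + b%:C * w - v%:C * w / (1 - t)%:C).

Definition weight_z (b s u : R) (z : R[i]) : R[i] :=
  cexp (- (s / (2 * (1 - s)))%:C * z ^+ 2 - b%:C * z + u%:C * z / (1 - s)%:C).

Definition calB (c v t : R) (x : R) : R[i] :=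
  (d2 * Num.sqrt a)%:C / (twopii ^+ 2 * (Num.sqrt (1 - t))%:C) *
  vline_integral c (fun w => contour_integral gamma1 (fun zeta =>
    weight_w a1 t v w *
    (\prod_(j < n) ((w / nul j - 1) / (zeta / nul j - 1))) *
    (\prod_(j < m) (1 - zeta / nur j)) *
    (cexp ((a * x)%:C * zeta) / (zeta - w)))).

Definition beta (v t : R) (x : R) : R[i] :=
  (d2 * Num.sqrt a)%:C / (twopii * (Num.sqrt (1 - t))%:C) *
  vline_integral 0 (fun w =>
    weight_w a1 t v w * cexp ((a * x)%:C * w) *
    \prod_(j < m) (1 - w / nur j)).

Definition calC (u s : R) (y : R) : R[i] :=
  (d1 * Num.sqrt a)%:C / (twopii ^+ 2 * (Num.sqrt (1 - s))%:C) *
  contour_integral gamma1 (fun z => contour_integral gamma2 (fun omega =>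
    weight_z a1 s u z *
    (\prod_(j < n) ((omega / nul j - 1) / (z / nul j - 1))) *
    (\prod_(j < m) (1 - omega / nur j)^-1) *
    (cexp (- (a * y)%:C * omega) / (omega - z)))).

Definition M0 (x y : R) : R[i] :=
  a%:C / twopii ^+ 2 *
  contour_integral gamma1 (fun zeta => contour_integral gamma2 (fun omega =>
    cexp ((a * x)%:C * zeta - (a * y)%:C * omega) / (zeta - omega) *
    (\prod_(j < n) ((1 - omega / nul j) / (1 - zeta / nul j))) *
    (\prod_(j < m) ((1 - zeta / nur j) / (1 - omega / nur j))))).

Definition calB_hat (c v t : R) (x : R) : R[i] :=
  (d2 * Num.sqrt a)%:C / (twopii ^+ 2 * (Num.sqrt (1 - t))%:C) *
  vline_integral c (fun w => contour_integral gamma2 (fun zeta =>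
    weight_w a2 t v w *
    (\prod_(j < m) ((w / nur j - 1) / (zeta / nur j - 1))) *
    (\prod_(j < n) (zeta / nul j - 1)) *
    (cexp (- (a * x)%:C * zeta) / (zeta - w)))).

Definition beta_hat (v t : R) (x : R) : R[i] :=
  (d2 * Num.sqrt a)%:C / (twopii * (Num.sqrt (1 - t))%:C) *
  vline_integral 0 (fun w =>
    weight_w a2 t v w * cexp (- (a * x)%:C * w) *
    \prod_(j < n) (w / nul j - 1)).

Definition calC_hat (u s : R) (y : R) : R[i] :=
  (d1 * Num.sqrt a)%:C / (twopii ^+ 2 * (Num.sqrt (1 - s))%:C) *
  contour_integral gamma2 (fun z => contour_integral gamma1 (fun omega =>
    weight_z a2 s u z *
    (\prod_(j < m) ((1 - omega / nur j) / (1 - z / nur j))) *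
    (\prod_(j < n) (omega / nul j - 1)^-1) *
    (cexp ((a * y)%:C * omega) / (z - omega)))).

Definition M0_hat (x y : R) : R[i] :=
  a%:C / twopii ^+ 2 *
  contour_integral gamma2 (fun zeta => contour_integral gamma1 (fun omega =>
    cexp (- (a * x)%:C * zeta + (a * y)%:C * omega) / (omega - zeta) *
    (\prod_(j < m) ((1 - omega / nur j) / (1 - zeta / nur j))) *
    (\prod_(j < n) ((1 - zeta / nul j) / (1 - omega / nul j))))).

Definition Lmn (c s u t v : R) : R[i] :=
  (d1 * d2)%:C^-1 *
  ((d1 * d2)%:C / (twopii ^+ 2 * (Num.sqrt ((1 - s) * (1 - t)))%:C) *
     vline_integral 0 (fun w => contour_integral gamma1 (fun z =>
       (w - z)^-1 * (weight_z a1 s u z * weight_w a1 t v w) *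
       \prod_(j < n) ((1 - w / nul j) / (1 - z / nul j))))
   + fredholm_det half_line
       (fun x y => - M0 x y + (calB c v t x + beta v t x) * calC u s y)
     / fredholm_det half_line (fun x y => - M0 x y)
   - 1).

Definition Lmn_hat (c s u t v : R) : R[i] :=
  (d1 * d2)%:C^-1 *
  ((d1 * d2)%:C / (twopii ^+ 2 * (Num.sqrt ((1 - s) * (1 - t)))%:C) *
     vline_integral 0 (fun w => contour_integral gamma2 (fun z =>
       (w - z)^-1 * (weight_z a2 s u z * weight_w a2 t v w) *
       \prod_(j < m) ((1 - w / nur j) / (1 - z / nur j))))
   + fredholm_det half_line
       (fun x y =>
          - M0_hat x y + (calB_hat c v t x + beta_hat v t x) * calC_hat u s y)
     / fredholm_det half_line (fun x y => - M0_hat x y)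
   - 1).

(* [c] and [c'] are the abscissae of the vertical lines in calB and calB_hat *)
Definition L_kernel (c c' s u t v : R) : R[i]^o :=
  Lmn c s u t v + Lmn_hat c' s u t v - (q_kernel s u t v)%:C.

End LimitKernel.

(* Main.v *)
(* Both kernels equal - q plus ((1-s)(1-t))^(-1/2) times a sum over the nodes nu_k
   of exp(- s nu_k^2 / (2(1-s)) + u nu_k / (1-s)) Y_k, with explicit weights Y_k.

   Prelimit side: after removal of Gaussian factors, the matrix A becomes
   (exp (mu_i nu_j)) and the heat factor p_t(mu_j, v) becomes a Gaussian dual
   function of mu_j, so the weights solve a linear system whose rows are
   parametrised by mu_i. Replacing rows by divided differences and letting K tend
   to infinity gives the confluent system with rows nu_j^k exp(a_1 nu_j), k < n,
   and nu_j^k exp(a_2 nu_j), k < m. It is invertible since, by Rolle, a non-zero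
   exponential polynomial p(x) exp(a_1 x) + q(x) exp(a_2 x) with deg p < n and
   deg q < m has fewer than n + m zeros. Its solution Y is a quadrature rule:
   V_1(p) + V_2(q) = sum_k (p(nu_k) exp(a_1 nu_k) + q(nu_k) exp(a_2 nu_k)) Y_k,
   where V_i(p) is the Gaussian mean of p exp(a_i w) on a vertical line.

   Limit side: by residues, every contour integral is a finite sum over the
   nodes, and the Fredholm determinants are those of kernels of finite rank, that
   is determinants of m x m (or n x n) matrices. Their ratio is a rank one update,
   and the quadrature rule expresses the updating row as a linear combination of
   the rows of I - M_0; the ratio then cancels the contribution of the second
   family of nodes, and L (resp. its hatted version) is the part of the sum over
   nu_1 .. nu_n (resp. nu_(n+1) .. nu_(n+m)). *)

(* The contours are arbitrary curves, known only through their half plane and their index around the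
   nodes. Residues therefore rest on three facts: a Cauchy formula for an entire function divided by
   z - p, the prescribed index at the nodes, and index 0 at every point of the opposite closed half
   plane.

   Nodes and Gaussian means are real, so each finite rank kernel is the complexification of a real
   one, and the Fredholm determinants reduce to determinants of real Gram matrices over [1, oo). The
   means do not depend on the abscissa of the vertical line, which is why c and c' disappear.

   The denominator det(I - M_0) is non-zero for the same reason as the confluent determinant: a
   vector in the kernel of its matrix yields an exponential polynomial vanishing at all n + m nodes.

   A single argument serves L and its hatted version, with a parameter h equal to a or - a. It sees
   only the signs h x_i < 0 < h y_j, where x is the family of nodes that survives in the result;
   these signs make all integrals over [1, oo) converge. *)
Require Import Defs.
From mathcomp Require Import all_boot all_order all_algebra.
From mathcomp Require Import all_classical all_reals all_analysis.
From mathcomp Require Import perm measurable_realfun.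
From mathcomp Require Import ring lra.

Set Implicit Arguments.
Unset Strict Implicit.
Unset Printing Implicit Defensive.

Import Order.TTheory GRing.Theory Num.Theory.
Import numFieldNormedType.Exports.

Local Open Scope classical_set_scope.
Local Open Scope ring_scope.
Local Open Scope complex_scope.

Local Notation Re := complex.Re.
Local Notation Im := complex.Im.

(** * Complex exponentials and integrals *)

Section ComplexBasics.
Context {R : realType}.
Implicit Types (z w : R[i]) (x y : R).

Lemma complex_eqP z w : Re z = Re w -> Im z = Im w -> z = w.
Proof. by case: z w => [a b] [c d] /= -> ->. Qed.

Lemma cReD z w : Re (z + w) = Re z + Re w. Proof. by case: z w => ? ? [] ? ?. Qed.
Lemma cImD z w : Im (z + w) = Im z + Im w. Proof. by case: z w => ? ? [] ? ?. Qed.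
Lemma cReN z : Re (- z) = - Re z. Proof. by case: z => ? ?. Qed.
Lemma cImN z : Im (- z) = - Im z. Proof. by case: z => ? ?. Qed.
Lemma cReM z w : Re (z * w) = Re z * Re w - Im z * Im w.
Proof. by case: z w => ? ? [] ? ?. Qed.
Lemma cImM z w : Im (z * w) = Re z * Im w + Im z * Re w.
Proof. by case: z w => ? ? [] ? ?. Qed.
Lemma cReV z : Re z^-1 = Re z / (Re z ^+ 2 + Im z ^+ 2).
Proof. by case: z => ? ?. Qed.
Lemma cImV z : Im z^-1 = - (Im z / (Re z ^+ 2 + Im z ^+ 2)).
Proof. by case: z => ? ?. Qed.

Definition cReIm := (cReD, cImD, cReN, cImN, cReM, cImM).

Lemma complex_neq0_Re z : Re z != 0 -> z != 0.
Proof. by rewrite eq_complex /=; case: (Re z == 0). Qed.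

(** The l1 norm is submultiplicative, like the modulus, but real-valued and free of square roots, so
    estimates split into real and imaginary parts. *)
Definition cnorm1 z : R := `|Re z| + `|Im z|.

Lemma cnorm1_ge0 z : 0 <= cnorm1 z. Proof. exact: addr_ge0. Qed.

Lemma ler_cnorm1D z w : cnorm1 (z + w) <= cnorm1 z + cnorm1 w.
Proof.
rewrite /cnorm1 !cReIm addrACA lerD //; exact: ler_normD.
Qed.

Lemma cnorm1N z : cnorm1 (- z) = cnorm1 z.
Proof. by rewrite /cnorm1 !cReIm !normrN. Qed.

Lemma ler_cnorm1M z w : cnorm1 (z * w) <= cnorm1 z * cnorm1 w.
Proof.
rewrite /cnorm1 !cReIm mulrDl !mulrDr -!normrM.
apply: le_trans (lerD (ler_normB _ _) (ler_normD _ _)) _; lra.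
Qed.

Lemma cexpD z w : cexp (z + w) = cexp z * cexp w.
Proof.
by apply: complex_eqP; rewrite /cexp /= !cReIm expRD ?cosD ?sinD; ring.
Qed.

Lemma Re_cexp z : Re (cexp z) = expR (Re z) * cos (Im z).
Proof. by rewrite /cexp /= mul0r subr0. Qed.
Lemma Im_cexp z : Im (cexp z) = expR (Re z) * sin (Im z).
Proof. by rewrite /cexp /= mul0r addr0. Qed.

Lemma cexp_real x : cexp x%:C = (expR x)%:C.
Proof. by apply: complex_eqP; rewrite ?Re_cexp ?Im_cexp /= ?cos0 ?sin0 ?mulr1 ?mulr0. Qed.

End ComplexBasics.

Section RealIntegral.
Context {R : realType}.
Notation mu := (@lebesgue_measure R).
Implicit Types (D : set R) (f g : R -> R).

Definition rintegrable D f := mu.-integrable D (EFin \o f).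

Lemma eq_rintegrable D f g : measurable D -> (forall x, D x -> f x = g x) ->
  rintegrable D f -> rintegrable D g.
Proof. by move=> mD fg; apply: eq_integrable => // x /[!inE] Dx /=; rewrite fg. Qed.

Lemma rintegrableD D f g : measurable D -> rintegrable D f -> rintegrable D g ->
  rintegrable D (fun x => f x + g x).
Proof. by move=> mD; exact: integrableD. Qed.

Lemma rintegrableB D f g : measurable D -> rintegrable D f -> rintegrable D g ->
  rintegrable D (fun x => f x - g x).
Proof. by move=> mD; exact: integrableB. Qed.

Lemma rintegrableZl D f (k : R) : measurable D -> rintegrable D f ->
  rintegrable D (fun x => k * f x).
Proof. by move=> mD; exact: integrableZl. Qed.

Lemma rintegrable_le D f g : measurable D -> measurable_fun D f ->
  rintegrable D g -> (forall x, D x -> `|f x| <= g x) -> rintegrable D f.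
Proof.
move=> mD mf ig fg; apply: le_integrable ig => //; first exact/measurable_EFinP.
move=> x Dx /=; rewrite lee_fin (le_trans (fg _ Dx)) //; exact: ler_norm.
Qed.

Lemma rintegrable_bounded D f g (C : R) : measurable D -> measurable_fun D f ->
  (forall x, D x -> `|f x| <= C) -> rintegrable D g ->
  rintegrable D (fun x => f x * g x).
Proof.
move=> mD mf fC ig; have ig' := ig; case/integrableP: ig' => /measurable_EFinP mg _.
apply: (@rintegrable_le _ _ (fun x => C * `|g x|)) => //.
- exact: measurable_funM.
- by apply: rintegrableZl => //; exact: (integrable_abse ig).
- by move=> x Dx; rewrite normrM ler_wpM2r ?fC.
Qed.

Lemma Rintegral0 D : \int[mu]_(x in D) (0 : R) = 0.
Proof. by rewrite /Rintegral integral0. Qed.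

Lemma rintegrable_sum D (I : Type) (r : seq I) (P : pred I) (f : I -> R -> R) :
  measurable D -> (forall i, P i -> rintegrable D (f i)) ->
  rintegrable D (fun x => \sum_(i <- r | P i) f i x).
Proof.
move=> mD fi; elim: r => [|i r ih].
  by apply: (@eq_rintegrable _ (fun=> 0)) => // [x _|]; [rewrite big_nil|exact: integrable0].
have [Pi|nPi] := boolP (P i); last first.
  by apply: eq_rintegrable ih => // x _; rewrite big_cons (negPf nPi).
by apply: (eq_rintegrable mD _ (rintegrableD mD (fi _ Pi) ih)) => x _; rewrite big_cons Pi.
Qed.

Lemma Rintegral_sum D (I : Type) (r : seq I) (P : pred I) (f : I -> R -> R) :
  measurable D -> (forall i, P i -> rintegrable D (f i)) ->
  \int[mu]_(x in D) (\sum_(i <- r | P i) f i x) =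
  \sum_(i <- r | P i) \int[mu]_(x in D) f i x.
Proof.
move=> mD fi; elim: r => [|i r ih].
  rewrite big_nil -[RHS](Rintegral0 D); apply: eq_Rintegral => x _.
  by rewrite big_nil.
rewrite big_cons -ih; have [Pi|nPi] := boolP (P i); last first.
  by apply: eq_Rintegral => x _; rewrite big_cons (negPf nPi).
rewrite -RintegralD //; [|exact: fi|exact: rintegrable_sum].
by apply: eq_Rintegral => x _; rewrite big_cons Pi.
Qed.

End RealIntegral.

Section ComplexIntegral.
Context {R : realType}.
Notation mu := (@lebesgue_measure R).
Implicit Types (D : set R) (f g : R -> R[i]).

Definition cintegrable D f :=
  rintegrable D (fun x => Re (f x)) /\ rintegrable D (fun x => Im (f x)).

Lemma eq_Cintegral D f g : (forall x, D x -> f x = g x) ->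
  Cintegral D f = Cintegral D g.
Proof.
by move=> fg; congr (_ +i* _); apply: eq_Rintegral => x /[!inE] Dx /=; rewrite fg.
Qed.

Lemma eq_cintegrable D f g : measurable D -> (forall x, D x -> f x = g x) ->
  cintegrable D f -> cintegrable D g.
Proof.
by move=> mD fg [h1 h2]; split;
  [apply: eq_rintegrable h1|apply: eq_rintegrable h2] => // x Dx; rewrite fg.
Qed.

Lemma CintegralD D f g : measurable D -> cintegrable D f -> cintegrable D g ->
  Cintegral D (fun x => f x + g x) = Cintegral D f + Cintegral D g.
Proof.
move=> mD [rf jf] [rg jg]; apply: complex_eqP; rewrite cReIm /= -RintegralD //;
  by apply: eq_Rintegral => x _; rewrite cReIm.
Qed.

Lemma cintegrableD D f g : measurable D -> cintegrable D f -> cintegrable D g ->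
  cintegrable D (fun x => f x + g x).
Proof.
move=> mD [rf jf] [rg jg]; split;
  by under eq_fun do rewrite cReIm; exact: rintegrableD.
Qed.

Lemma cintegrableZl D f (k : R[i]) : measurable D -> cintegrable D f ->
  cintegrable D (fun x => k * f x).
Proof.
move=> mD [rf jf]; split; under eq_fun do rewrite cReIm.
  by apply: rintegrableB => //; exact: rintegrableZl.
by apply: rintegrableD => //; exact: rintegrableZl.
Qed.

Lemma CintegralZl D f (k : R[i]) : measurable D -> cintegrable D f ->
  Cintegral D (fun x => k * f x) = k * Cintegral D f.
Proof.
move=> mD [rf jf]; apply: complex_eqP; rewrite cReIm /=.
  rewrite -!RintegralZl // -RintegralB //; [|exact: rintegrableZl|exact: rintegrableZl].
  by apply: eq_Rintegral => x _; rewrite cReIm.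
rewrite -!RintegralZl // -RintegralD //; [|exact: rintegrableZl|exact: rintegrableZl].
by apply: eq_Rintegral => x _; rewrite cReIm.
Qed.

Lemma cintegrable0 D : measurable D -> cintegrable D (fun=> 0).
Proof. by move=> mD; split; exact: integrable0. Qed.

Lemma Cintegral0 D : Cintegral D (fun=> 0) = 0.
Proof. by apply: complex_eqP; rewrite /= /Rintegral integral0. Qed.

Lemma cintegrable_sum D (I : Type) (r : seq I) (P : pred I) (f : I -> R -> R[i]) :
  measurable D -> (forall i, P i -> cintegrable D (f i)) ->
  cintegrable D (fun x => \sum_(i <- r | P i) f i x).
Proof.
move=> mD fi; elim: r => [|i r ih].
  by apply: (@eq_cintegrable _ (fun=> 0)) => // [x _|]; [rewrite big_nil|exact: cintegrable0].
have [Pi|nPi] := boolP (P i); last first.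
  by apply: eq_cintegrable ih => // x _; rewrite big_cons (negPf nPi).
by apply: (eq_cintegrable mD _ (cintegrableD mD (fi _ Pi) ih)) => x _; rewrite big_cons Pi.
Qed.

Lemma Cintegral_sum D (I : Type) (r : seq I) (P : pred I) (f : I -> R -> R[i]) :
  measurable D -> (forall i, P i -> cintegrable D (f i)) ->
  Cintegral D (fun x => \sum_(i <- r | P i) f i x) =
  \sum_(i <- r | P i) Cintegral D (f i).
Proof.
move=> mD fi; elim: r => [|i r ih].
  rewrite big_nil -[RHS](Cintegral0 D); apply: eq_Cintegral => x _.
  by rewrite big_nil.
rewrite big_cons -ih; have [Pi|nPi] := boolP (P i); last first.
  by apply: eq_Cintegral => x _; rewrite big_cons (negPf nPi).
rewrite -CintegralD //; [|exact: fi|exact: cintegrable_sum].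
by apply: eq_Cintegral => x _; rewrite big_cons Pi.
Qed.

Lemma Cintegral_real D (f : R -> R) :
  Cintegral D (fun x => (f x)%:C) = (\int[mu]_(x in D) f x)%:C.
Proof. by apply: complex_eqP => //=; rewrite /Rintegral integral0. Qed.

End ComplexIntegral.

(** * Contour integrals *)

Section MeanValue.
Context {R : realType}.
Implicit Types (f g h : R -> R).

Lemma is_derive_continuous f g : (forall x : R, is_derive x 1 f (g x)) ->
  continuous f.
Proof.
move=> fg x; apply: differentiable_continuous; apply/derivable1_diffP.
by have [] := fg x.
Qed.

Lemma mean_value f g (x y : R) : (forall x : R, is_derive x 1 f (g x)) ->
  exists2 c, Num.min x y <= c <= Num.max x y & f y - f x = g c * (y - x).
Proof.
move=> fg; have cf := is_derive_continuous fg.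
have [xy|/ltW yx] := leP x y.
  have [c] := MVT_segment xy (fun z _ => fg z) (continuous_subspaceT cf).
  by rewrite in_itv /=; exists c.
have [c] := MVT_segment yx (fun z _ => fg z) (continuous_subspaceT cf).
rewrite in_itv /= => cxy e; exists c => //.
by rewrite -opprB e -mulrN opprB.
Qed.

Lemma minmax_norm_le (x y c M : R) : Num.min x y <= c <= Num.max x y ->
  `|x| <= M -> `|y| <= M -> `|c| <= M.
Proof.
by rewrite ge_min le_max !ler_norml => /andP[/orP[]h1 /orP[]h2] /andP[? ?] /andP[? ?];
  apply/andP; split; lra.
Qed.

Lemma minmax_dist_le (x y c : R) : Num.min x y <= c <= Num.max x y ->
  `|c - x| <= `|y - x|.
Proof.
rewrite ge_min le_max => /andP[/orP[]h1 /orP[]h2]; rewrite ler_norml;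
  by have [h3|h3] := ger0P (y - x); apply/andP; split; lra.
Qed.

(** Two applications of the mean value theorem, the second between x and the intermediate point of
    the first; this costs the factor 1/2 of Taylor's formula. *)
Lemma taylor2_bound f g h (M C : R) :
  (forall x : R, is_derive x 1 f (g x)) -> (forall x : R, is_derive x 1 g (h x)) ->
  (forall x, `|x| <= M -> `|h x| <= C) ->
  forall x y, `|x| <= M -> `|y| <= M ->
  `|f y - f x - (y - x) * g x| <= C * (y - x) ^+ 2.
Proof.
move=> fg gh hC x y xM yM.
have [c cxy ->] := mean_value x y fg.
have [d dxc gE] := mean_value x c gh.
have cM := minmax_norm_le cxy xM yM.
have dM := minmax_norm_le dxc xM cM.
rewrite (_ : _ - _ = h d * ((c - x) * (y - x))); last by rewrite mulrA -gE; ring.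
rewrite -(real_normK (num_real (y - x))) expr2 !normrM.
by rewrite ler_pM ?hC // ler_wpM2r // minmax_dist_le.
Qed.

(** Cut the interval into N + 1 equal steps: each contributes at most C / (N + 1)^2, hence the total
    at most C / (N + 1). *)
Lemma quadratic_increment_eq (I : R -> R) (C : R) :
  (forall x y : R, 0 <= x <= 1 -> 0 <= y <= 1 -> `|I y - I x| <= C * (y - x) ^+ 2) ->
  I 1 = I 0.
Proof.
move=> IC; apply/eqP; rewrite -subr_eq0 -normr_le0; apply/ler_addgt0Pr => e e0.
rewrite add0r.
have step (N : nat) (k : nat) : (k <= N.+1)%N ->
    `|I (k%:R / N.+1%:R) - I 0| <= k%:R * (C * (N.+1%:R^-1) ^+ 2).
  elim: k => [|k ih] kN; first by rewrite !mul0r subrr normr0.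
  have N0 : 0 < N.+1%:R :> R by rewrite ltr0n.
  have in01 (j : nat) : (j <= N.+1)%N ->
      (0 <= j%:R / N.+1%:R :> R) && (j%:R / N.+1%:R <= 1 :> R).
    move=> jN; apply/andP; split; first exact: divr_ge0.
       by rewrite ler_pdivrMr // mul1r ler_nat.
  have := lerD (IC _ _ (in01 _ (ltnW kN)) (in01 _ kN)) (ih (ltnW kN)).
  rewrite -mulrBl -natrB // subSnn mul1r => h.
  set X := C * _; rewrite (_ : k.+1%:R * X = X + k%:R * X); last first.
    by rewrite -add1n natrD mulrDl mul1r.
  by apply: le_trans h; apply: le_trans (ler_normD _ _); rewrite addrA subrK.
pose N := Num.truncn (`|C| / e).
have := step N N.+1 (leqnn _).
rewrite divff ?pnatr_eq0 // => /le_trans; apply.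
rewrite expr2 !mulrA [_ * C]mulrC mulfK ?pnatr_eq0 //.
rewrite ler_pdivrMr ?ltr0n // -ler_pdivrMl // mulrC.
apply: le_trans (_ : `|C| / e <= _).
  by rewrite ler_wpM2r ?invr_ge0 ?(ltW e0) // ler_norm.
by rewrite ltW // Num.Theory.truncnS_gt.
Qed.

End MeanValue.

(** * Continuity and differentiability of complex curves *)

Section Curves.
Context {R : realType}.
Implicit Types (D : set R) (k l : R -> R[i]).

(** Componentwise continuity, so that real limit theorems apply directly; [within_ccont] derives it
    from continuity into [R[i]^o]. *)
Definition ccont D k :=
  {within D, continuous (fun x => Re (k x))} /\
  {within D, continuous (fun x => Im (k x))}.

Lemma eq_ccont D k l : k =1 l -> ccont D k -> ccont D l.
Proof. by move=> /funext ->. Qed.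

Lemma ccont_cst D (c : R[i]) : ccont D (fun=> c).
Proof. by split=> x; exact: cst_continuous. Qed.

Lemma ccontP D k : ccont D k <-> (forall x, D x ->
  (Re (k y) @[y --> within D (nbhs x)] --> Re (k x)) /\
  (Im (k y) @[y --> within D (nbhs x)] --> Im (k x))).
Proof.
split=> [[/subspace_continuousP rk /subspace_continuousP ik] x Dx|h].
  by split; [exact: rk|exact: ik].
by split; apply/subspace_continuousP => x Dx; have [] := h x Dx.
Qed.

Lemma ccontD D k l : ccont D k -> ccont D l -> ccont D (fun x => k x + l x).
Proof.
move=> /ccontP ck /ccontP cl; apply/ccontP => x Dx.
have [rk ik] := ck x Dx; have [rl il] := cl x Dx.
by split; under eq_fun do rewrite cReIm; rewrite cReIm; exact: cvgD.
Qed.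

Lemma ccontM D k l : ccont D k -> ccont D l -> ccont D (fun x => k x * l x).
Proof.
move=> /ccontP ck /ccontP cl; apply/ccontP => x Dx.
have [rk ik] := ck x Dx; have [rl il] := cl x Dx.
split; under eq_fun do rewrite cReIm; rewrite cReIm.
  by apply: cvgB; exact: cvgM.
by apply: cvgD; exact: cvgM.
Qed.

Lemma complex_sqr_gt0 (z : R[i]) : z != 0 -> 0 < Re z ^+ 2 + Im z ^+ 2.
Proof.
rewrite eq_complex lt_def addr_ge0 ?sqr_ge0 // andbT.
by rewrite paddr_eq0 ?sqr_ge0 // !sqrf_eq0.
Qed.

Lemma ccontV D k : ccont D k -> (forall x, D x -> k x != 0) ->
  ccont D (fun x => (k x)^-1).
Proof.
move=> /ccontP ck k0; apply/ccontP => x Dx; have [rk ik] := ck x Dx.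
have nz : Re (k x) ^+ 2 + Im (k x) ^+ 2 != 0.
  by rewrite gt_eqF // complex_sqr_gt0 // k0.
have sq : (Re (k y) ^+ 2 + Im (k y) ^+ 2) @[y --> within D (nbhs x)]
    --> Re (k x) ^+ 2 + Im (k x) ^+ 2.
  by apply: cvgD; rewrite expr2; apply: cvgM.
split; [under eq_fun do rewrite cReV; rewrite cReV|
        under eq_fun do rewrite cImV; rewrite cImV; apply: cvgN];
  by apply: cvgM => //; exact: cvgV.
Qed.

Lemma ccontS D D' k : D `<=` D' -> ccont D' k -> ccont D k.
Proof. by move=> DD [rk ik]; split; apply: continuous_subspaceW DD _. Qed.

Definition cderiv k (x : R) (d : R[i]) :=
  is_derive x 1 (fun y => Re (k y)) (Re d) /\
  is_derive x 1 (fun y => Im (k y)) (Im d).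

Lemma cderiv_cst (c : R[i]) x : cderiv (fun=> c) x 0.
Proof. by split; exact: is_derive_cst. Qed.

Lemma cderivD k l x d e : cderiv k x d -> cderiv l x e ->
  cderiv (fun y => k y + l y) x (d + e).
Proof.
move=> [rk ik] [rl il]; split; under eq_fun do rewrite cReIm; rewrite cReIm;
  exact: is_deriveD.
Qed.

Lemma cderivM k l x d e : cderiv k x d -> cderiv l x e ->
  cderiv (fun y => k y * l y) x (d * l x + k x * e).
Proof.
move=> [rk ik] [rl il]; split; under eq_fun do rewrite cReIm;
  by apply: is_derive_eq; rewrite !cReIm /GRing.scale /=; ring.
Qed.

Lemma cderiv_cexp k x d : cderiv k x d ->
  cderiv (fun y => cexp (k y)) x (cexp (k x) * d).
Proof.
move=> [rk ik].
have de : is_derive x 1 (fun y => expR (Re (k y))) (expR (Re (k x)) * Re d).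
  exact: (is_derive1_comp (is_derive_expR _) rk).
have dc : is_derive x 1 (fun y => cos (Im (k y))) (- sin (Im (k x)) * Im d).
  exact: (is_derive1_comp (is_derive_cos _) ik).
have ds : is_derive x 1 (fun y => sin (Im (k y))) (cos (Im (k x)) * Im d).
  exact: (is_derive1_comp (is_derive_sin _) ik).
split.
- under eq_fun do rewrite Re_cexp.
  by apply: is_derive_eq; rewrite cReM Re_cexp Im_cexp /GRing.scale /=; ring.
- under eq_fun do rewrite Im_cexp.
  by apply: is_derive_eq; rewrite cImM Re_cexp Im_cexp /GRing.scale /=; ring.
Qed.

Lemma ccont_cexp D k : ccont D k -> ccont D (fun x => cexp (k x)).
Proof.
move=> /ccontP ck; apply/ccontP => x Dx; have [rk ik] := ck x Dx.
split; [under eq_fun do rewrite Re_cexp; rewrite Re_cexp|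
        under eq_fun do rewrite Im_cexp; rewrite Im_cexp]; apply: cvgM.
- by apply: continuous_cvg => //; exact: continuous_expR.
- by apply: continuous_cvg => //; exact: continuous_cos.
- by apply: continuous_cvg => //; exact: continuous_expR.
- by apply: continuous_cvg => //; exact: continuous_sin.
Qed.

End Curves.

(** * Entire functions *)

Section Entire.
Context {R : realType}.
Implicit Types (F G : R[i] -> R[i]).

(* Complex differentiability, recorded through the consequences that are used:
   the chain rule along curves and a second order bound on bounded sets. *)
Record entire F F' : Prop := Entire {
  entire_cont : forall D k, ccont D k -> ccont D (fun x => F (k x));
  entire_cont' : forall D k, ccont D k -> ccont D (fun x => F' (k x));
  entire_chain : forall k x d, cderiv k x d ->
    cderiv (fun y => F (k y)) x (F' (k x) * d);
  entire_bound : forall M, exists C, forall z w, cnorm1 z <= M -> cnorm1 w <= M ->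
    [/\ cnorm1 (F z) <= C, cnorm1 (F' z) <= C,
        cnorm1 (F w - F z) <= C * cnorm1 (w - z) &
        cnorm1 (F w - F z - (w - z) * F' z) <= C * cnorm1 (w - z) ^+ 2] }.

Lemma eq_entire F F' G G' : F =1 G -> F' =1 G' -> entire F F' -> entire G G'.
Proof. by move=> /funext -> /funext ->. Qed.

Lemma cnorm10 : cnorm1 (0 : R[i]) = 0.
Proof. by rewrite /cnorm1 /= normr0 addr0. Qed.

Lemma entire_cst (c : R[i]) : entire (fun=> c) (fun=> 0).
Proof.
split.
- by move=> D k _; exact: ccont_cst.
- by move=> D k _; exact: ccont_cst.
- by move=> k x d _; rewrite mul0r; exact: cderiv_cst.
- move=> M; exists (cnorm1 c) => z w _ _; rewrite mulr0 subrr subr0 cnorm10.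
  by split=> //; rewrite ?mulr_ge0 ?exprn_ge0 ?cnorm1_ge0.
Qed.

Lemma entire_id : entire id (fun=> 1).
Proof.
split=> //.
- by move=> D k _; exact: ccont_cst.
- by move=> k x d; rewrite mul1r.
(* The same constant must bound the value z and the derivative 1. *)
- move=> M; exists (Num.max M 1) => z w zM wM.
  have M1 : 1 <= Num.max M 1 by rewrite le_max lexx orbT.
  have M0 : 0 <= Num.max M 1 := le_trans ler01 M1.
  split.
  + by rewrite le_max zM.
  + by rewrite /cnorm1 /= normr0 normr1 addr0.
  + by rewrite ler_peMl ?cnorm1_ge0.
  + by rewrite mulr1 subrr cnorm10 mulr_ge0 ?exprn_ge0 ?cnorm1_ge0.
Qed.

Lemma entireD F F' G G' : entire F F' -> entire G G' ->
  entire (fun z => F z + G z) (fun z => F' z + G' z).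
Proof.
move=> [cF cF' hF bF] [cG cG' hG bG]; split.
- by move=> D k ck; apply: ccontD; [exact: cF|exact: cG].
- by move=> D k ck; apply: ccontD; [exact: cF'|exact: cG'].
- by move=> k x d kd; rewrite mulrDl; apply: cderivD; [exact: hF|exact: hG].
- move=> M; have [A HA] := bF M; have [B HB] := bG M; exists (A + B) => z w zM wM.
  have [a1 a2 a3 a4] := HA _ _ zM wM; have [b1 b2 b3 b4] := HB _ _ zM wM.
  split; rewrite ?mulrDl.
  + exact: le_trans (ler_cnorm1D _ _) (lerD a1 b1).
  + exact: le_trans (ler_cnorm1D _ _) (lerD a2 b2).
  + apply: le_trans (lerD a3 b3); apply: le_trans (ler_cnorm1D _ _).
    by rewrite opprD addrACA.
  + apply: le_trans (lerD a4 b4); apply: le_trans (ler_cnorm1D _ _).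
    by rewrite (_ : _ + _ - _ - _ = F w - F z - (w - z) * F' z + (G w - G z - (w - z) * G' z)) //; ring.
Qed.

Lemma entireM F F' G G' : entire F F' -> entire G G' ->
  entire (fun z => F z * G z) (fun z => F' z * G z + F z * G' z).
Proof.
move=> [cF cF' hF bF] [cG cG' hG bG]; split.
- by move=> D k ck; apply: ccontM; [exact: cF|exact: cG].
- by move=> D k ck; apply: ccontD; apply: ccontM;
    [exact: cF'|exact: cG|exact: cF|exact: cG'].
- move=> k x d kd; rewrite (_ : _ * d = F' (k x) * d * G (k x) + F (k x) * (G' (k x) * d)).
    by apply: cderivM; [exact: hF|exact: hG].
  by ring.
- move=> M; have [A HA] := bF M; have [B HB] := bG M.
  (* The second order remainder of a product splits into three terms, each at most A B |w - z|^2: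
     the two remainders times the other factor, and the product of F' with the increment of G. *)
  exists (3 * (A * B)) => z w zM wM.
  have [a1 a2 a3 a4] := HA _ _ zM wM; have [b1 b2 b3 b4] := HB _ _ zM wM.
  have [b1' _ _ _] := HB _ _ wM zM; have [a1' _ _ _] := HA _ _ wM zM.
  have A0 := le_trans (cnorm1_ge0 _) a1; have B0 := le_trans (cnorm1_ge0 _) b1.
  have AB0 : 0 <= A * B by rewrite mulr_ge0.
  have pM (x y : R[i]) X Y : cnorm1 x <= X -> cnorm1 y <= Y -> cnorm1 (x * y) <= X * Y.
    by move=> hx hy; apply: le_trans (ler_cnorm1M _ _) (ler_pM _ _ hx hy); exact: cnorm1_ge0.
  have pD (x y : R[i]) X Y : cnorm1 x <= X -> cnorm1 y <= Y -> cnorm1 (x + y) <= X + Y.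
    by move=> hx hy; apply: le_trans (ler_cnorm1D _ _) (lerD hx hy).
  set d := cnorm1 (w - z) in a3 a4 b3 b4 *.
  have d0 : 0 <= d := cnorm1_ge0 _.
  split.
  + by apply: le_trans (pM _ _ _ _ a1 b1) _; lra.
  + by apply: le_trans (pD _ _ _ _ (pM _ _ _ _ a2 b1) (pM _ _ _ _ a1 b2)) _; lra.
  + rewrite (_ : _ - _ = F w * (G w - G z) + (F w - F z) * G z); last by ring.
    apply: le_trans (pD _ _ _ _ (pM _ _ _ _ a1' b3) (pM _ _ _ _ a3 b1)) _.
    have : 0 <= A * B * d by rewrite mulr_ge0.
    rewrite (_ : A * (B * d) = A * B * d); last by rewrite mulrA.
    rewrite (_ : A * d * B = A * B * d); last by rewrite mulrAC.
    rewrite -(mulrA 3); set t := A * B * d; lra.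
  + rewrite (_ : _ - _ - _ = (F w - F z - (w - z) * F' z) * G w +
        F z * (G w - G z - (w - z) * G' z) + (w - z) * (F' z * (G w - G z))); last by ring.
    apply: le_trans (pD _ _ _ _ (pD _ _ _ _ (pM _ _ _ _ a4 b1') (pM _ _ _ _ a1 b4))
      (pM _ _ _ _ (lexx d) (pM _ _ _ _ a2 b3))) _.
    by rewrite le_eqVlt; apply/orP; left; apply/eqP; ring.
Qed.

Lemma entire_comp F F' G G' : entire F F' -> entire G G' ->
  entire (fun z => G (F z)) (fun z => G' (F z) * F' z).
Proof.
move=> [cF cF' hF bF] [cG cG' hG bG]; split.
- by move=> D k ck; apply: cG; exact: cF.
- by move=> D k ck; apply: ccontM; [apply: cG'; exact: cF|exact: cF'].
- by move=> k x d kd; rewrite -mulrA; apply: (hG (fun y => F (k y))); exact: hF.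
(* A bounds F on the ball of radius M, so it is the radius on which G is estimated. In the constant
   below, 1 serves the bound of G, A the term G' times the remainder of F, and A^2 the remainder of
   G at increments of size A |w - z|. *)
- move=> M; have [A HA] := bF M; have [B HB] := bG A.
  exists (B * (1 + A + A ^+ 2)) => z w zM wM.
  have [a1 a2 a3 a4] := HA _ _ zM wM; have [a1' _ _ _] := HA _ _ wM zM.
  have [b1 b2 b3 b4] := HB _ _ a1 a1'.
  have A0 := le_trans (cnorm1_ge0 _) a1; have B0 := le_trans (cnorm1_ge0 _) b1.
  have pM (x y : R[i]) X Y : cnorm1 x <= X -> cnorm1 y <= Y -> cnorm1 (x * y) <= X * Y.
    by move=> hx hy; apply: le_trans (ler_cnorm1M _ _) (ler_pM _ _ hx hy); exact: cnorm1_ge0.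
  set d := cnorm1 (w - z) in a3 a4 *; set e := cnorm1 (F w - F z) in a3 b3 b4.
  have d0 : 0 <= d := cnorm1_ge0 _; have e0 : 0 <= e := cnorm1_ge0 _.
  have A2 : 0 <= A ^+ 2 by rewrite exprn_ge0.
  have BA : 0 <= B * A by rewrite mulr_ge0.
  have BA2 : 0 <= B * A ^+ 2 by rewrite mulr_ge0.
  split.
  + by apply: le_trans b1 _; lra.
  + by apply: le_trans (pM _ _ _ _ b2 a2) _; lra.
  + apply: le_trans b3 _; apply: le_trans (ler_wpM2l B0 a3) _.
    by rewrite mulrA ler_wpM2r //; lra.
  + rewrite (_ : _ - _ - _ = G (F w) - G (F z) - (F w - F z) * G' (F z) +
        G' (F z) * (F w - F z - (w - z) * F' z)); last by ring.
    apply: le_trans (ler_cnorm1D _ _) _.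
    apply: le_trans (lerD b4 (pM _ _ _ _ b2 a4)) _.
    have e2 : e ^+ 2 <= A ^+ 2 * d ^+ 2 by rewrite -exprMn lerXn2r // ?nnegrE ?mulr_ge0.
    apply: le_trans (lerD (ler_wpM2l B0 e2) (lexx _)) _.
    rewrite -mulrDr -mulrDl mulrA.
    by rewrite ler_wpM2r ?exprn_ge0 // ler_wpM2l //; lra.
Qed.

End Entire.

Section EntireExp.
Context {R : realType}.
Implicit Types (F G : R[i] -> R[i]).

(** By multiplicativity it suffices to expand at 0: the increment from z to w is [cexp z] times that
    from 0 to w - z. The expansion at 0 follows from those of the real functions exp, cos and
    sin. *)
Lemma entire_cexp : entire (cexp : R[i] -> R[i]) cexp.
Proof.
split; [exact: ccont_cexp|exact: ccont_cexp|exact: cderiv_cexp|].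
move=> M.
(* The radius is doubled because the expansion is applied to w - z. *)
pose E := expR (2 * `|M|).
have E1 : 1 <= E by rewrite -expR0 ler_expR mulr_ge0.
have bexp x : `|x| <= 2 * `|M| -> `|expR x| <= E.
  by move=> xM; rewrite ger0_norm ?expR_ge0 // ler_expR (le_trans (ler_norm _)).
have bcos (x : R) : `|cos x| <= 1 by rewrite ler_norml cos_geN1 cos_le1.
have bsin (x : R) : `|sin x| <= 1 by rewrite ler_norml sin_geN1 sin_le1.
have dsin (x : R) : is_derive x 1 sin (cos x) := is_derive_sin x.
have dcos (x : R) : is_derive x 1 cos (- sin x) := is_derive_cos x.
have dexp (x : R) : is_derive x 1 expR (expR x) := is_derive_expR x.
have dNsin (x : R) : is_derive x 1 (fun x => - sin x) (- cos x).
  exact: is_deriveN.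
have cexp_le z : cnorm1 z <= M -> cnorm1 (cexp z) <= 2 * E.
  move=> zM; rewrite /cnorm1 Re_cexp Im_cexp !normrM.
  have hE : `|expR (Re z)| <= E.
    apply: bexp; have := normr_ge0 (Im z); have := normr_ge0 M; have := ler_norm M.
    by move: zM; rewrite /cnorm1; lra.
  rewrite mulrDl mul1r; apply: lerD; rewrite -[leRHS]mulr1;
    by apply: ler_pM.
have rem h : cnorm1 h <= 2 * `|M| ->
    cnorm1 (cexp h - 1 - h) <= (4 * E) * cnorm1 h ^+ 2 /\
    cnorm1 (cexp h - 1) <= (2 * E) * cnorm1 h.
  case: h => a b; rewrite /cnorm1 /= => hM.
  have aM : `|a| <= 2 * `|M| by apply: le_trans hM; rewrite lerDl.
  have bM : `|b| <= 2 * `|M| by apply: le_trans hM; rewrite lerDr.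
  have z0 : `|0 : R| <= 2 * `|M| by rewrite normr0 mulr_ge0.
  have e2 := taylor2_bound dexp dexp bexp z0 aM.
  have c2 := taylor2_bound dcos dNsin (C := 1) (M := 2 * `|M|) _ z0 bM.
  have s2 := taylor2_bound dsin dcos (C := 1) (M := 2 * `|M|) _ z0 bM.
  rewrite !subr0 expR0 mulr1 in e2.
  rewrite !subr0 cos0 sin0 oppr0 mulr0 subr0 mul1r in c2.
  rewrite !subr0 sin0 cos0 mulr1 subr0 mul1r in s2.
  have {}c2 : `|cos b - 1| <= b ^+ 2 by apply: c2 => x _; rewrite normrN.
  have {}s2 : `|sin b - b| <= b ^+ 2 by apply: s2 => x _; rewrite normrN.
  have e1 : `|expR a - 1| <= E * `|a|.
    have [c ca] := mean_value 0 a dexp.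
    rewrite expR0 subr0 => ->; rewrite normrM ler_wpM2r //.
    by apply: bexp; apply: minmax_norm_le ca z0 aM.
  have c1 : `|cos b - 1| <= `|b|.
    have [c ca] := mean_value 0 b dcos.
    by rewrite cos0 subr0 => ->; rewrite normrM -[leRHS]mul1r ler_wpM2r // normrN.
  have s1 : `|sin b| <= `|b|.
    have [c ca] := mean_value 0 b dsin.
    by rewrite sin0 !subr0 => ->; rewrite normrM -[leRHS]mul1r ler_wpM2r.
  have ea : `|expR a| <= E by exact: bexp.
  have a0 := normr_ge0 a; have b0 := normr_ge0 b.
  have a2 : a ^+ 2 = `|a| ^+ 2 by rewrite real_normK ?num_real.
  have b2 : b ^+ 2 = `|b| ^+ 2 by rewrite real_normK ?num_real.
  rewrite !mul0r !subr0 addr0; split.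
  - rewrite (_ : expR a * cos b - 1 - a =
        expR a * (cos b - 1) + (expR a - 1 - a)); last by ring.
    rewrite [X in _ + `|X| <= _](_ : _ =
        expR a * (sin b - b) + (expR a - 1) * b); last by ring.
    have h1 : `|expR a * (cos b - 1) + (expR a - 1 - a)| <= E * `|b| ^+ 2 + E * `|a| ^+ 2.
      apply: le_trans (ler_normD _ _) _; apply: lerD; last by rewrite -a2.
      by rewrite normrM -b2 ler_pM.
    have h2 : `|expR a * (sin b - b) + (expR a - 1) * b| <= E * `|b| ^+ 2 + E * `|a| * `|b|.
      apply: le_trans (ler_normD _ _) _; apply: lerD; rewrite normrM; last first.
        by rewrite ler_wpM2r.
      by rewrite -b2 ler_pM.
    apply: le_trans (lerD h1 h2) _.
    have EE : 0 <= E by exact: expR_ge0.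
    have p1 : 0 <= E * `|a| ^+ 2 by rewrite mulr_ge0 ?exprn_ge0.
    have p2 : 0 <= E * `|b| ^+ 2 by rewrite mulr_ge0 ?exprn_ge0.
    have p3 : 0 <= E * `|a| * `|b| by rewrite !mulr_ge0.
    by rewrite sqrrD; lra.
  - rewrite (_ : expR a * cos b - 1 = expR a * (cos b - 1) + (expR a - 1)); last by ring.
    rewrite [X in _ + `|X| <= _](_ : _ = expR a * sin b); last by ring.
    have h1 : `|expR a * (cos b - 1) + (expR a - 1)| <= E * `|b| + E * `|a|.
      apply: le_trans (ler_normD _ _) _; apply: lerD => //.
      by rewrite normrM ler_pM.
    have h2 : `|expR a * sin b| <= E * `|b| by rewrite normrM ler_pM.
    apply: le_trans (lerD h1 h2) _.
    have p1 : 0 <= E * `|a| by rewrite mulr_ge0 ?expR_ge0.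
    by lra.
(* The bound 2 E of [cexp z] times the constant 4 E of the second order remainder. *)
exists (8 * E ^+ 2) => z w zM wM.
have E0 : 0 <= E by exact: expR_ge0.
have EE : E <= E ^+ 2 by rewrite expr2 ler_peMl.
have dM : cnorm1 (w - z) <= 2 * `|M|.
  apply: le_trans (ler_cnorm1D _ _) _; rewrite cnorm1N.
  by have := ler_norm M; lra.
have [r1 r2] := rem _ dM.
have d0 := cnorm1_ge0 (w - z).
have cE := cexp_le _ zM.
have ez : cexp w = cexp z * cexp (w - z) by rewrite -cexpD addrC subrK.
split.
- by apply: le_trans cE _; lra.
- by apply: le_trans cE _; lra.
- rewrite ez (_ : _ - _ = cexp z * (cexp (w - z) - 1)); last by ring.
  apply: le_trans (ler_cnorm1M _ _) _.
  apply: le_trans (ler_pM (cnorm1_ge0 _) (cnorm1_ge0 _) cE r2) _.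
  rewrite mulrA ler_wpM2r //.
  by rewrite (_ : 2 * E * (2 * E) = 4 * E ^+ 2); [have := sqr_ge0 E; lra|ring].
- rewrite ez (_ : _ - _ - _ = cexp z * (cexp (w - z) - 1 - (w - z))); last by ring.
  apply: le_trans (ler_cnorm1M _ _) _.
  apply: le_trans (ler_pM (cnorm1_ge0 _) (cnorm1_ge0 _) cE r1) _.
  by rewrite le_eqVlt; apply/orP; left; apply/eqP; ring.
Qed.

Lemma entire_linear (a b : R[i]) : entire (fun z => a + b * z) (fun=> b).
Proof.
apply: eq_entire (entireD (entire_cst a) (entireM (entire_cst b) entire_id)) => // z.
by rewrite mul0r !add0r mulr1.
Qed.

Lemma entire_exp_quadratic (a b : R[i]) :
  exists F', entire (fun z => cexp (a * z ^+ 2 + b * z)) F'.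
Proof.
eexists; apply: entire_comp entire_cexp.
apply: entireD; first exact: (entireM (entire_cst a) (entireM entire_id entire_id)).
exact: (entireM (entire_cst b) entire_id).
Qed.

Lemma entire_prod (I : Type) (r : seq I) (f : I -> R[i] -> R[i]) :
  (forall i, exists f', entire (f i) f') ->
  exists F', entire (fun z => \prod_(i <- r) f i z) F'.
Proof.
move=> ef; elim: r => [|i r [G' eG]].
  by exists (fun=> 0); apply: eq_entire (entire_cst 1) => // z; rewrite big_nil.
have [f' ei] := ef i; eexists.
by apply: eq_entire (entireM ei eG) => // z; rewrite big_cons.
Qed.

End EntireExp.

(** * The fundamental theorem of calculus along piecewise C1 contours *)

Section RealPieces.
Context {R : realType}.
Notation mu := (@lebesgue_measure R).
Implicit Types (f h Phi : R -> R) (p q r : R).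

Lemma continuous_rintegrable p q f : {within `[p, q], continuous f} ->
  rintegrable `[p, q] f.
Proof. by move=> cf; apply: continuous_compact_integrable => //; exact: segment_compact. Qed.

(** The derivative of a contour is controlled only in the open pieces; the breakpoints, where it may
    take any value, are negligible. *)
Lemma eq_oo_integral p q f h : {within `[p, q], continuous h} ->
  (forall x, x \in `]p, q[ -> f x = h x) ->
  rintegrable `[p, q] f /\
  \int[mu]_(x in `[p, q]) f x = \int[mu]_(x in `[p, q]) h x.
Proof.
move=> ch fh; have ih := continuous_rintegrable ch.
have /integrableP[/measurable_EFinP mh hoo] := ih.
have moh : measurable_fun `]p, q[ h.
  by apply: measurable_funS mh => //; exact: subset_itv_oo_cc.
have mof : measurable_fun `]p, q[ f.
  by apply: eq_measurable_fun moh => x /[!inE] /= xpq; rewrite fh.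
split; last first.
  rewrite /Rintegral (eq_integral_itv_bounded true false mof moh) //.
have mf : measurable_fun `[p, q] f := measurable_fun_itv_cc mof.
apply/integrableP; split; first exact/measurable_EFinP.
apply: le_lt_trans hoo; rewrite le_eqVlt; apply/orP; left; apply/eqP.
apply: (@eq_integral_itv_bounded _ p q (fun x => `|h x|) (fun x => `|f x|) true false).
- exact: measurableT_comp.
- exact: measurableT_comp.
- by move=> x xpq; rewrite fh.
Qed.

Lemma integral_derive_piece p q f h Phi : p < q ->
  {within `[p, q], continuous h} -> (forall x, x \in `]p, q[ -> f x = h x) ->
  {within `[p, q], continuous Phi} ->
  (forall x, x \in `]p, q[ -> is_derive x 1 Phi (f x)) ->
  \int[mu]_(x in `[p, q]) f x = Phi q - Phi p.
Proof.
move=> pq ch fh cP dP; rewrite (eq_oo_integral ch fh).2.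
rewrite /Rintegral (@continuous_FTC2 _ h Phi p q) //.
- move/continuous_within_itvP : cP => /(_ pq)[_ cp cq].
  by split => // x xpq; have [] := dP x xpq.
- by move=> x xpq; rewrite derive1E -fh //; have [_ ->] := dP x xpq.
Qed.

Lemma itv_cc_split p q r : p < q -> q < r ->
  `[p, r]%classic = `[p, q]%classic `|` `]q, r]%classic.
Proof. by move=> pq qr; rewrite -itv_bndbnd_setU ?bnd_simp ?ltW. Qed.

Lemma disjoint_itv_cc_oc p q r : [disjoint `[p, q]%classic & `]q, r]%classic].
Proof.
apply/disj_setPS => x [/=]; rewrite !in_itv /= => /andP[_ xq] /andP[qx _].
by rewrite leNgt qx in xq.
Qed.

Lemma rintegrable_cat p q r f : p < q -> q < r ->
  rintegrable `[p, q] f -> rintegrable `[q, r] f -> rintegrable `[p, r] f.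
Proof.
move=> pq qr i1 i2; rewrite (itv_cc_split pq qr).
have {}i2 : rintegrable `]q, r] f.
  by apply: integrableS i2 => //; apply: subset_itvr; rewrite bnd_simp.
move: i1 i2 => /integrableP[m1 h1] /integrableP[m2 h2].
have mU : measurable_fun (`[p, q] `|` `]q, r]) (EFin \o f) by apply/measurable_funU.
apply/integrableP; split => //.
rewrite ge0_integral_setU //; first exact: lte_add_pinfty.
- exact: measurableT_comp.
- exact: disjoint_itv_cc_oc.
Qed.

Lemma Rintegral_cat p q r f : p < q -> q < r ->
  rintegrable `[p, q] f -> rintegrable `[q, r] f ->
  \int[mu]_(x in `[p, r]) f x =
  \int[mu]_(x in `[p, q]) f x + \int[mu]_(x in `[q, r]) f x.
Proof.
move=> pq qr i1 i2; have i12 := rintegrable_cat pq qr i1 i2.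
have -> : \int[mu]_(x in `[q, r]) f x = \int[mu]_(x in `]q, r]) f x.
  rewrite Rintegral_itv_obnd_cbnd //.
  by apply: integrableS i2 => //; apply: subset_itvr; rewrite bnd_simp.
rewrite (itv_cc_split pq qr) Rintegral_setU //; last exact: disjoint_itv_cc_oc.
by rewrite -itv_cc_split.
Qed.

End RealPieces.

Section Contours.
Context {R : realType}.
Implicit Types (g : R -> R[i]) (k Phi : R -> R[i]).

Lemma Re_le_normc (z : R[i]) : (`|Re z|%:C <= `|z|)%R.
Proof.
case: z => x y /=; rewrite normc_def lecR -sqrtr_sqr ler_wsqrtr //.
by rewrite lerDl sqr_ge0.
Qed.

Lemma Im_le_normc (z : R[i]) : (`|Im z|%:C <= `|z|)%R.
Proof.
case: z => x y /=; rewrite normc_def lecR -sqrtr_sqr ler_wsqrtr //.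
by rewrite lerDr sqr_ge0.
Qed.

Lemma continuous_Re : continuous (@complex.Re R : R[i]^o -> R).
Proof.
move=> z; have FF : Filter (nbhs (z : R[i]^o)) by exact: nbhs_filter.
apply/(@cvgrPdist_lt _ _ _ _ FF) => e e0.
have e0' : (0 < e%:C :> R[i]) by rewrite ltcR.
apply/(@nbhs_ballP _ R[i]^o); exists e%:C => //= w zw; rewrite -ltcR.
have -> : Re z - Re w = Re (z - w) by rewrite cReD cReN.
exact: le_lt_trans (Re_le_normc _) zw.
Qed.

Lemma continuous_Im : continuous (@complex.Im R : R[i]^o -> R).
Proof.
move=> z; have FF : Filter (nbhs (z : R[i]^o)) by exact: nbhs_filter.
apply/(@cvgrPdist_lt _ _ _ _ FF) => e e0.
have e0' : (0 < e%:C :> R[i]) by rewrite ltcR.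
apply/(@nbhs_ballP _ R[i]^o); exists e%:C => //= w zw; rewrite -ltcR.
have -> : Im z - Im w = Im (z - w) by rewrite cImD cImN.
exact: le_lt_trans (Im_le_normc _) zw.
Qed.

Lemma within_ccont D (k : R -> R[i]^o) : {within D, continuous k} -> ccont D k.
Proof.
move=> ck; split=> x.
- by apply: (@continuous_comp _ _ _ (k : subspace D -> R[i]^o) (@complex.Re R)); [exact: ck|exact: continuous_Re].
- by apply: (@continuous_comp _ _ _ (k : subspace D -> R[i]^o) (@complex.Im R)); [exact: ck|exact: continuous_Im].
Qed.

Lemma path_lt_last (x : R) (s : seq R) : path <%R x s -> x <= last x s.
Proof.
elim: s x => //= y s ih x /andP[xy /ih ys].
exact: le_trans (ltW xy) ys.
Qed.

(** Transfers a property stable under concatenation from the C1 pieces to [0, 1]. The bounds 0 and 1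
    are carried along so that continuity on [0, 1] can be restricted to each piece. *)
Lemma piecewise_ind g (P : R -> R -> Prop) : piecewise_C1 g ->
  (forall p q, 0 <= p -> p < q -> q <= 1 -> C1_on g p q -> P p q) ->
  (forall p q r, 0 <= p -> p < q -> q < r -> r <= 1 -> P p q -> P q r -> P p r) ->
  P 0 1.
Proof.
move=> [s [ps sE C1]] base cat; have s0 : s != [::].
  by apply/eqP => s0; move: sE; rewrite s0 /= => /eqP; rewrite eq_sym oner_eq0.
suff gen x : 0 <= x -> last x s <= 1 -> path <%R x s ->
    (forall i, (i < size s)%N -> C1_on g (nth 0 (x :: s) i) (nth 0 s i)) ->
    P x (last x s) by have := gen 0; rewrite sE; apply.
elim: s x {ps sE C1} s0 => // y s ih x _ x0 l1 /= /andP[xy ys] C1.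
have [s0|s0] := eqVneq s [::].
  by move: l1; rewrite s0 /= => y1; apply: base => //; exact: (C1 0%N).
have y0 : 0 <= y := le_trans x0 (ltW xy).
have yl : y < last y s.
  by case: s s0 ys {ih C1 l1} => // z s _ /= /andP[yz /path_lt_last]; exact: lt_le_trans.
apply: (cat _ y) => //; last by apply: ih => // i; exact: (C1 i.+1).
by apply: base => //; [exact: le_trans (ltW yl) l1|exact: (C1 0%N)].
Qed.

Lemma cnorm1_real (x : R) (z : R[i]) : cnorm1 (x%:C * z) = `|x| * cnorm1 z.
Proof. by rewrite /cnorm1 !cReIm /= !mul0r subr0 addr0 !normrM mulrDr. Qed.

Lemma ccont_bounded (p q : R) k : p <= q -> ccont `[p, q] k ->
  exists2 M, 0 <= M & forall x, x \in `[p, q] -> cnorm1 (k x) <= M.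
Proof.
move=> pq ck.
have c1 : {within `[p, q], continuous (fun x => cnorm1 (k x))}.
  apply/subspace_continuousP => x xpq; have [rk ik] := (ccontP _ _).1 ck x xpq.
  by apply: cvgD; exact: cvg_norm.
have [c _ hc] := EVT_max pq c1.
by exists (cnorm1 (k c)) => //; exact: cnorm1_ge0.
Qed.

Section Curve.
Variable g : R -> R[i].
Hypothesis gP : piecewise_C1 g.
Notation Igr k := (Cintegral `[0, 1] (fun x => k x * Cderive g x)).

Lemma C1_on_cderiv p q x : C1_on g p q -> x \in `]p, q[ -> cderiv g x (Cderive g x).
Proof.
move=> [dg _] /dg [dr di]; by split; rewrite /= derive1E; apply: derivableP; [exact: dr|exact: di].
Qed.

Lemma contour_integrable_piece p q k : C1_on g p q -> ccont `[p, q] k ->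
  exists2 h, ccont `[p, q] h & forall x, x \in `]p, q[ -> k x * Cderive g x = h x.
Proof.
move=> [_ [g' cg' gE]] ck; exists (fun x => k x * g' x).
  by apply: ccontM => //; exact: within_ccont.
by move=> x xpq; rewrite gE.
Qed.

Lemma contour_integrable k : ccont `[0, 1] k ->
  cintegrable `[0, 1] (fun x => k x * Cderive g x).
Proof.
move=> ck.
apply: (piecewise_ind (P := fun p q => cintegrable `[p, q] (fun x => k x * Cderive g x)) gP).
  move=> p q p0 pq q1 C1.
  have ckpq : ccont `[p, q] k.
    apply: ccontS ck => x /=; rewrite !in_itv /= => /andP[px xq].
    by rewrite (le_trans p0) // (le_trans xq).
  have [h [rh ih] hE] := contour_integrable_piece C1 ckpq.
  split.
    by apply: (eq_oo_integral rh _).1 => x xpq; rewrite hE.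
  by apply: (eq_oo_integral ih _).1 => x xpq; rewrite hE.
move=> p q r p0 pq qr r1 [i1 i2] [j1 j2].
by split; apply: (rintegrable_cat pq qr).
Qed.

(** The primitive [Phi] is a function of the parameter, not of the point, so a branch of the
    logarithm along the curve is admissible. Continuity of [Phi] makes the increments of the pieces
    telescope. *)
Lemma contour_derive k Phi : ccont `[0, 1] k -> ccont `[0, 1] Phi ->
  (forall x d, x \in `]0, 1[ -> cderiv g x d -> cderiv Phi x (k x * d)) ->
  Igr k = Phi 1 - Phi 0.
Proof.
move=> ck cP dP.
pose P p q := cintegrable `[p, q] (fun x => k x * Cderive g x) /\
  Cintegral `[p, q] (fun x => k x * Cderive g x) = Phi q - Phi p.
suff [] : P 0 1 by [].
apply: (piecewise_ind gP) => [p q p0 pq q1 C1|p q r p0 pq qr r1 [[i1 i2] e1] [[j1 j2] e2]]; last first.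
  split; first by split; exact: (rintegrable_cat pq qr).
  have -> : Phi r - Phi p = (Phi q - Phi p) + (Phi r - Phi q) by ring.
  by rewrite -e1 -e2; apply: complex_eqP; rewrite cReIm /=; exact: Rintegral_cat.
have spq : `[p, q] `<=` `[0, 1].
  by move=> x /=; rewrite !in_itv /= => /andP[px xq]; rewrite (le_trans p0) // (le_trans xq).
have [h [rh ih] hE] := contour_integrable_piece C1 (ccontS spq ck).
have [rP iP] := ccontS spq cP.
have dPx x : x \in `]p, q[ -> cderiv Phi x (k x * Cderive g x).
  move=> xpq; apply: dP; last exact: C1_on_cderiv xpq.
  by move: xpq; rewrite !in_itv /= => /andP[px xq]; rewrite (le_lt_trans p0) // (lt_le_trans xq).
split; first split.
- by apply: (eq_oo_integral rh _).1 => x xpq; rewrite hE.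
- by apply: (eq_oo_integral ih _).1 => x xpq; rewrite hE.
- apply: complex_eqP; rewrite ?(cReD, cImD) ?(cReN, cImN).
    apply: (integral_derive_piece pq rh _ rP) => x xpq; first by rewrite hE.
    exact: (dPx x xpq).1.
  apply: (integral_derive_piece pq ih _ iP) => x xpq; first by rewrite hE.
  exact: (dPx x xpq).2.
Qed.

(** B is twice the l1 length of the curve: the real and the imaginary part of the integral are each
    at most e times this length. *)
Lemma contour_bound : exists2 B, 0 <= B & forall k e, ccont `[0, 1] k ->
  (forall x, x \in `[0, 1] -> cnorm1 (k x) <= e) -> cnorm1 (Igr k) <= e * B.
Proof.
have [i1 i2] : cintegrable `[0, 1] (Cderive g).
  apply: eq_cintegrable (contour_integrable (ccont_cst `[0, 1] 1)) => // x _.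
  by rewrite mul1r.
have j1 : rintegrable `[0, 1] (fun x => cnorm1 (Cderive g x)).
  exact: (rintegrableD _ (integrable_norm i1) (integrable_norm i2)).
pose B := \int[@lebesgue_measure R]_(x in `[0, 1]) cnorm1 (Cderive g x).
have B0 : 0 <= B by apply: Rintegral_ge0 => x _; exact: cnorm1_ge0.
exists (2 * B) => [|k e ck ke]; first by rewrite mulr_ge0.
have e0 : 0 <= e.
  by apply: le_trans (cnorm1_ge0 _) (ke 0 _); rewrite in_itv /= lexx ler01.
have [k1 k2] := contour_integrable ck.
have je : rintegrable `[0, 1] (fun x => e * cnorm1 (Cderive g x)).
  exact: rintegrableZl.
have bd (u : R -> R) : rintegrable `[0, 1] u ->
    (forall x, x \in `[0, 1] -> `|u x| <= cnorm1 (k x * Cderive g x)) ->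
    `|\int[@lebesgue_measure R]_(x in `[0, 1]) u x| <= e * B.
  move=> iu uk; apply: le_trans (le_normr_Rintegral _ iu) _ => //.
  rewrite -RintegralZl //; apply: le_Rintegral => //; first exact: integrable_norm.
  move=> x x01; apply: le_trans (uk _ x01) _; apply: le_trans (ler_cnorm1M _ _) _.
  by rewrite ler_wpM2r ?cnorm1_ge0 // ke.
rewrite /cnorm1 (_ : e * (2 * B) = e * B + e * B); last by ring.
apply: lerD; apply: bd => // x _; rewrite /cnorm1; [rewrite lerDl|rewrite lerDr]; exact: normr_ge0.
Qed.

End Curve.
End Contours.

(** * Cauchy's formula for entire functions *)

Lemma partial_fraction_id (K : fieldType) (r a q z f d : K) :
  z != a -> z != q -> a != q ->
  r / (z - a) * (f / (z - q)) * d =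
  r / (a - q) * (f / (z - a) * d) + - (r / (a - q)) * (f / (z - q) * d).
Proof. by move=> za zq aq; field; rewrite !subr_eq0 za zq aq. Qed.

Section Cauchy.
Context {R : realType}.
Variable g : R -> R[i].
Hypotheses (gP : piecewise_C1 g) (cg : ccont `[0, 1] g) (g01 : g 0 = g 1).

(** The curve stays on one side of the vertical line through q, where ln |z - q| + i atan (Y / X) is
    a continuous logarithm up to a constant; it takes the same value at both ends of the closed
    curve. *)
Lemma contour_inv_eq0 (q : R[i]) : (forall x, x \in `[0, 1] -> Re (g x) != Re q) ->
  contour_integral g (fun z => (z - q)^-1) = 0.
Proof.
move=> gq.
pose X x := Re (g x) - Re q; pose Y x := Im (g x) - Im q.
have X0 x : x \in `[0, 1] -> X x != 0 by move=> /gq; rewrite subr_eq0.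
have N0 x : x \in `[0, 1] -> 0 < X x ^+ 2 + Y x ^+ 2.
  by move=> /X0 x0; rewrite ltr_wpDr ?sqr_ge0 // exprn_even_gt0.
have gqE x : g x - q = X x +i* Y x by apply: complex_eqP; rewrite !cReIm.
have nz x : x \in `[0, 1] -> g x - q != 0.
  by move=> x01; apply: complex_neq0_Re; rewrite gqE; exact: X0.
(* a branch of log (g - q) on the half plane containing the contour *)
pose Phi x : R[i] := (ln (X x ^+ 2 + Y x ^+ 2) / 2) +i* atan (Y x / X x).
have cgq : ccont `[0, 1] (fun x => g x - q).
  by apply: ccontD => //; exact: (ccont_cst _ (- q)).
rewrite /contour_integral (contour_derive gP (Phi := Phi)).
- by rewrite /Phi /X /Y g01 subrr.
- by apply: ccontV.
- apply/ccontP => x x01.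
  have [/= rg ig] := (ccontP _ _).1 cgq x x01.
  have rX : X y @[y --> within `[0, 1]%classic (nbhs x)] --> X x.
    by move: rg; rewrite gqE; under eq_fun do rewrite gqE.
  have rY : Y y @[y --> within `[0, 1]%classic (nbhs x)] --> Y x.
    by move: ig; rewrite gqE; under eq_fun do rewrite gqE.
  split.
    apply: cvgMr_tmp; apply: continuous_cvg; first by apply: continuous_ln; exact: N0.
    by apply: cvgD; rewrite expr2; apply: cvgM.
  apply: continuous_cvg; first exact: continuous_atan.
  by apply: cvgM => //; apply: cvgV => //; exact: X0.
- move=> x d x01 [rd id].
  have x01' : x \in `[0, 1] by move: x01; rewrite !in_itv /= => /andP[/ltW-> /ltW].
  have dX : is_derive x 1 X (Re d) by apply: is_derive_eq; rewrite subr0.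
  have dY : is_derive x 1 Y (Im d) by apply: is_derive_eq; rewrite subr0.
  have dN : is_derive x 1 (fun y => X y ^+ 2 + Y y ^+ 2) (2 * X x * Re d + 2 * Y x * Im d).
    by apply: is_derive_eq; rewrite /GRing.scale /=; ring.
  have dV : is_derive x 1 (fun y => (X y)^-1) (- (X x) ^- 2 * Re d).
    exact: is_deriveV (X0 x x01') dX.
  have dq : is_derive x 1 (fun y => Y y / X y) ((Im d * X x - Y x * Re d) / X x ^+ 2).
    by apply: is_derive_eq; rewrite /GRing.scale /=; field; exact: X0.
  have nN : X x ^+ 2 + Y x ^+ 2 != 0 by rewrite gt_eqF ?N0.
  have dl := is_derive1_comp (g := fun y => X y ^+ 2 + Y y ^+ 2) (is_derive1_ln (N0 x x01')) dN.
  have da := is_derive1_comp (g := fun y => Y y / X y) (is_derive1_atan (Y x / X x)) dq.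
  have XX := X0 x x01'.
  split; rewrite /= gqE /=.
    apply: is_derive_eq.
    by rewrite /GRing.scale /= !cReIm /=; field.
  apply: is_derive_eq.
  by rewrite !cReIm /=; field; rewrite nN XX.
Qed.

(* With I(t) the integral of F (p + t (z - p)) / (z - p), a second order
   expansion of F gives |I(y) - I(x)| = O((y - x)^2), since F' has a primitive
   along the closed contour; hence I(1) = I(0). *)
Lemma contour_cauchy (F F' : R[i] -> R[i]) (p : R[i]) : entire F F' ->
  (forall x, x \in `[0, 1] -> g x != p) ->
  contour_integral g (fun z => F z / (z - p)) =
  F p * contour_integral g (fun z => (z - p)^-1).
Proof.
move=> eF gp.
have nz x : x \in `[0, 1] -> g x - p != 0 by move=> /gp; rewrite subr_eq0.
have cgp : ccont `[0, 1] (fun x => g x - p).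
  by apply: ccontD => //; exact: (ccont_cst _ (- p)).
have cV : ccont `[0, 1] (fun x => (g x - p)^-1) by apply: ccontV.
(* The homothety of centre p deforms the contour, at t = 1, into the point p, at t = 0, where F is
   constant. *)
pose z_ (t : R) x : R[i] := p + t%:C * (g x - p).
have cz t : ccont `[0, 1] (z_ t).
  by apply: ccontD; [exact: ccont_cst|apply: ccontM => //; exact: ccont_cst].
pose I t := Cintegral `[0, 1] (fun x => F (z_ t x) / (g x - p) * Cderive g x).
have ck t : ccont `[0, 1] (fun x => F (z_ t x) / (g x - p)).
  by apply: ccontM => //; exact: (entire_cont eF).
suff I10 : I 1 = I 0.
  transitivity (I 1).
    by apply: eq_Cintegral => x _; rewrite /z_ mul1r addrCA subrr addr0.
  rewrite I10 /I -CintegralZl; [|exact: measurable_itv|exact: contour_integrable].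
  by apply: eq_Cintegral => x _; rewrite /z_ mul0r addr0 mulrA.
(* For t non-zero F (z_t) / t is a primitive along the curve; at t = 0 the factor F' p is constant
   and F' p times g is a primitive. *)
have J0 t : Cintegral `[0, 1] (fun x => F' (z_ t x) * Cderive g x) = 0.
  have [->|t0] := eqVneq t 0.
    rewrite (contour_derive gP (Phi := fun x => F' p * g x)).
    - by rewrite g01 subrr.
    - exact: (entire_cont' eF).
    - by apply: ccontM => //; exact: ccont_cst.
    - move=> x d _ gd; rewrite /z_ mul0r addr0 -[F' p * d]add0r -[0 in X in cderiv _ _ X](mul0r (g x)).
      by apply: cderivM => //; exact: cderiv_cst.
  rewrite (contour_derive gP (Phi := fun x => (t^-1)%:C * F (z_ t x))).
  - by rewrite /z_ g01 subrr.
  - exact: (entire_cont' eF).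
  - by apply: ccontM; [exact: ccont_cst|exact: (entire_cont eF)].
  - move=> x d _ gd.
    have -> : F' (z_ t x) * d = 0 * F (z_ t x) + (t^-1)%:C * (F' (z_ t x) * (t%:C * d)).
      have tt : (t^-1)%:C * t%:C = 1 :> R[i] by rewrite -rmorphM mulVf.
      by transitivity (F' (z_ t x) * d * ((t^-1)%:C * t%:C)); [rewrite tt mulr1|ring].
    apply: cderivM; first exact: cderiv_cst.
    apply: (entire_chain eF).
    rewrite -[t%:C * d]add0r; apply: cderivD; first exact: cderiv_cst.
    rewrite -[t%:C * d]add0r -[0 in X in cderiv _ _ X](mul0r (g x - p)).
    apply: cderivM; first exact: cderiv_cst.
    by rewrite -[d]addr0; apply: cderivD => //; exact: cderiv_cst.
have [B B0 hB] := contour_bound gP.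
have [M M0 hM] := ccont_bounded ler01 cgp.
have [M' M'0 hM'] := ccont_bounded ler01 cV.
(* All the points z_t with t in [0, 1] have norm at most |p| + M. *)
have [C hC] := entire_bound eF (cnorm1 p + M).
have zM t x : 0 <= t <= 1 -> x \in `[0, 1] -> cnorm1 (z_ t x) <= cnorm1 p + M.
  move=> /andP[t0 t1] x01; apply: le_trans (ler_cnorm1D _ _) _; rewrite lerD2l cnorm1_real.
  by rewrite ger0_norm //; apply: le_trans (hM _ x01); rewrite ler_piMl ?cnorm1_ge0.
have C0 : 0 <= C.
  have z0 : cnorm1 p <= cnorm1 p + M by rewrite lerDl.
  have [h _ _ _] := hC p p z0 z0.
  exact: le_trans (cnorm1_ge0 _) h.
have incr x y : 0 <= x <= 1 -> 0 <= y <= 1 ->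
    cnorm1 (I y - I x) <= C * M ^+ 2 * M' * B * (y - x) ^+ 2.
  move=> x01 y01.
  (* The second order remainder. The linear term subtracted here is (y - x) F' (z_x) after division
     by g - p, and its integral vanishes by [J0]. *)
  pose k s := (F (z_ y s) - F (z_ x s) - (z_ y s - z_ x s) * F' (z_ x s)) / (g s - p).
  have dz s : z_ y s - z_ x s = (y - x)%:C * (g s - p).
    by rewrite /z_ rmorphB /=; ring.
  have ek : I y - I x = Cintegral `[0, 1] (fun s => k s * Cderive g s).
    have i1 : cintegrable `[0, 1] (fun s => -1 * (F (z_ x s) / (g s - p) * Cderive g s)).
      by apply: cintegrableZl; [exact: measurable_itv|exact: contour_integrable].
    have i2 := contour_integrable gP (entire_cont' eF (cz x)).
    have i3 := cintegrableZl (- (y - x)%:C) (measurable_itv _) i2.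
    have i4 := cintegrableD (measurable_itv _) (contour_integrable gP (ck y)) i1.
    transitivity (I y + (-1) * I x + (- (y - x)%:C) *
        Cintegral `[0, 1] (fun s => F' (z_ x s) * Cderive g s)).
      by rewrite J0 mulr0 addr0 mulN1r.
    have mI : measurable `[0 : R, 1] := measurable_itv _.
    rewrite /I -(CintegralZl _ mI (contour_integrable gP (ck x))) -(CintegralZl _ mI i2).
    rewrite -(CintegralD mI (contour_integrable gP (ck y)) i1) -(CintegralD mI i4 i3).
    by apply: eq_Cintegral => s s01; rewrite /k dz; field; exact: nz.
  rewrite ek.
  have -> : C * M ^+ 2 * M' * B * (y - x) ^+ 2 = C * (`|y - x| * M) ^+ 2 * M' * B.
    by rewrite exprMn real_normK ?num_real //; ring.
  apply: hB => [|s s01].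
    apply: ccontM => //; apply: ccontD.
      apply: ccontD; first exact: (entire_cont eF).
      by apply: (eq_ccont (fun s => mulN1r _)); apply: ccontM;
        [exact: ccont_cst|exact: (entire_cont eF)].
    apply: (eq_ccont (fun s => mulN1r _)); apply: ccontM; first exact: ccont_cst.
    apply: ccontM; last exact: (entire_cont' eF).
    apply: ccontD => //; apply: (eq_ccont (fun s => mulN1r _)).
    by apply: ccontM => //; exact: ccont_cst.
  apply: le_trans (ler_cnorm1M _ _) _.
  apply: ler_pM; rewrite ?cnorm1_ge0 //; last exact: hM'.
  have [_ _ _] := hC _ _ (zM _ _ x01 s01) (zM _ _ y01 s01).
  move=> /le_trans; apply; rewrite ler_wpM2l // dz cnorm1_real.
  by rewrite lerXn2r ?nnegrE ?mulr_ge0 ?cnorm1_ge0 // ler_wpM2l // hM.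
apply: complex_eqP.
  apply: (quadratic_increment_eq (I := fun t => Re (I t)) (C := C * M ^+ 2 * M' * B)) => x y x01 y01.
  by apply: le_trans (incr _ _ x01 y01); rewrite -cReN -cReD lerDl.
apply: (quadratic_increment_eq (I := fun t => Im (I t)) (C := C * M ^+ 2 * M' * B)) => x y x01 y01.
by apply: le_trans (incr _ _ x01 y01); rewrite -cImN -cImD lerDr.
Qed.

(** Each product of two simple poles is split; Cauchy's formula gives 2 pi i F at the poles al_i,
    and 0 at q, which has index 0. *)
Lemma contour_partial_fractions (F F' : R[i] -> R[i]) (q : R[i]) (I : finType)
    (rho al : I -> R[i]) : entire F F' ->
  (forall x, x \in `[0, 1] -> g x != q) -> (forall i, al i != q) ->
  (forall i x, x \in `[0, 1] -> g x != al i) ->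
  contour_integral g (fun z => (z - q)^-1) = 0 ->
  (forall i, contour_integral g (fun z => (z - al i)^-1) = twopii) ->
  contour_integral g (fun z => (\sum_i rho i / (z - al i)) * (F z / (z - q))) =
  twopii * \sum_i rho i * F (al i) / (al i - q).
Proof.
move=> eF gq alq gal I0 I1.
have cfrac p : (forall x, x \in `[0, 1] -> g x != p) ->
    cintegrable `[0, 1] (fun x => F (g x) / (g x - p) * Cderive g x).
  move=> gp; apply: contour_integrable => //; apply: ccontM.
    exact: (entire_cont eF).
  apply: ccontV; last by move=> x /gp; rewrite subr_eq0.
  by apply: ccontD => //; exact: (ccont_cst _ (- p)).
transitivity (Cintegral `[0, 1] (fun x => \sum_i
    (rho i / (al i - q) * (F (g x) / (g x - al i) * Cderive g x) +
     - (rho i / (al i - q)) * (F (g x) / (g x - q) * Cderive g x)))).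
  apply: eq_Cintegral => x x01; rewrite !mulr_suml; apply: eq_bigr => i _.
  by apply: partial_fraction_id; [exact: gal|exact: gq|exact: alq].
have i1 i := cintegrableZl (rho i / (al i - q)) (measurable_itv _) (cfrac _ (gal i)).
have i2 i := cintegrableZl (- (rho i / (al i - q))) (measurable_itv _) (cfrac _ gq).
rewrite Cintegral_sum //; last by move=> i _; exact: cintegrableD.
rewrite mulr_sumr; apply: eq_bigr => i _.
rewrite (CintegralD _ (i1 i) (i2 i)) // (CintegralZl _ _ (cfrac _ (gal i))) //.
rewrite (CintegralZl _ _ (cfrac _ gq)) //.
rewrite -!/(contour_integral g (fun z => F z / (z - _))).
rewrite (contour_cauchy eF gq) (contour_cauchy eF (gal i)) I0 I1 !mulr0 addr0.
by move: twopii (rho i) => c r; ring.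
Qed.

End Cauchy.

(** * Gaussian integrals on vertical lines *)

Section ImproperIntegrals.
Context {R : realType}.
Notation mu := (@lebesgue_measure R).
Implicit Types (f Phi : R -> R).

(** Dominated convergence, with |f| as the dominating function. It turns primitives on segments into
    integrals over the line or a half line. *)
Lemma cvg_Rintegral_exhaust (D : set R) f (A : nat -> set R) : measurable D ->
  rintegrable D f -> (forall n, measurable (A n)) -> (forall n, A n `<=` D) ->
  (forall x, D x -> exists N, forall n, (N <= n)%N -> A n x) ->
  \int[mu]_(x in A n) f x @[n --> \oo] --> \int[mu]_(x in D) f x.
Proof.
move=> mD iF mA AD exh.
have /integrableP[/measurable_EFinP mf _] := iF.
have AE n : \int[mu]_(x in A n) f x = \int[mu]_(x in D) (f \_ (A n)) x.
  by rewrite -Rintegral_mkcondr; congr (Rintegral _ _ _); rewrite setIC; apply/esym/setIidl.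
under eq_fun do rewrite AE.
rewrite /Rintegral; apply: fine_cvg; rewrite fineK; last exact: integrable_fin_num.
have [] := @dominated_convergence _ _ _ mu D mD (fun n => EFin \o (f \_ (A n)))
  (EFin \o f) (EFin \o (fun x => `|f x|)) _ _ _ _ _ => //.
- move=> n; apply/measurable_EFinP; apply/(measurable_restrict _ (mA n)) => //.
  by rewrite setIC; apply: measurable_funS mf => // x [].
- exact/measurable_EFinP.
- apply: aeW => x Dx; have [N AN] := exh x Dx.
  apply: cvg_near_cst; exists N => // n /= Nn.
  by rewrite patchE mem_set //; exact: AN.
- exact: integrable_norm.
- apply: aeW => x n Dx /=; rewrite lee_fin patchE.
  by case: ifPn => // _; rewrite normr0.
Qed.

Lemma continuous_Rintegral_derive p q f Phi : p < q -> continuous f ->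
  (forall x : R, is_derive x 1 Phi (f x)) ->
  \int[mu]_(x in `[p, q]) f x = Phi q - Phi p.
Proof.
move=> pq cf dPhi; have cPhi := is_derive_continuous dPhi.
by apply: (integral_derive_piece pq (h := f)) => //; exact: continuous_subspaceT.
Qed.

Lemma Rintegral_derive_line f Phi : continuous f -> rintegrable setT f ->
  (forall x : R, is_derive x 1 Phi (f x)) ->
  Phi n%:R @[n --> \oo] --> (0 : R) -> Phi (- n%:R) @[n --> \oo] --> (0 : R) ->
  \int[mu]_x f x = 0.
Proof.
move=> cf iF dPhi P1 P2.
(* The index n + 1 makes every segment non-degenerate, as the fundamental theorem requires. *)
have h := @cvg_Rintegral_exhaust setT f (fun n => `[(- n.+1%:R : R), n.+1%:R]%classic)
  measurableT iF (fun=> measurable_itv _) (fun=> subsetT _) _.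
have {}h : \int[mu]_(x in `[(- n.+1%:R : R), n.+1%:R]) f x @[n --> \oo] --> \int[mu]_x f x.
  apply: h => x _; exists (Num.truncn `|x|) => n xn /=.
  rewrite in_itv /= -ler_norml; apply: ltW; apply: lt_le_trans (Num.Theory.truncnS_gt _) _.
  by rewrite ler_nat ltnS.
have h2 : \int[mu]_(x in `[(- n.+1%:R : R), n.+1%:R]) f x @[n --> \oo] --> (0 : R).
  under eq_fun => n do rewrite (continuous_Rintegral_derive _ cf dPhi) ?gtrN ?ltr0n //.
  have P1' : Phi n.+1%:R @[n --> \oo] --> (0 : R).
    by rewrite (cvg_shiftS (fun n => Phi n%:R)).
  have P2' : Phi (- n.+1%:R) @[n --> \oo] --> (0 : R).
    by rewrite (cvg_shiftS (fun n => Phi (- n%:R))).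
  by have := cvgB P1' P2'; rewrite subr0; apply.
exact: (cvg_unique _ h h2).
Qed.

Lemma Rintegral_derive_halfline a f Phi : continuous f -> rintegrable `[a, +oo[ f ->
  (forall x : R, is_derive x 1 Phi (f x)) ->
  Phi (a + n%:R) @[n --> \oo] --> (0 : R) ->
  \int[mu]_(x in `[a, +oo[) f x = - Phi a.
Proof.
move=> cf iF dPhi P1.
have h := @cvg_Rintegral_exhaust `[a, +oo[%classic f (fun n => `[a, a + n.+1%:R]%classic)
  (measurable_itv _) iF (fun=> measurable_itv _) _ _.
have {}h : \int[mu]_(x in `[a, a + n.+1%:R]) f x @[n --> \oo] --> \int[mu]_(x in `[a, +oo[) f x.
  apply: h => [n x /=|x /=]; rewrite !in_itv /= ?andbT; first by case/andP.
  move=> ax; exists (Num.truncn `|x - a|) => n xn /=.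
  rewrite in_itv /= ax /= -lerBlDl; apply: ltW; apply: le_lt_trans (ler_norm _) _.
  apply: lt_le_trans (Num.Theory.truncnS_gt _) _.
  by rewrite ler_nat ltnS.
have h2 : \int[mu]_(x in `[a, a + n.+1%:R]) f x @[n --> \oo] --> - Phi a.
  under eq_fun => n do rewrite (continuous_Rintegral_derive _ cf dPhi) ?ltrDl ?ltr0n //.
  have P1' : Phi (a + n.+1%:R) @[n --> \oo] --> (0 : R).
    by rewrite (cvg_shiftS (fun n => Phi (a + n%:R))).
  by have := cvgB P1' (cvg_cst (Phi a)); rewrite sub0r; apply.
exact: (cvg_unique _ h h2).
Qed.

Lemma cvg0_norm_le (u : nat -> R) (v : nat -> R) :
  (forall n, `|u n| <= v n) -> v n @[n --> \oo] --> (0 : R) -> u n @[n --> \oo] --> (0 : R).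
Proof.
move=> uv v0; apply: norm_cvg0; apply: (squeeze_cvgr _ (cvg_cst 0) v0).
by apply: nearW => n; rewrite normr_ge0 uv.
Qed.

Lemma cvg_inv_natr : (n.+1%:R : R)^-1 @[n --> \oo] --> (0 : R).
Proof. exact: cvg_harmonic. Qed.

End ImproperIntegrals.

Section GaussianBounds.
Context {R : realType}.
Notation mu := (@lebesgue_measure R).
Implicit Types (al e x : R) (k : nat).

Lemma expr_le_expR k x : 0 <= x -> x ^+ k <= k`!%:R * expR x.
Proof.
move=> x0; have f0 : (0 : R) < k`!%:R by rewrite ltr0n fact_gt0.
rewrite mulrC -ler_pdivrMr //; case: k f0 => [|k] f0.
  by rewrite expr0 fact0 divr1 -expR0 ler_expR.
by apply: le_trans (expR_ge1Dxn k x0); rewrite lerDr.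
Qed.

(** Combine y^k <= k! exp y with |x| <= 1 / e + e x^2, which follows from (e |x| - 1)^2 >= 0. *)
Lemma poly_gauss_bound k (A e : R) : 0 <= A -> 0 < e -> exists2 C, 0 <= C &
  forall x, (A + `|x|) ^+ k <= C * expR (e * x ^+ 2).
Proof.
move=> A0 e0; exists (k`!%:R * expR (A + e^-1)).
  by rewrite mulr_ge0 ?expR_ge0.
move=> x; apply: le_trans (expr_le_expR _ _) _; first by rewrite addr_ge0.
rewrite -mulrA ler_wpM2l // -expRD ler_expR -addrA lerD2l.
rewrite -(real_normK (num_real x)); move: (normr_ge0 x); set y := `|x| => y0.
have h := sqr_ge0 (e * y - 1); rewrite -(ler_pM2l e0).
have -> : e * (e^-1 + e * y ^+ 2) = 1 + (e * y) ^+ 2 by field; rewrite gt_eqF.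
have ey : 0 <= e * y by rewrite mulr_ge0 // ltW.
by nra.
Qed.

Definition gauss al x : R := expR (- (al * x ^+ 2)).

Lemma gauss_ge0 al x : 0 <= gauss al x. Proof. exact: expR_ge0. Qed.

(** A multiple of the centred normal density of variance 1 / (2 al), whose integrability and total
    mass are known. *)
Lemma gaussE al x : 0 < al ->
  gauss al x = Num.sqrt (pi / al) * normal_pdf 0 (Num.sqrt (2 * al)^-1) x.
Proof.
move=> al0; have i0 : 0 < (2 * al)^-1 by rewrite invr_gt0 mulr_gt0.
rewrite normal_pdfE ?gt_eqF ?sqrtr_gt0 // /normal_peak /normal_fun subr0.
rewrite sqr_sqrtr ?ltW //.
have -> : (2 * al)^-1 * pi *+ 2 = pi / al by rewrite -mulr_natr; field; rewrite gt_eqF.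
rewrite mulrA divff ?mul1r; last by rewrite gt_eqF // sqrtr_gt0 divr_gt0 ?pi_gt0.
by rewrite /gauss; congr expR; rewrite -mulr_natr; field; rewrite gt_eqF.
Qed.

Lemma gauss_integrable al : 0 < al -> rintegrable setT (gauss al).
Proof.
move=> al0; apply: (eq_rintegrable _ (fun x _ => esym (gaussE x al0))) => //.
by apply: rintegrableZl => //; exact: integrable_normal_pdf.
Qed.

Lemma integral_gauss al : 0 < al -> \int[mu]_x gauss al x = Num.sqrt (pi / al).
Proof.
move=> al0; under eq_Rintegral do rewrite gaussE //.
rewrite RintegralZl //.
  by rewrite /Rintegral integral_normal_pdf mulr1.
exact: integrable_normal_pdf.
Qed.

(** Half of the decay rate is spent on absorbing the polynomial factor. *)
Lemma gauss_bound k (A C al : R) (f : R -> R) : 0 <= A -> 0 <= C -> 0 < al ->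
  (forall x, `|f x| <= C * (A + `|x|) ^+ k * gauss al x) ->
  exists2 B, 0 <= B & forall x, `|f x| <= B * gauss (al / 2) x.
Proof.
move=> A0 C0 al0 fb.
have al2 : 0 < al / 2 by rewrite divr_gt0.
have [B B0 hB] := poly_gauss_bound k A0 al2.
exists (C * B) => [|x]; first by rewrite mulr_ge0.
have -> : gauss (al / 2) x = expR (al / 2 * x ^+ 2) * gauss al x.
  by rewrite /gauss -expRD; congr expR; field.
apply: le_trans (fb x) _; rewrite -(mulrA C) -(mulrA C) (mulrA B).
by rewrite ler_wpM2l // ler_wpM2r // gauss_ge0.
Qed.

Lemma continuous_gauss_rintegrable k (A C al : R) (f : R -> R) : 0 <= A -> 0 <= C ->
  0 < al -> continuous f -> (forall x, `|f x| <= C * (A + `|x|) ^+ k * gauss al x) ->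
  rintegrable setT f.
Proof.
move=> A0 C0 al0 cf fb; have [B B0 hB] := gauss_bound A0 C0 al0 fb.
apply: (@rintegrable_le _ _ _ (fun x => B * gauss (al / 2) x)) => //.
- exact: continuous_measurable_fun.
- by apply: rintegrableZl => //; apply: gauss_integrable; rewrite divr_gt0.
Qed.

(** Here s is a sign, so that both ends of the line are treated at once; the decay used is exp (- al
    n^2) <= 1 / (al n). *)
Lemma cvg_gauss_nat al (s : R) : 0 < al -> s ^+ 2 = 1 ->
  gauss al (s * n%:R) @[n --> \oo] --> (0 : R).
Proof.
move=> al0 s1; rewrite -(cvg_shiftS (fun n => gauss al (s * n%:R))).
apply: (@cvg0_norm_le _ _ (fun n => al^-1 * n.+1%:R^-1)) => [n|]; last first.
  by rewrite -(mulr0 al^-1); apply: cvgMl_tmp; exact: cvg_inv_natr.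
rewrite ger0_norm ?gauss_ge0 // /gauss expRN exprMn s1 mul1r -invfM.
have n0 : (0 : R) < n.+1%:R by rewrite ltr0n.
rewrite lef_pV2 ?posrE ?mulr_gt0 ?expR_gt0 //.
apply: le_trans (expR_ge1Dx _); rewrite expr2 mulrA.
have n1 : (1 : R) <= n.+1%:R by rewrite ler1n.
have : al * n.+1%:R <= al * n.+1%:R * n.+1%:R by rewrite ler_peMr // mulr_ge0 // ltW.
by lra.
Qed.

Lemma cvg0_gauss k (A C al : R) (f : R -> R) (s : R) : 0 <= A -> 0 <= C -> 0 < al ->
  (forall x, `|f x| <= C * (A + `|x|) ^+ k * gauss al x) -> s ^+ 2 = 1 ->
  f (s * n%:R) @[n --> \oo] --> (0 : R).
Proof.
move=> A0 C0 al0 fb s1; have [B B0 hB] := gauss_bound A0 C0 al0 fb.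
apply: (cvg0_norm_le (fun n => hB (s * n%:R))).
rewrite -(mulr0 B); apply: cvgMl_tmp; apply: cvg_gauss_nat => //.
by rewrite divr_gt0.
Qed.

End GaussianBounds.

(** * Fourier transform of a Gaussian, with T standing for the cosine or the sine *)

Section GaussianFourier.
Context {R : realType}.
Notation mu := (@lebesgue_measure R).
Variables (al : R) (al0 : 0 < al).
Variables T T' : R -> R.
Hypotheses (dT : forall x : R, is_derive x 1 T (T' x))
  (dT' : forall x : R, is_derive x 1 T' (- T x))
  (T1 : forall x, `|T x| <= 1) (T'1 : forall x, `|T' x| <= 1).

Let is_derive_scaled (f f' : R -> R) (k : R) : (forall x : R, is_derive x 1 f (f' x)) ->
  forall x : R, is_derive x 1 (fun y => f (k * y)) (k * f' (k * x)).
Proof.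
move=> df x.
have dk : is_derive x 1 (fun y : R => k * y) k.
  by apply: is_derive_eq; rewrite /GRing.scale /= !mulr1 ?addr0.
by have := is_derive1_comp (g := fun y => k * y) (df (k * x)) dk; rewrite mulrC.
Qed.

Lemma is_derive_gauss (x : R) : is_derive x 1 (gauss al) (- (2 * al * x) * gauss al x).
Proof.
have dq : is_derive x 1 (fun y : R => - (al * y ^+ 2)) (- (2 * al * x)).
  by apply: is_derive_eq; rewrite /GRing.scale /=; ring.
have := is_derive1_comp (g := fun y : R => - (al * y ^+ 2)) (is_derive_expR _) dq.
by rewrite mulrC.
Qed.

Let cgauss : continuous (gauss al) := is_derive_continuous is_derive_gauss.
Let cT (k : R) : continuous (fun x : R => T (k * x)) := is_derive_continuous (is_derive_scaled k dT).
Let cT' (k : R) : continuous (fun x : R => T' (k * x)) := is_derive_continuous (is_derive_scaled k dT').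

Let iT k : rintegrable setT (fun x => gauss al x * T (k * x)).
Proof.
apply: (@continuous_gauss_rintegrable _ 0 0 1 al) => //.
  by move=> x; apply: cvgM; [exact: cgauss|exact: cT].
by move=> x; rewrite expr0 !mul1r normrM ger0_norm ?gauss_ge0 // ler_piMr ?gauss_ge0.
Qed.

Let iT' k : rintegrable setT (fun x => x * gauss al x * T' (k * x)).
Proof.
apply: (@continuous_gauss_rintegrable _ 1 0 1 al) => //.
  by move=> x; apply: cvgM; [apply: cvgM; [exact: cvg_id|exact: cgauss]|exact: cT'].
move=> x; rewrite add0r expr1 mul1r !normrM (ger0_norm (gauss_ge0 _ _)).
by rewrite ler_piMr // mulr_ge0 ?gauss_ge0.
Qed.

Let u k := \int[mu]_x (gauss al x * T (k * x)).

(** Differentiation under the integral, dominated by |x| times the Gaussian since T' is bounded by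
    1. *)
Let du (k : R) : is_derive k 1 u (\int[mu]_x (x * gauss al x * T' (k * x))).
Proof.
pose f (k x : R) := gauss al x * T (k * x).
have df (a x : R) : is_derive a 1 (f ^~ x) (x * gauss al x * T' (a * x)).
  have h := is_derive_scaled x dT a.
  have h' : is_derive a 1 (fun y => T (y * x)) (x * T' (a * x)).
    by rewrite (_ : (fun y => _) = (fun y => T (x * y))) ?[a * x]mulrC //; apply/funext => y; rewrite mulrC.
  by apply: is_derive_eq; rewrite /GRing.scale /=; ring.
have dfE a x : (partial1of2 f) a x = x * gauss al x * T' (a * x).
  by rewrite /partial1of2 derive1E; have [_ ->] := df a x.
have kI : `]k - 1, k + 1[%classic k by rewrite /= in_itv /= ltrBlDr ltrDl ltr01 andbT.
have iG : mu.-integrable setT (EFin \o (fun x => `|x| * gauss al x)).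
  apply: (@continuous_gauss_rintegrable _ 1 0 1 al) => //.
    by move=> x; apply: cvgM; [exact: norm_continuous|exact: cgauss].
  by move=> x; rewrite add0r expr1 mul1r normrM normr_id (ger0_norm (gauss_ge0 _ _)).
have G0 x : 0 <= `|x| * gauss al x by rewrite mulr_ge0 ?gauss_ge0.
have Gub x y : `]k - 1, k + 1[%classic x -> setT y -> `|(partial1of2 f) x y| <= `|y| * gauss al y.
  move=> _ _; rewrite dfE !normrM (ger0_norm (gauss_ge0 _ _)).
  by rewrite ler_piMr // mulr_ge0 ?gauss_ge0.
have d1 x y : `]k - 1, k + 1[%classic x -> setT y -> derivable (f ^~ y) x 1.
  by move=> _ _; have [] := df x y.
have intf x : `]k - 1, k + 1[%classic x -> mu.-integrable setT (EFin \o f x).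
  by move=> _; exact: iT.
have dd := derivable_under_integral measurableT kI intf d1 G0 iG Gub.
have de := differentiation_under_integral measurableT kI intf d1 G0 iG Gub.
apply: DeriveDef; first exact: dd.
rewrite -derive1E; rewrite /u -/(f _) in de *; rewrite de.
by apply: eq_Rintegral => x _; rewrite dfE.
Qed.

(** The derivative of the Gaussian times T' (k x) integrates to 0, and T'' = - T brings back [u]. *)
Let by_parts (k : R) : \int[mu]_x (x * gauss al x * T' (k * x)) = - (k / (2 * al)) * u k.
Proof.
pose f x := (- (2 * al)) * (x * gauss al x * T' (k * x)) + (- k) * (gauss al x * T (k * x)).
have if1 := rintegrableZl (- (2 * al)) measurableT (iT' k).
have if2 := rintegrableZl (- k) measurableT (iT k).
have I0 : \int[mu]_x f x = 0.
  apply: (@Rintegral_derive_line _ f (fun x => gauss al x * T' (k * x))).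
  - move=> x; apply: cvgD; apply: cvgMl_tmp; apply: cvgM.
    + by apply: cvgM; [exact: cvg_id|exact: cgauss].
    + exact: cT'.
    + exact: cgauss.
    + exact: cT.
  - exact: rintegrableD.
  - move=> x; have h1 := is_derive_gauss x; have h2 := is_derive_scaled k dT' x.
    by apply: is_derive_eq; rewrite /f /GRing.scale /=; ring.
  - rewrite (_ : (fun n => _) = (fun n => (fun x => gauss al x * T' (k * x)) (1 * n%:R))).
      apply: (@cvg0_gauss _ 0 0 1 al (fun x => gauss al x * T' (k * x))) => //; last by rewrite expr1n.
      by move=> x; rewrite expr0 !mul1r normrM ger0_norm ?gauss_ge0 // ler_piMr ?gauss_ge0.
    by apply/funext => n; rewrite mul1r.
  - rewrite (_ : (fun n => _) = (fun n => (fun x => gauss al x * T' (k * x)) ((-1) * n%:R))).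
      apply: (@cvg0_gauss _ 0 0 1 al (fun x => gauss al x * T' (k * x))) => //; last by rewrite sqrrN expr1n.
      by move=> x; rewrite expr0 !mul1r normrM ger0_norm ?gauss_ge0 // ler_piMr ?gauss_ge0.
    by apply/funext => n; rewrite mulN1r.
move: I0; rewrite /f (RintegralD measurableT if1 if2).
rewrite (RintegralZl _ measurableT (iT' k)) (RintegralZl _ measurableT (iT k)) -/(u k) => h.
have a2 : 2 * al != 0 by rewrite mulf_neq0 ?gt_eqF.
apply: (mulfI a2); rewrite mulrA mulrN mulrCA mulfV // mulr1.
by apply/eqP; rewrite -subr_eq0 -oppr_eq0; apply/eqP; rewrite -h; ring.
Qed.

(** The two previous facts give u' = - (k / (2 al)) u, so u times exp (k^2 / (4 al)) is constant,
    equal to its value at k = 0. *)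
Lemma gauss_fourier (k : R) : \int[mu]_x (gauss al x * T (k * x)) =
  T 0 * (Num.sqrt (pi / al) * expR (- (k ^+ 2 / (4 * al)))).
Proof.
pose e (k : R) := expR (k ^+ 2 / (4 * al)).
have de (x : R) : is_derive x 1 e (x / (2 * al) * e x).
  have dq : is_derive x 1 (fun y : R => y ^+ 2 / (4 * al)) (x / (2 * al)).
    by apply: is_derive_eq; rewrite /GRing.scale /=; field; rewrite gt_eqF.
  have h := is_derive1_comp (g := fun y : R => y ^+ 2 / (4 * al)) (is_derive_expR _) dq.
  by apply: (is_derive_eq h); rewrite mulrC.
have dc (x : R) : is_derive x 1 (fun k => u k * e k) 0.
  have h1 := du x; rewrite by_parts in h1; have h2 := de x.
  by apply: is_derive_eq; rewrite /GRing.scale /=; ring.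
have := is_derive_0_is_cst k 0 dc.
rewrite /e expr0n /= mul0r expR0 mulr1 => h.
rewrite expRN -[LHS](mulfK (lt0r_neq0 (expR_gt0 (k ^+ 2 / (4 * al))))) -/(u k) h mulrA; congr (_ / _).
rewrite /u; under eq_Rintegral do rewrite mul0r.
by rewrite RintegralZr ?integral_gauss 1?mulrC //; exact: gauss_integrable.
Qed.

End GaussianFourier.

(** * Gaussian moments on vertical lines *)

Section Hermite.
Context {R : realType}.
Implicit Types (c l : R) (k : nat) (p q : {poly R}).

(** Rescaled Hermite polynomials: the k-th derivative of exp (- c x^2 / 2) is [hermite c k] times
    this function. *)
Fixpoint hermite c k : {poly R} :=
  if k is k'.+1 then (hermite c k')^`() - c *: ('X * hermite c k') else 1.

Lemma hermite1 c : hermite c 1 = - c *: 'X.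
Proof. by rewrite /= -polyC1 derivC polyC1 mulr1 sub0r scaleNr. Qed.

(** The three-term recurrence, in the shape that integration by parts gives for the moments of a
    Gaussian on a vertical line. *)
Lemma hermite_rec c k :
  hermite c k.+2 = - c *: (k.+1%:R *: hermite c k + 'X * hermite c k.+1).
Proof.
elim: k => [|k ih].
  have -> : hermite c 2 = (hermite c 1)^`() - c *: ('X * hermite c 1) by [].
  rewrite hermite1 derivZ derivX.
  by rewrite (_ : hermite c 0 = 1) // scale1r -!mul_polyC !polyCN; ring.
have e3 : hermite c k.+3 = (hermite c k.+2)^`() - c *: ('X * hermite c k.+2) by [].
have e2 : hermite c k.+1 = (hermite c k)^`() - c *: ('X * hermite c k) by [].
have e2' : hermite c k.+2 = (hermite c k.+1)^`() - c *: ('X * hermite c k.+1) by [].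
rewrite e3 {1}ih derivZ derivD derivZ derivM derivX mul1r.
have -> : (hermite c k)^`() = hermite c k.+1 + c *: ('X * hermite c k) by rewrite e2 subrK.
have -> : (hermite c k.+1)^`() = hermite c k.+2 + c *: ('X * hermite c k.+1) by rewrite e2' subrK.
move: (hermite c k) (hermite c k.+1) (hermite c k.+2) ih => u0 u1 u2 ->.
rewrite -[k.+2]addn1 natrD -!mul_polyC !polyCD !polyCN; ring.
Qed.

Lemma horner_norm_bound p : exists2 C, 0 <= C &
  forall x : R, `|p.[x]| <= C * (1 + `|x|) ^+ size p.
Proof.
exists (\sum_(i < size p) `|p`_i|) => [|x]; first exact: sumr_ge0.
rewrite horner_coef mulr_suml; apply: le_trans (ler_norm_sum _ _ _) _.
apply: ler_sum => i _; rewrite normrM ler_wpM2l // normrX.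
apply: le_trans (_ : (1 + `|x|) ^+ i <= _).
  by apply: lerXn2r; rewrite ?nnegrE ?addr_ge0 // lerDr.
by apply: ler_weXn2l; [rewrite lerDl|exact: ltnW].
Qed.

End Hermite.

Section Moments.
Context {R : realType}.
Variables (al : R) (al0 : 0 < al).
Implicit Types (l : R) (k : nat) (p q : {poly R}).

(** The value of (2 pi i)^-1 times the integral of exp (al w^2 + l w) over a vertical line. *)
Definition gauss_dual l : R :=
  (2 * Num.sqrt (pi * al))^-1 * expR (- (l ^+ 2 / (4 * al))).

(** The k-th derivative of [gauss_dual] in l, which amounts to inserting w^k in the integral. *)
Definition gmoment k l : R := (hermite (2 * al)^-1 k).[l] * gauss_dual l.

(* (2 pi i)^-1 times the integral of [p w * exp (al w^2 + l w)] over any vertical line *)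
Definition gmean l p : R := \sum_(k < size p) p`_k * gmoment k l.

Lemma gmean_widen l p n : (size p <= n)%N -> gmean l p = \sum_(k < n) p`_k * gmoment k l.
Proof.
move=> pn; rewrite /gmean (big_ord_widen _ (fun k => p`_k * gmoment k l) pn) big_mkcond.
apply: eq_bigr => k _; case: ltnP => // h; by rewrite nth_default // mul0r.
Qed.

Lemma gmeanD l p q : gmean l (p + q) = gmean l p + gmean l q.
Proof.
pose n := maxn (size p) (size q).
rewrite (@gmean_widen _ _ n) ?(@gmean_widen _ p n) ?(@gmean_widen _ q n) ?leq_maxl ?leq_maxr //.
  by rewrite -big_split; apply: eq_bigr => k _; rewrite /= coefD mulrDl.
exact: size_polyD.
Qed.

Lemma gmeanZ l a p : gmean l (a *: p) = a * gmean l p.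
Proof.
rewrite (@gmean_widen _ _ (size p)) ?size_scale_leq // mulr_sumr.
by apply: eq_bigr => k _; rewrite coefZ mulrA.
Qed.

Lemma gmean0 l : gmean l 0 = 0.
Proof. by rewrite /gmean size_poly0 big_ord0. Qed.

Lemma gmean_sum l (I : Type) (r : seq I) (f : I -> {poly R}) :
  gmean l (\sum_(i <- r) f i) = \sum_(i <- r) gmean l (f i).
Proof.
elim: r => [|i r ih]; first by rewrite !big_nil gmean0.
by rewrite !big_cons gmeanD ih.
Qed.

Lemma gmean_mulX l p n : (size p <= n)%N ->
  gmean l ('X * p) = \sum_(k < n) p`_k * gmoment k.+1 l.
Proof.
move=> pn; rewrite (@gmean_widen _ _ n.+1).
  rewrite big_ord_recl coefXM mul0r add0r.
  by apply: eq_bigr => k _; rewrite coefXM.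
by apply: leq_trans (size_polyMleq _ _) _; rewrite size_polyX.
Qed.

Lemma is_derive_gauss_dual l : is_derive l 1 gauss_dual (- ((2 * al)^-1 * l) * gauss_dual l).
Proof.
have dq : is_derive l 1 (fun y : R => - (y ^+ 2 / (4 * al))) (- ((2 * al)^-1 * l)).
  by apply: is_derive_eq; rewrite /GRing.scale /=; field; rewrite gt_eqF.
have h := is_derive1_comp (g := fun y : R => - (y ^+ 2 / (4 * al))) (is_derive_expR _) dq.
by apply: is_derive_eq; rewrite /gauss_dual /GRing.scale /=; ring.
Qed.

Lemma is_derive_gmoment k l : is_derive l 1 (gmoment k) (gmoment k.+1 l).
Proof.
have h1 := is_derive_gauss_dual l.
have h2 : is_derive l 1 (horner (hermite (2 * al)^-1 k)) (hermite (2 * al)^-1 k)^`().[l].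
  exact: is_derive_poly.
have hS : hermite (2 * al)^-1 k.+1 =
  (hermite (2 * al)^-1 k)^`() - (2 * al)^-1 *: ('X * hermite (2 * al)^-1 k) by [].
by apply: is_derive_eq; rewrite /gmoment hS hornerD hornerN hornerZ hornerM hornerX /GRing.scale /=; ring.
Qed.

Lemma gmoment0 l : gmoment 0 l = gauss_dual l.
Proof. by rewrite /gmoment -[hermite _ 0]/(1%:P) hornerC mul1r. Qed.

Lemma gmoment1 l : gmoment 1 l = - ((2 * al)^-1 * l) * gauss_dual l.
Proof. by rewrite /gmoment hermite1 hornerZ hornerX mulNr. Qed.

Lemma gmoment_rec k l : gmoment k.+2 l =
  - ((2 * al)^-1) * (k.+1%:R * gmoment k l + l * gmoment k.+1 l).
Proof. rewrite /gmoment hermite_rec hornerZ hornerD hornerZ hornerM hornerX; ring. Qed.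

Lemma gmoment_bounded k : exists2 C, 0 <= C & forall l, `|gmoment k l| <= C.
Proof.
pose c : R := (2 * Num.sqrt (pi * al))^-1.
have c0 : 0 <= c by rewrite invr_ge0 mulr_ge0.
have e0 : 0 < (4 * al)^-1 by rewrite invr_gt0 mulr_gt0.
have [C C0 hC] := horner_norm_bound (hermite (2 * al)^-1 k).
have Cc0 : 0 <= C * c by rewrite mulr_ge0.
have fb x : `|gmoment k x| <=
    C * c * (1 + `|x|) ^+ size (hermite (2 * al)^-1 k) * gauss (4 * al)^-1 x.
  have -> : gmoment k x = (hermite (2 * al)^-1 k).[x] * (c * gauss (4 * al)^-1 x).
    by rewrite /gmoment /gauss_dual /gauss [_ * x ^+ 2]mulrC.
  rewrite normrM [X in _ * X]ger0_norm ?mulr_ge0 ?gauss_ge0 // (mulrAC C) mulrA.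
  by rewrite ler_wpM2r ?gauss_ge0 // ler_wpM2r.
have [B B0 hB] := gauss_bound ler01 Cc0 e0 fb.
exists B => // l; apply: le_trans (hB l) _; rewrite ler_piMr // /gauss.
by rewrite -[leRHS]expR0 ler_expR oppr_le0 mulr_ge0 ?sqr_ge0 // divr_ge0 // ltW.
Qed.

Lemma is_derive_gmean l p : is_derive l 1 (fun l => gmean l p) (gmean l ('X * p)).
Proof.
rewrite (@gmean_mulX _ _ (size p)) // /gmean.
have -> : (fun l => \sum_(k < size p) p`_k * gmoment k l) =
    \sum_(k < size p) (fun l => p`_k * gmoment k l).
  by apply/funext => y; rewrite fct_sumE.
apply: is_derive_sum => k.
exact: (is_deriveZ p`_k (is_derive_gmoment k l)).
Qed.

(** The bound is uniform in l, so that the mean along a moving argument l + h z can be integrated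
    against a decaying exponential. *)
Lemma gmean_bounded p : exists2 C, 0 <= C & forall l, `|gmean l p| <= C.
Proof.
rewrite /gmean.
suff h n : exists2 C, 0 <= C & forall l, `|\sum_(k < n) p`_k * gmoment k l| <= C by exact: h.
elim: n => [|n [C C0 ih]].
  by exists 0 => // l; rewrite big_ord0 normr0.
have [B B0 hB] := gmoment_bounded n.
exists (C + `|p`_n| * B) => [|l]; first by rewrite addr_ge0 ?mulr_ge0.
rewrite big_ord_recr /= (le_trans (ler_normD _ _)) // lerD // normrM ler_wpM2l //.
Qed.

End Moments.

Section VerticalLines.
Context {R : realType}.
Notation mu := (@lebesgue_measure R).
Variables (al : R) (al0 : 0 < al) (c l : R).
Implicit Types (k : nat) (x : R) (p : {poly R}).

Let w x : R[i] := c +i* x.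
Let f k x : R[i] := w x ^+ k * cexp (al%:C * w x ^+ 2 + l%:C * w x).

Let K : R := expR (al * c ^+ 2 + l * c).

Let fE x : cexp (al%:C * w x ^+ 2 + l%:C * w x) =
  (K * gauss al x)%:C * (cos ((2 * al * c + l) * x) +i* sin ((2 * al * c + l) * x)).
Proof.
have -> : al%:C * w x ^+ 2 + l%:C * w x =
    (al * c ^+ 2 + l * c + - (al * x ^+ 2)) +i* ((2 * al * c + l) * x).
  by apply: complex_eqP; rewrite expr2 !cReIm /=; ring.
by apply: complex_eqP; rewrite ?Re_cexp ?Im_cexp expRD ?cReM ?cImM /= ?mul0r ?subr0 ?addr0.
Qed.

Let cderivw x : cderiv w x 'i.
Proof. by split=> /=; [exact: is_derive_cst|exact: is_derive_id]. Qed.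

(** At k = 0 the truncated predecessor is harmless, being multiplied by 0. *)
Let cderivwX k x : cderiv (fun y => w y ^+ k) x (k%:R * w x ^+ k.-1 * 'i).
Proof.
elim: k => [|k ih]; first by rewrite !mul0r; exact: cderiv_cst.
under [X in cderiv X]eq_fun do rewrite exprS.
have -> : k.+1%:R * w x ^+ k.+1.-1 * 'i = 'i * w x ^+ k + w x * (k%:R * w x ^+ k.-1 * 'i).
  rewrite /= -[k.+1]addn1 natrD; case: k {ih} => [|k] /=; first by rewrite !mul0r mulr0 add0r !expr0; ring.
  by rewrite exprS; ring.
exact: cderivM.
Qed.

Let cderivf k x : cderiv (f k) x
  ('i * (k%:R * f k.-1 x + (2 * al)%:C * f k.+1 x + l%:C * f k x)).
Proof.
have h1 := cderivwX k x; have h2 := cderivwX 2 x.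
have h3 : cderiv (fun y => al%:C * w y ^+ 2 + l%:C * w y) x
    (0 * w x ^+ 2 + al%:C * (2%:R * w x ^+ 1 * 'i) + (0 * w x + l%:C * 'i)).
  by apply: cderivD; apply: cderivM => //; exact: cderiv_cst.
have := cderivM h1 (cderiv_cexp h3); rewrite /f.
set E := cexp _; set d := (X in cderiv _ _ X -> _); set d' := (X in _ -> cderiv _ _ X).
suff -> : d = d' by [].
rewrite /d /d' [(2 * al)%:C]rmorphM /= (_ : 2%:C = 2 :> R[i]); last by rewrite rmorph_nat.
by rewrite [w x ^+ k.+1]exprS expr1; ring.
Qed.

Let wnorm x : cnorm1 (w x) = `|c| + `|x|. Proof. by []. Qed.

Let fbound k x : cnorm1 (f k x) <= (2 * K) * (`|c| + `|x|) ^+ k * gauss al x.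
Proof.
apply: le_trans (ler_cnorm1M _ _) _.
have wk j : cnorm1 (w x ^+ j) <= (`|c| + `|x|) ^+ j.
  elim: j => [|j ih]; first by rewrite !expr0 /cnorm1 /= normr1 normr0 addr0.
  rewrite !exprS; apply: le_trans (ler_cnorm1M _ _) _.
  by rewrite wnorm ler_wpM2l // addr_ge0.
have KG : 0 <= K * gauss al x := mulr_ge0 (expR_ge0 _) (gauss_ge0 _ _).
rewrite fE cnorm1_real (ger0_norm KG).
rewrite (_ : 2 * K * _ * _ = (`|c| + `|x|) ^+ k * (K * gauss al x * 2)); last by ring.
apply: (ler_pM (cnorm1_ge0 _) (mulr_ge0 KG (cnorm1_ge0 _)) (wk k)).
apply: (ler_wpM2l KG).
have h1 : `|cos ((2 * al * c + l) * x)| <= 1 by rewrite ler_norml cos_geN1 cos_le1.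
have h2 : `|sin ((2 * al * c + l) * x)| <= 1 by rewrite ler_norml sin_geN1 sin_le1.
by apply: le_trans (lerD h1 h2) _; lra.
Qed.

Let K2 : 0 <= 2 * K. Proof. by rewrite mulr_ge0 ?expR_ge0. Qed.

Let contf k : continuous (fun x => Re (f k x)) /\ continuous (fun x => Im (f k x)).
Proof.
by split; [apply: (is_derive_continuous (fun x => (cderivf k x).1))|
  apply: (is_derive_continuous (fun x => (cderivf k x).2))].
Qed.

Let boundRe k x : `|Re (f k x)| <= (2 * K) * (`|c| + `|x|) ^+ k * gauss al x.
Proof. by apply: le_trans (fbound k x); rewrite /cnorm1 lerDl. Qed.

Let boundIm k x : `|Im (f k x)| <= (2 * K) * (`|c| + `|x|) ^+ k * gauss al x.
Proof. by apply: le_trans (fbound k x); rewrite /cnorm1 lerDr. Qed.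

Let intf k : cintegrable setT (f k).
Proof.
split.
  exact: (continuous_gauss_rintegrable (normr_ge0 c) K2 al0 (contf k).1 (boundRe k)).
exact: (continuous_gauss_rintegrable (normr_ge0 c) K2 al0 (contf k).2 (boundIm k)).
Qed.

Let E k := Cintegral setT (f k).

(** Up to the factor i, the combination is the integral of the derivative of [f k], which tends to 0
    at both ends of the line. *)
Let recE k : k%:R * E k.-1 + (2 * al)%:C * E k.+1 + l%:C * E k = 0.
Proof.
pose d x := 'i * (k%:R * f k.-1 x + (2 * al)%:C * f k.+1 x + l%:C * f k x).
have i1 := cintegrableZl (k%:R) measurableT (intf k.-1).
have i2 := cintegrableZl (2 * al)%:C measurableT (intf k.+1).
have i3 := cintegrableZl l%:C measurableT (intf k).
have i12 := cintegrableD measurableT i1 i2.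
have i123 := cintegrableD measurableT i12 i3.
have id := cintegrableZl 'i measurableT i123.
suff h : Cintegral setT d = 0.
  have := h; rewrite /d (CintegralZl _ measurableT i123) (CintegralD measurableT i12 i3).
  rewrite (CintegralD measurableT i1 i2) !CintegralZl //; try exact: intf.
  move=> /eqP; rewrite mulf_eq0 => /orP[|/eqP //].
  by rewrite eq_complex /= oner_eq0 andbF.
have cd : continuous (fun x => Re (d x)) /\ continuous (fun x => Im (d x)).
  have hc : ccont setT d.
    have cf j : ccont setT (f j) by split; apply: continuous_subspaceT; [exact: (contf j).1|exact: (contf j).2].
    apply: ccontM; first exact: ccont_cst.
    apply: ccontD; first apply: ccontD; apply: ccontM => //; exact: ccont_cst.
  by move: hc => [h1 h2]; split; apply/continuous_subspace_setT.
have lim (g : R -> R) : (forall x, `|g x| <= (2 * K) * (`|c| + `|x|) ^+ k * gauss al x) ->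
    (g n%:R @[n --> \oo] --> (0 : R)) /\ (g (- n%:R) @[n --> \oo] --> (0 : R)).
  move=> gb; split.
    under eq_fun do rewrite -[_%:R]mul1r.
    by apply: (@cvg0_gauss _ k `|c| (2 * K) al g) => //; rewrite expr1n.
  under eq_fun do rewrite -mulN1r.
  by apply: (@cvg0_gauss _ k `|c| (2 * K) al g) => //; rewrite sqrrN expr1n.
have [r1 r2] := lim _ (boundRe k); have [j1 j2] := lim _ (boundIm k).
apply: complex_eqP; rewrite /=.
  exact: (Rintegral_derive_line cd.1 id.1 (fun x => (cderivf k x).1)).
exact: (Rintegral_derive_line cd.2 id.2 (fun x => (cderivf k x).2)).
Qed.

(** On the line the integrand is K times a Gaussian oscillating at frequency 2 al c + l. The Fourier
    transform at this frequency cancels the dependence of K on the abscissa c. *)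
Let E0 : E 0 = (2 * pi * gmoment al 0 l)%:C.
Proof.
set ka := 2 * al * c + l.
have bcos (x : R) : `|cos x| <= 1 by rewrite ler_norml cos_geN1 cos_le1.
have bsin (x : R) : `|sin x| <= 1 by rewrite ler_norml sin_geN1 sin_le1.
have dNsin (x : R) : is_derive x 1 (fun x : R => - sin x) (- cos x) by exact: is_deriveN.
have dNcos (x : R) : is_derive x 1 cos (- sin x) := is_derive_cos x.
have bNsin (x : R) : `|- sin x| <= 1 by rewrite normrN.
have hc := gauss_fourier al0 dNcos dNsin bcos bNsin ka.
have hs := gauss_fourier al0 (@is_derive_sin R) dNcos bsin bcos ka.
have f0 x : f 0 x = K%:C * ((gauss al x * cos (ka * x)) +i* (gauss al x * sin (ka * x))).
  by rewrite /f expr0 mul1r fE; apply: complex_eqP; rewrite ?cReM ?cImM /=; ring.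
have iG (T : R -> R) : continuous T -> (forall x, `|T x| <= 1) ->
    rintegrable setT (fun x => gauss al x * T (ka * x)).
  move=> cT T1; apply: (@continuous_gauss_rintegrable _ 0 0 1 al) => //.
    move=> x; apply: cvgM.
      exact: (is_derive_continuous (@is_derive_gauss _ al)).
    apply: (@continuous_comp _ _ _ (fun x => ka * x) T); last exact: cT.
    by apply: cvgMl_tmp; exact: cvg_id.
  by move=> x; rewrite expr0 !mul1r normrM ger0_norm ?gauss_ge0 // ler_piMr ?gauss_ge0.
have icx : cintegrable setT (fun x => (gauss al x * cos (ka * x)) +i* (gauss al x * sin (ka * x))).
  by split; apply: iG => //; [exact: continuous_cos|exact: continuous_sin].
have -> : E 0 = Cintegral setT (fun x => K%:C *
    ((gauss al x * cos (ka * x)) +i* (gauss al x * sin (ka * x)))).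
  by apply: eq_Cintegral => x _; exact: f0.
rewrite CintegralZl //.
have -> : Cintegral setT (fun x => (gauss al x * cos (ka * x)) +i* (gauss al x * sin (ka * x))) =
    (Num.sqrt (pi / al) * expR (- (ka ^+ 2 / (4 * al))))%:C.
  by apply: complex_eqP => /=; rewrite ?hc ?hs ?cos0 ?sin0 ?mul1r ?mul0r.
rewrite -rmorphM gmoment0 /gauss_dual; congr (_%:C).
rewrite mulrCA /K -expRD.
have -> : al * c ^+ 2 + l * c + - (ka ^+ 2 / (4 * al)) = - (l ^+ 2 / (4 * al)).
  by rewrite /ka; field; rewrite gt_eqF.
rewrite mulrA; congr (_ * _).
have sp : Num.sqrt (pi * al) != 0 :> R by rewrite gt_eqF // sqrtr_gt0 mulr_gt0 ?pi_gt0.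
apply: (mulIf sp); rewrite -sqrtrM ?divr_ge0 ?pi_ge0 ?ltW //.
have -> : pi / al * (pi * al) = pi ^+ 2 :> R by field; rewrite gt_eqF.
rewrite sqrtr_sqr ger0_norm ?pi_ge0 //; field; exact: sp.
Qed.

(** Both sides satisfy the same recurrence of order two, hence the induction on two consecutive
    moments. *)
Lemma vertical_moment k : cintegrable setT (f k) /\
  Cintegral setT (f k) = (2 * pi * gmoment al k l)%:C.
Proof.
split; first exact: intf.
rewrite -/(E k); suff [] : E k = (2 * pi * gmoment al k l)%:C /\
  E k.+1 = (2 * pi * gmoment al k.+1 l)%:C by [].
have a2 : (2 * al)%:C != 0 :> R[i].
  by rewrite eq_complex /= eqxx andbT mulf_neq0 // gt_eqF.
elim: k => [|k [ih1 ih2]].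
  split; first exact: E0.
  have := recE 0; rewrite mul0r add0r E0 => /eqP; rewrite addr_eq0 => /eqP h.
  apply: (mulfI a2); rewrite h -!rmorphM -rmorphN; congr (_%:C).
  by rewrite gmoment0 gmoment1; field; rewrite gt_eqF.
split => //; have := recE k.+1; rewrite ih1 ih2 => /eqP.
rewrite addrAC addr_eq0 => /eqP h; apply: (mulfI a2); apply: oppr_inj.
rewrite -h -(rmorph_nat (real_complex R)) -!rmorphM -rmorphD -rmorphN; congr (_%:C).
by rewrite gmoment_rec; field; rewrite gt_eqF.
Qed.

End VerticalLines.

Section VerticalPoly.
Context {R : realType}.
Variables (al : R) (al0 : 0 < al).

Lemma gauss_line_integral (k0 : R[i]) (c l : R) (p : {poly R}) :
  vline_integral c (fun w => k0 * (cexp (al%:C * w ^+ 2 + l%:C * w) *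
    (map_poly (real_complex R) p).[w])) = k0 * twopii * (gmean al l p)%:C.
Proof.
rewrite /vline_integral.
have vm k := vertical_moment al0 c l k.
transitivity ('i * Cintegral setT (fun x => \sum_(k < size p) (k0 * (p`_k)%:C) *
    ((c +i* x) ^+ k * cexp (al%:C * (c +i* x) ^+ 2 + l%:C * (c +i* x))))).
  congr (_ * _); apply: eq_Cintegral => x _.
  rewrite horner_coef size_map_poly !mulr_sumr; apply: eq_bigr => k _.
  by rewrite coef_map /= -[RHS]mulrA; congr (_ * _); rewrite mulrC -mulrA.
rewrite Cintegral_sum //; last by move=> k _; apply: cintegrableZl => //; have [] := vm k.
rewrite /gmean rmorph_sum !mulr_sumr; apply: eq_bigr => k _.
rewrite CintegralZl //; last by have [] := vm k.
have [_ ->] := vm k.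
have -> : twopii = 'i * (2 * pi)%:C :> R[i].
  by apply: complex_eqP; rewrite !cReIm /=; ring.
rewrite !rmorphM /=; ring.
Qed.

End VerticalPoly.

(** * Fredholm determinants of finite rank kernels *)

Section DetIdentities.
Variable F : fieldType.

(** Sylvester's identity: the same block matrix is triangularised in two ways by unipotent
    factors. *)
Lemma det_1addM_comm (m n : nat) (A : 'M[F]_(m, n)) (B : 'M[F]_(n, m)) :
  \det (1%:M + A *m B) = \det (1%:M + B *m A).
Proof.
have e1 : block_mx 1%:M (- A) B 1%:M *m block_mx 1%:M A 0 1%:M =
    block_mx 1%:M 0 B (1%:M + B *m A).
  by rewrite mulmx_block !mul1mx !mulmx0 !mulmx1 ?addr0 subrr addrC.
have e2 : block_mx 1%:M (- A) B 1%:M *m block_mx 1%:M 0 (- B) 1%:M =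
    block_mx (1%:M + A *m B) (- A) 0 1%:M.
  by rewrite mulmx_block !mul1mx !mulmx0 !mulmx1 ?add0r mulNmx mulmxN opprK subrr.
have := congr1 determinant e1; have := congr1 determinant e2.
rewrite !det_mulmx !(det_ublock, det_lblock) !det1 !mulr1 !mul1r => e2' e1'.
by rewrite -e2' -e1'.
Qed.

Lemma det_1add_rank1 (n : nat) (x : 'cV[F]_n) (y : 'rV[F]_n) :
  \det (1%:M + x *m y) = 1 + (y *m x) 0 0.
Proof.
by rewrite det_1addM_comm det_mx11 !mxE eqxx.
Qed.

Section PrincipalMinors.
Variables (m : nat) (G : 'M[F]_m).

(** Its determinant is the principal minor of G on A, without renumbering the indices of A. *)
Definition row_patch (A : {set 'I_m}) : 'M[F]_m :=
  \matrix_(i, j) if i \in A then G i j else (i == j)%:R.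

(* Expanding each row of the determinant of [1 + G] along the two summands. *)
Lemma det_1add_patch : \det (1%:M + G) = \sum_(A : {set 'I_m}) \det (row_patch A).
Proof.
rewrite /determinant exchange_big /=; apply: eq_bigr => s _.
rewrite -mulr_sumr; congr (_ * _).
rewrite (eq_bigr (fun i => G i (s i) + (i == s i)%:R)); last first.
  by move=> i _; rewrite !mxE addrC.
rewrite bigA_distr; apply: eq_bigr => A _; apply: eq_bigr => i _.
by rewrite mxE.
Qed.

(** With E the selection matrix of phi, E^T E = 1, so the submatrix is 1 + E^T (G - 1) E;
    Sylvester's identity turns it into 1 + E E^T (G - 1), which is the patched matrix. *)
Lemma det_submx_patch (k : nat) (phi : {ffun 'I_k -> 'I_m}) : injective phi ->
  \det (\matrix_(i, j) G (phi i) (phi j)) = \det (row_patch [set phi i | i : 'I_k]%SET).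
Proof.
move=> iphi; pose E : 'M[F]_(m, k) := \matrix_(i, a) (phi a == i)%:R.
have EG (p : nat) (M : 'M[F]_(m, p)) a j : (E^T *m M) a j = M (phi a) j.
  rewrite mxE (bigD1 (phi a)) //= big1 => [|i ia]; first by rewrite !mxE eqxx mul1r addr0.
  by rewrite !mxE eq_sym (negPf ia) mul0r.
have GE (p : nat) (M : 'M[F]_(p, m)) i a : (M *m E) i a = M i (phi a).
  rewrite mxE (bigD1 (phi a)) //= big1 => [|j ja]; first by rewrite !mxE eqxx mulr1 addr0.
  by rewrite !mxE eq_sym (negPf ja) mulr0.
have EE : E^T *m E = 1%:M.
  by apply/matrixP => a b; rewrite EG !mxE (inj_eq iphi) eq_sym.
have -> : \matrix_(i, j) G (phi i) (phi j) = 1%:M + (E^T *m (G - 1%:M)) *m E.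
  rewrite mulmxBr mulmxBl mulmx1 EE addrC subrK.
  by apply/matrixP => a b; rewrite GE EG mxE.
rewrite det_1addM_comm; set B := E^T *m _.
have EBin a j : (E *m B) (phi a) j = G (phi a) j - (phi a == j)%:R.
  rewrite mxE (bigD1 a) //= big1 => [|b ba]; first by rewrite /B EG !mxE eqxx mul1r addr0.
  by rewrite [E _ _]mxE (inj_eq iphi) (negPf ba) mul0r.
congr (\det _); apply/matrixP => i j; rewrite mxE [RHS]mxE mxE.
case: ifPn => [/imsetP[a _ ->]|nA]; first by rewrite EBin addrC subrK.
rewrite mxE big1 ?addr0 // => b _.
rewrite [E _ _]mxE; case: eqP => [bi|_]; last by rewrite mul0r.
by case/negP: nA; rewrite -bi imset_f.
Qed.

Lemma det_submx_noninj (k : nat) (phi : {ffun 'I_k -> 'I_m}) : ~ injective phi ->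
  \det (\matrix_(i, j) G (phi i) (phi j)) = 0.
Proof.
move=> /injectiveP/injectivePn [i [j ij pij]].
by apply: (determinant_alternate ij) => a; rewrite !mxE pij.
Qed.

End PrincipalMinors.
End DetIdentities.

Section FredholmAlgebra.
Variables (F : numFieldType) (m : nat) (G : 'M[F]_m).

Definition minor_sum k := \sum_(phi : {ffun 'I_k -> 'I_m})
  \det (\matrix_(i, j) G (phi i) (phi j)).

Lemma minor_sum_gt k : (m < k)%N -> minor_sum k = 0.
Proof.
move=> mk; apply: big1 => phi _; apply: det_submx_noninj => iphi.
by have := leq_card phi iphi; rewrite !card_ord leqNgt mk.
Qed.

(** Non-injective families repeat a row, and each k-subset is the image of k! injections; this
    factor cancels the one of Fredholm's series. *)
Lemma minor_sumE k : minor_sum k =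
  k`!%:R * \sum_(A : {set 'I_m} | #|A| == k) \det (row_patch G A).
Proof.
rewrite /minor_sum (bigID (fun phi : {ffun 'I_k -> 'I_m} => injectiveb phi)) /=.
rewrite [X in _ + X]big1 ?addr0; last first.
  by move=> phi /injectiveP; exact: det_submx_noninj.
rewrite (eq_bigr (fun phi : {ffun 'I_k -> 'I_m} => \det (row_patch G [set phi i | i : 'I_k]%SET))); last first.
  by move=> phi /injectiveP; exact: det_submx_patch.
rewrite (partition_big (fun phi : {ffun 'I_k -> 'I_m} => [set phi i | i : 'I_k]%SET)
  (fun A => #|A| == k)) /=; last first.
  by move=> phi /injectiveP iphi; rewrite card_imset // card_ord.
rewrite mulr_sumr; apply: eq_bigr => A /eqP kA.
rewrite (eq_bigr (fun=> \det (row_patch G A))); last by move=> phi /andP[_ /eqP ->].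
rewrite sumr_const mulr_natl; congr (_ *+ _).
transitivity #|[set phi in ffun_on (mem A) | injectiveb (phi : {ffun 'I_k -> 'I_m})]%SET|; last first.
  by rewrite card_inj_ffuns_on kA card_ord ffactnn.
rewrite cardsE; apply: eq_card => phi; rewrite -!topredE /= andbC.
have [/injectiveP iphi|] := boolP (injectiveb phi); last by rewrite !andbF.
rewrite !andbT; apply/eqP/ffun_onP => [<- i|pA]; first exact: imset_f.
apply/eqP; rewrite eqEcard card_imset // card_ord kA leqnn andbT.
by apply/fintype.subsetP => _ /imsetP[i _ ->]; exact: pA.
Qed.

Lemma fredholm_sum : \sum_(k < m.+1) (k`!%:R)^-1 * minor_sum k = \det (1%:M + G).
Proof.
rewrite det_1add_patch.
(* A subset has at most m elements, so [inord] preserves its cardinal. *)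
rewrite (partition_big (fun A : {set 'I_m} => inord #|A| : 'I_m.+1) predT) //=.
apply: eq_bigr => k _; have f0 : k`!%:R != 0 :> F by rewrite pnatr_eq0 -lt0n fact_gt0.
rewrite minor_sumE mulKf //.
apply: eq_bigl => A; rewrite -val_eqE /= inordK //.
by rewrite ltnS (leq_trans (max_card _)) // card_ord.
Qed.

End FredholmAlgebra.

Section Fredholm.
Context {R : realType}.
Notation mu := (@lebesgue_measure R).
Variables (D : set R) (mD : measurable D).

(** Integrands that are finite sums of products of functions of one variable are integrated variable
    by variable, with no exchange of integrals. *)
Lemma iterated_integral_prod (T : finType) k (c : T -> R) (h : T -> 'I_k -> R -> R) :
  (forall t i, rintegrable D (h t i)) ->
  iterated_integral D (fun x : k.-tuple R =>
    (\sum_t c t * \prod_(i < k) h t i (tnth x i))%:C) =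
  (\sum_t c t * \prod_(i < k) \int[mu]_(x in D) h t i x)%:C.
Proof.
elim: k c h => [|k ih] c h ih' /=.
  by congr (_%:C); apply: eq_bigr => t _; rewrite !big_ord0.
transitivity (Cintegral D (fun x => (\sum_t (c t * \prod_(i < k) \int[mu]_(x in D) h t (lift ord0 i) x)
    * h t ord0 x)%:C)).
  apply: eq_Cintegral => x _.
  transitivity (iterated_integral D (fun y : k.-tuple R => (\sum_t (c t * h t ord0 x) *
    \prod_(i < k) h t (lift ord0 i) (tnth y i))%:C)).
    congr iterated_integral; apply/funext => y; congr (_%:C); apply: eq_bigr => t _.
    rewrite big_ord_recl -!mulrA; congr (_ * (h t ord0 _ * _)).
    by apply: eq_bigr => i _; rewrite tnthS.
  rewrite (ih (fun t => c t * h t ord0 x) (fun t i => h t (lift ord0 i))) //.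
  by congr (_%:C); apply: eq_bigr => t _; rewrite mulrAC.
rewrite Cintegral_real Rintegral_sum //; last by move=> t _; apply: rintegrableZl.
congr (_%:C); apply: eq_bigr => t _; rewrite RintegralZl //; last exact: ih'.
by rewrite big_ord_recl mulrAC mulrA.
Qed.

Variables (m : nat) (f g : 'I_m -> R -> R).
Hypothesis ifg : forall i j, rintegrable D (fun x => f i x * g j x).

Let G : 'M[R]_m := \matrix_(i, j) \int[mu]_(x in D) (f i x * g j x).

(** The Leibniz expansion, followed by expansion of the sums defining the kernel, separates the
    variables; the one-variable integrals are entries of the Gram matrix, and the sum over
    permutations recombines into a determinant. *)
Lemma iterated_integral_det k :
  iterated_integral D (fun x : k.-tuple R => \det (\matrix_(i < k, j < k)
    (\sum_(a < m) f a (tnth x i) * g a (tnth x j))%:C)) = (minor_sum G k)%:C.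
Proof.
pose c (t : 'S_k * {ffun 'I_k -> 'I_m}) : R := (-1) ^+ t.1.
(* The variable x_i occurs in row i through f, and in column i, which belongs to row s^-1 i, through
   g. *)
pose h (t : 'S_k * {ffun 'I_k -> 'I_m}) i x := f (t.2 i) x * g (t.2 ((t.1^-1)%g i)) x.
transitivity (iterated_integral D (fun x : k.-tuple R =>
    (\sum_t c t * \prod_(i < k) h t i (tnth x i))%:C)).
  congr iterated_integral; apply/funext => x.
  transitivity (\det (map_mx (real_complex R) (\matrix_(i < k, j < k)
      \sum_(a < m) f a (tnth x i) * g a (tnth x j)))).
    by congr (\det _); apply/matrixP => i j; rewrite !mxE.
  rewrite det_map_mx; congr (_%:C).
  rewrite /determinant /c -(pair_bigA _ (fun (s : 'S_k) (phi : {ffun 'I_k -> 'I_m}) =>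
    (-1) ^+ s * \prod_(i < k) h (s, phi) i (tnth x i))) /=.
  apply: eq_bigr => s _; rewrite -mulr_sumr; congr (_ * _).
  rewrite (eq_bigr (fun i => \sum_(a < m) f a (tnth x i) * g a (tnth x (s i)))); last first.
    by move=> i _; rewrite mxE.
  rewrite bigA_distr_bigA; apply: eq_bigr => phi _.
  rewrite !big_split /=; congr (_ * _).
  rewrite (reindex_inj (@perm_inj _ s^-1%g)) /=.
  by apply: eq_bigr => i _; rewrite permKV.
rewrite iterated_integral_prod; last by move=> t i; exact: ifg.
congr (_%:C); rewrite /c -(pair_bigA _ (fun (s : 'S_k) (phi : {ffun 'I_k -> 'I_m}) =>
  (-1) ^+ s * \prod_(i < k) \int[mu]_(x in D) h (s, phi) i x)) /=.
rewrite exchange_big /=; apply: eq_bigr => phi _.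
have vinj : injective (fun s : 'S_k => (s^-1)%g) by exact: invg_inj.
rewrite (reindex_inj vinj) /=; apply: eq_bigr => s _.
rewrite odd_permV; congr (_ * _); apply: eq_bigr => i _.
by rewrite mxE mxE /h /= invgK.
Qed.

Lemma fredholm_det_finite_rank :
  fredholm_det D (fun x y => (\sum_(a < m) f a x * g a y)%:C) = (\det (1%:M + G))%:C.
Proof.
rewrite /fredholm_det.
under eq_fun do rewrite iterated_integral_det.
(* The k-th partial sum stops before index k, so it is stationary from m + 1 on: the terms of index
   greater than m vanish. *)
apply: (@lim_near_cst R[i]^o) => //; exists m.+1 => // k /= mk.
rewrite /series /= -fredholm_sum rmorph_sum.
rewrite (big_cat_nat (n := m.+1)) //= [X in _ + X]big1_seq ?addr0; last first.
  by move=> i /andP[_]; rewrite mem_index_iota => /andP[mi _]; rewrite minor_sum_gt // mulr0.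
by rewrite big_mkord; apply: eq_bigr => i _; rewrite rmorphM fmorphV rmorph_nat.
Qed.

End Fredholm.

(** * Exponential polynomials and the prelimit kernel *)

Section ExponentialPolynomials.
Context {R : realType}.
Implicit Types (f g : R -> R) (p q : {poly R}) (s t : seq R).

(** The zeros of f are x followed by s, so the derivative has one zero fewer. These stay to the
    right of x, which keeps the new list sorted when a zero is prepended. *)
Lemma rolle_seq f g x s : (forall y : R, is_derive y 1 f (g y)) ->
  path <%R x s -> f x = 0 -> (forall y, y \in s -> f y = 0) ->
  exists t, [/\ size t = size s, path <%R x t & forall y, y \in t -> g y = 0].
Proof.
move=> fg; elim: s x => [|y s ih] x /=; first by exists [::].
move=> /andP[xy ys] fx fs.
have fy : f y = 0 by apply: fs; rewrite mem_head.
have [t [st yt gt]] := ih y ys fy (fun z zs => fs z (mem_behead (s := y :: s) zs)).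
have [|||c cxy dc] := @Rolle _ f x y xy.
- by move=> z _; have [] := fg z.
- exact/continuous_subspaceT/(is_derive_continuous fg).
- by rewrite fx fy.
have /andP[xc cy] : x < c < y by move: cxy; rewrite in_itv.
exists (c :: t); split => /=; first by rewrite st.
  rewrite xc /=; case: t yt {st gt} => //= z t /andP[yz ->].
  by rewrite (lt_trans cy yz).
move=> z; rewrite in_cons => /orP[/eqP ->|]; last exact: gt.
by have [_ <-] := fg c; have [_ ->] := dc.
Qed.

Lemma poly_roots_eq0 p s : uniq s -> (size p <= size s)%N ->
  (forall x, x \in s -> p.[x] = 0) -> p = 0.
Proof.
move=> us ps ph; apply: contraTeq ps => p0; rewrite -ltnNge.
by apply: max_poly_roots => //; apply/allP => x xs; apply/rootP; exact: ph.
Qed.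

Lemma derivDscale_eq0 (h : R) q : h != 0 -> q^`() + h *: q = 0 -> q = 0.
Proof.
move=> h0 /eqP; rewrite addr_eq0 => /eqP e; apply/eqP; apply: contraT => q0.
have := lt_size_deriv q0.
by rewrite e size_polyN size_scale // ltnn.
Qed.

(** Differentiation replaces (p, q) by (p', q' + h q): the bound on the size of p drops by one, that
    of q is kept, and Rolle loses one zero. After n steps only the polynomial q remains. *)
Lemma exp_poly_eq0 (h : R) n m p q x s : h != 0 -> path <%R x s ->
  (size p <= n)%N -> (size q <= m)%N -> (n + m <= (size s).+1)%N ->
  (forall y, y \in x :: s -> p.[y] + q.[y] * expR (h * y) = 0) -> p = 0 /\ q = 0.
Proof.
move=> h0; elim: n p q x s => [|n ih] p q x s xs pn qm nms zero.
  have p0 : p = 0 by apply/eqP; rewrite -size_poly_eq0 -leqn0.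
  split => //; apply: (@poly_roots_eq0 _ (x :: s)).
  - exact: (@lt_sorted_uniq _ _ (x :: s) xs).
  - exact: leq_trans qm nms.
  - move=> y /zero; rewrite p0 horner0 add0r => /eqP.
    by rewrite mulf_eq0 (gt_eqF (expR_gt0 _)) orbF => /eqP.
pose f y := p.[y] + q.[y] * expR (h * y).
have df (y : R) : is_derive y 1 f (p^`().[y] + (q^`() + h *: q).[y] * expR (h * y)).
  have dp : is_derive y 1 (horner p) p^`().[y] by exact: is_derive_poly.
  have dq : is_derive y 1 (horner q) q^`().[y] by exact: is_derive_poly.
  have dl : is_derive y 1 (fun z : R => h * z) h.
    by apply: is_derive_eq; rewrite /GRing.scale /= mulr1.
  have de := is_derive1_comp (g := fun z : R => h * z) (is_derive_expR _) dl.
  by apply: is_derive_eq; rewrite hornerD hornerZ /GRing.scale /=; ring.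
have [t [st xt gt]] := rolle_seq df xs (zero x (mem_head _ _))
  (fun y ys => zero y (mem_behead (s := x :: s) ys)).
have [q1 p1] : q^`() + h *: q = 0 /\ p^`() = 0.
  (* With no zero of the derivative left, the count forces n = m = 0, so p is constant and q = 0. *)
  case: t st xt gt => [|y t] st xt gt.
    have : (n.+1 + m <= 1)%N by move: nms; rewrite -st.
    rewrite addSn ltnS leqn0 addn_eq0 => /andP[/eqP n0 /eqP m0].
    move: pn qm; rewrite n0 m0 leqn0 size_poly_eq0 => /size1_polyC pE /eqP ->.
    by rewrite pE deriv0 derivC scaler0 addr0.
  move: xt => /= /andP[_ yt].
  have [||||-> ->] := ih p^`() (q^`() + h *: q) y t yt => //.
  - have [->|p0] := eqVneq p 0; first by rewrite deriv0 size_poly0.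
    by rewrite -ltnS; apply: leq_trans (lt_size_deriv p0) pn.
  - apply: leq_trans (size_polyD _ _) _; rewrite geq_max.
    rewrite (leq_trans (size_scale_leq _ _)) // andbT.
    have [->|q0] := eqVneq q 0; first by rewrite deriv0 size_poly0.
    by apply: leq_trans qm; exact: ltnW (lt_size_deriv q0).
  - by move: nms; rewrite -st /= addSn ltnS.
have q0 := derivDscale_eq0 h0 q1.
split => //; apply: (@poly_roots_eq0 _ (x :: s)).
- exact: (@lt_sorted_uniq _ _ (x :: s) xs).
- by apply: leq_trans pn _; apply: leq_trans nms; rewrite leq_addr.
- by move=> y /zero; rewrite q0 horner0 mul0r addr0.
Qed.

End ExponentialPolynomials.

(** * The confluent linear system and its quadrature rule *)

Section Confluent.
Context {R : realType}.
Variables (n m : nat) (b b' : R) (x : 'I_(n + m) -> R).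
Hypotheses (bb' : b != b') (x_incr : forall i j : 'I_(n + m), (i < j)%N -> x i < x j).

Definition exp_poly_ev (p q : {poly R}) (y : R) : R :=
  p.[y] * expR (b * y) + q.[y] * expR (b' * y).

Lemma exp_poly_ev_inj (p q : {poly R}) : (size p <= n)%N -> (size q <= m)%N ->
  (forall k, exp_poly_ev p q (x k) = 0) -> p = 0 /\ q = 0.
Proof.
move=> pn qm ev0.
case: (posnP (n + m)) => [/eqP|nm0].
  rewrite addn_eq0 => /andP[/eqP n0 /eqP m0]; move: pn qm.
  by rewrite n0 m0 !leqn0 !size_poly_eq0 => /eqP -> /eqP ->.
pose s := [seq x k | k <- enum 'I_(n + m)].
have ss : size s = (n + m)%N by rewrite size_map size_enum_ord.
have so : sorted <%R s.
  rewrite sorted_map; apply: (@sub_sorted _ (fun i j : 'I_(n + m) => (i < j)%N)).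
    by move=> i j; exact: x_incr.
  by have := iota_ltn_sorted 0 (n + m); rewrite -val_enum_ord sorted_map.
(* Dividing by exp (b y) leaves a single exponential, with non-zero rate b' - b. *)
have evs y : y \in s -> p.[y] + q.[y] * expR ((b' - b) * y) = 0.
  move=> /mapP[k _ ->]; have := ev0 k; rewrite /exp_poly_ev => e.
  apply: (mulIf (lt0r_neq0 (expR_gt0 (b * x k)))); rewrite mul0r mulrDl -mulrA -expRD -e.
  by congr (_ + _ * expR _); ring.
case: s ss so evs => [|y s] ss so evs; first by move: nm0; rewrite -ss.
by apply: (exp_poly_eq0 _ so pn qm) evs; rewrite ?subr_eq0 1?eq_sym // -ss.
Qed.

Definition confluent_mx : 'M[R]_(n + m) := \matrix_(i, j)
  match fintype.split i with
  | inl k => x j ^+ k * expR (b * x j)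
  | inr k => x j ^+ k * expR (b' * x j)
  end.

Lemma mul_confluent_mx (r : 'rV[R]_(n + m)) j : (r *m confluent_mx) 0 j =
  exp_poly_ev (rVpoly (lsubmx r)) (rVpoly (rsubmx r)) (x j).
Proof.
rewrite mxE big_split_ord /= /exp_poly_ev.
rewrite (@horner_coef_wide _ n) ?size_poly // (@horner_coef_wide _ m) ?size_poly //.
rewrite !mulr_suml; congr (_ + _); apply: eq_bigr => k _; rewrite coef_rVpoly_ord !mxE.
  by rewrite (unsplitK (inl k)) mulrA.
by rewrite (unsplitK (inr k)) mulrA.
Qed.

Lemma confluent_unit : confluent_mx \in unitmx.
Proof.
rewrite -row_free_unit; apply: inj_row_free => r r0.
have [|||p0 q0] := @exp_poly_ev_inj (rVpoly (lsubmx r)) (rVpoly (rsubmx r)).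
- exact: size_poly.
- exact: size_poly.
- by move=> k; rewrite -mul_confluent_mx r0 mxE.
by rewrite -[r]hsubmxK -[lsubmx r]rVpolyK -[rsubmx r]rVpolyK p0 q0 !linear0 row_mx0.
Qed.

Variables (V V' : {poly R} -> R).
Hypotheses (VE : forall p : {poly R}, (size p <= n)%N -> V p = \sum_(k < n) p`_k * V 'X^k)
  (VE' : forall p : {poly R}, (size p <= m)%N -> V' p = \sum_(k < m) p`_k * V' 'X^k).

Definition confluent_col : 'cV[R]_(n + m) := \col_i
  match fintype.split i with inl k => V 'X^k | inr k => V' 'X^k end.

Definition confluent_weight k : R := (invmx confluent_mx *m confluent_col) k 0.

(** By linearity both sides are products with the row r of the coefficients of p and q: r times the
    right-hand side column on the left, and r times the matrix times the solution on the right. *)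
Lemma confluent_quadrature (p q : {poly R}) : (size p <= n)%N -> (size q <= m)%N ->
  V p + V' q = \sum_k exp_poly_ev p q (x k) * confluent_weight k.
Proof.
move=> pn qm; pose r : 'rV[R]_(n + m) := row_mx (poly_rV p) (poly_rV q).
transitivity ((r *m confluent_col) 0 0).
  rewrite mxE big_split_ord /= VE // VE' //; congr (_ + _); apply: eq_bigr => k _.
    by rewrite [r]/(row_mx _ _) row_mxEl !mxE (unsplitK (inl k)).
  by rewrite [r]/(row_mx _ _) row_mxEr !mxE (unsplitK (inr k)).
rewrite -[confluent_col](mulKVmx confluent_unit) (mulmxA r) mxE.
apply: eq_bigr => k _; rewrite mul_confluent_mx /r row_mxKl row_mxKr.
by rewrite !poly_rV_K.
Qed.

End Confluent.

(** * Finite differences and limits of matrices *)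

Section FiniteDifferences.
Context {R : realType}.
Implicit Types (f : R -> R) (h b x : R) (k : nat).

Fixpoint fdiff h k f b : R :=
  if k is k'.+1 then fdiff h k' f (b + h) - fdiff h k' f b else f b.

(** The signed binomial (-1)^(k - a) C(k, a), zero for a > k; so the sum expressing a difference of
    order k may run over any larger range, such as a full block of rows. *)
Fixpoint fdiff_coef k a : R :=
  if k is k'.+1 then (if a is a'.+1 then fdiff_coef k' a' else 0) - fdiff_coef k' a
  else (a == 0)%:R.

Lemma fdiffE h k f b N : (k < N)%N ->
  fdiff h k f b = \sum_(a < N) fdiff_coef k a * f (b + h * a%:R).
Proof.
elim: k b N => [|k ih] b [|N] // kN.
  rewrite big_ord_recl /= mul1r mulr0 addr0 big1 ?addr0 // => i _.
  by rewrite mul0r.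
rewrite /= (ih (b + h) N kN) (ih b N.+1 (ltnW kN)).
rewrite [in LHS]big_ord_recl [in RHS]big_ord_recl /= sub0r opprD addrCA mulNr; congr (_ + _).
rewrite -sumrB; apply: eq_bigr => i _; rewrite mulrBl; congr (_ * f _ - _).
by rewrite /bump /= add1n -[i.+1]add1n natrD mulrDr mulr1 addrA.
Qed.

Lemma is_derive_fdiff h k f (f' : R -> R) : (forall x : R, is_derive x 1 f (f' x)) ->
  forall x : R, is_derive x 1 (fdiff h k f) (fdiff h k f' x).
Proof.
move=> df; elim: k => [|k ih] x //=.
have h1 := ih x.
have ds : is_derive x 1 (fun y : R => y + h) 1 by apply: is_derive_eq; rewrite addr0.
have h2 := is_derive1_comp (g := fun y : R => y + h) (ih (x + h)) ds.
by apply: is_derive_eq; rewrite mulr1.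
Qed.

(** The outermost difference is h times the derivative at some c, that is h times a difference of
    order k of f', to which the induction applies at base point c. *)
Lemma fdiff_mean_value (f : nat -> R -> R) h k b : 0 <= h ->
  (forall i (x : R), is_derive x 1 (f i) (f i.+1 x)) ->
  exists2 xi, b <= xi <= b + h * k%:R & fdiff h k (f 0) b = h ^+ k * f k xi.
Proof.
move=> h0; elim: k f b => [|k ih] f b df.
  by exists b; rewrite ?mulr0 ?addr0 ?lexx //= mul1r.
have [c cb e] := mean_value b (b + h) (is_derive_fdiff h k (df 0)).
have {}cb : b <= c <= b + h.
  have bh : b <= b + h by rewrite lerDl.
  by move: cb; rewrite (min_l bh) (max_r bh).
have [xi /andP[x1 x2] e2] := ih (fun i => f i.+1) c (fun i => df i.+1).
exists xi.
  case/andP: cb => c1 c2; rewrite (le_trans c1) //= (le_trans x2) //.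
  by rewrite -[k.+1]add1n natrD mulrDr mulr1 addrA lerD2r.
by rewrite /= e e2 exprS; ring.
Qed.

(** The base point may move with K: the second group of rows does not start at a_2 exactly. *)
Lemma cvg_fdiff (f : nat -> R -> R) k b (h_ b_ : nat -> R) :
  (forall i (x : R), is_derive x 1 (f i) (f i.+1 x)) ->
  (\forall K \near \oo, 0 < h_ K) -> h_ K @[K --> \oo] --> (0 : R) ->
  b_ K @[K --> \oo] --> b ->
  (h_ K)^-1 ^+ k * fdiff (h_ K) k (f 0) (b_ K) @[K --> \oo] --> f k b.
Proof.
move=> df hpos h0 bb.
have ex K : exists xi, 0 < h_ K -> b_ K <= xi <= b_ K + h_ K * k%:R /\
    fdiff (h_ K) k (f 0) (b_ K) = h_ K ^+ k * f k xi.
  (* A default value for the finitely many indices at which the step is not positive. *)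
  case: (ltP 0 (h_ K)) => hK; last by exists 0.
  by have [xi x1 x2] := fdiff_mean_value k (b_ K) (ltW hK) df; exists xi.
have [xi xiP] := choice ex.
have xib : xi K @[K --> \oo] --> b.
  have b2 : b_ K + h_ K * k%:R @[K --> \oo] --> b.
    rewrite -[b in X in _ --> X]addr0 -(mul0r k%:R); apply: cvgD => //.
    by apply: cvgMr_tmp.
  apply: (squeeze_cvgr _ bb b2).
  by apply: filterS hpos => K /xiP[].
have cf : continuous (f k) := is_derive_continuous (df k).
have lim : f k (xi K) @[K --> \oo] --> f k b by apply: continuous_cvg => //; exact: cf.
apply: cvg_trans lim; apply: near_eq_cvg.
apply: filterS hpos => K hK; have [_ ->] := xiP K hK.
by rewrite mulrA -exprMn mulVf ?gt_eqF // expr1n mul1r.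
Qed.

End FiniteDifferences.

Section MatrixLimits.
Context {R : realType}.

Lemma cvg_sum_seq (I : Type) (r : seq I) (f : I -> nat -> R) (l : I -> R) :
  (forall i, f i K @[K --> \oo] --> l i) ->
  \sum_(i <- r) f i K @[K --> \oo] --> \sum_(i <- r) l i.
Proof.
move=> fl; elim: r => [|i r ih].
  by rewrite big_nil; under eq_fun do rewrite big_nil; exact: cvg_cst.
by rewrite big_cons; under eq_fun do rewrite big_cons; exact: cvgD.
Qed.

Lemma cvg_prod_seq (I : Type) (r : seq I) (f : I -> nat -> R) (l : I -> R) :
  (forall i, f i K @[K --> \oo] --> l i) ->
  \prod_(i <- r) f i K @[K --> \oo] --> \prod_(i <- r) l i.
Proof.
move=> fl; elim: r => [|i r ih].
  by rewrite big_nil; under eq_fun do rewrite big_nil; exact: cvg_cst.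
by rewrite big_cons; under eq_fun do rewrite big_cons; exact: cvgM.
Qed.

Lemma cvg_det n (M : nat -> 'M[R]_n) (L : 'M[R]_n) :
  (forall i j, M K i j @[K --> \oo] --> L i j) -> \det (M K) @[K --> \oo] --> \det L.
Proof.
move=> ML; rewrite /determinant; apply: cvg_sum_seq => s.
by apply: cvgMl_tmp; exact: cvg_prod_seq.
Qed.

Lemma cvg_mulmx n p q (M : nat -> 'M[R]_(n, p)) (L : 'M[R]_(n, p))
    (M' : nat -> 'M[R]_(p, q)) (L' : 'M[R]_(p, q)) :
  (forall i j, M K i j @[K --> \oo] --> L i j) ->
  (forall i j, M' K i j @[K --> \oo] --> L' i j) ->
  forall i j, (M K *m M' K) i j @[K --> \oo] --> (L *m L') i j.
Proof.
move=> h h' i j; rewrite mxE; under eq_fun do rewrite mxE.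
by apply: cvg_sum_seq => k; exact: cvgM.
Qed.

Lemma near_unitmx n (M : nat -> 'M[R]_n) (L : 'M[R]_n) : L \in unitmx ->
  (forall i j, M K i j @[K --> \oo] --> L i j) -> \forall K \near \oo, M K \in unitmx.
Proof.
rewrite unitmxE unitfE => L0 ML.
have h : \forall K \near \oo, \det (M K) != 0 by apply: cvgr_neq0 L0; exact: cvg_det.
by apply: filterS h => K; rewrite unitmxE unitfE.
Qed.

(** By Cramer's formula the entries are quotients of determinants, once M K is invertible. *)
Lemma cvg_invmx n (M : nat -> 'M[R]_n) (L : 'M[R]_n) : L \in unitmx ->
  (forall i j, M K i j @[K --> \oo] --> L i j) ->
  forall i j, invmx (M K) i j @[K --> \oo] --> invmx L i j.
Proof.
move=> Lu ML i j.
have lim : (\det (M K))^-1 * \adj (M K) i j @[K --> \oo] --> invmx L i j.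
  rewrite /invmx Lu mxE; apply: cvgM.
    by apply: cvgV; [move: Lu; rewrite unitmxE unitfE|exact: cvg_det].
  rewrite mxE; under eq_fun do rewrite mxE.
  apply: cvgMl_tmp; apply: cvg_det => a c.
  by rewrite !mxE; under eq_fun do rewrite !mxE; exact: ML.
apply: cvg_trans lim; apply: near_eq_cvg.
apply: filterS (near_unitmx Lu ML) => K Ku.
by rewrite /invmx Ku [RHS]mxE.
Qed.

End MatrixLimits.

Section GmeanMonomials.
Context {R : realType}.
Variables (al : R).

Lemma gmeanXn l k : gmean al l 'X^k = gmoment al k l.
Proof.
rewrite (@gmean_widen _ _ _ _ k.+1) ?size_polyXn // big_ord_recr /= coefXn eqxx mul1r.
by rewrite big1 ?add0r // => i _; rewrite coefXn ltn_eqF // mul0r.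
Qed.

Lemma gmean_coefs l (p : {poly R}) n : (size p <= n)%N ->
  gmean al l p = \sum_(k < n) p`_k * gmean al l 'X^k.
Proof. by move=> pn; rewrite (gmean_widen _ _ pn); apply: eq_bigr => k _; rewrite gmeanXn. Qed.

End GmeanMonomials.

(** * Convergence of the prelimit kernel *)

Section PrelimitConvergence.
Context {R : realType}.
Variables (n m : nat) (a1 a2 : R) (nu : 'I_(n + m) -> R).
Hypotheses (ha : a1 < a2) (nu_incr : forall i j : 'I_(n + m), (i < j)%N -> nu i < nu j).
Variables (s t u v : R).
Hypotheses (hs : 0 < s < 1) (ht : 0 < t < 1).

Let al : R := t / (2 * (1 - t)).
Let w0 : R := v / (1 - t).

Let t0 : 0 < t. Proof. by case/andP: ht. Qed.
Let t1 : 0 < 1 - t. Proof. by case/andP: ht => _; rewrite subr_gt0. Qed.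
Let s1 : 0 < 1 - s. Proof. by case/andP: hs => _; rewrite subr_gt0. Qed.
Let al0 : 0 < al. Proof. by rewrite divr_gt0 // mulr_gt0. Qed.

(* the solution of the limiting linear system, obtained from A_mx by divided differences *)
Definition node_weight (k : 'I_(n + m)) : R :=
  confluent_weight a1 a2 nu (gmean al (a1 - w0)) (gmean al (a2 - w0)) k.

Let B K : 'M[R]_(n + m) := \matrix_(i, j) expR (mu a1 a2 K i * nu j).
Let G K : 'cV[R]_(n + m) := \col_i gauss_dual al (mu a1 a2 K i - w0).

Let h (K : nat) : R := (a2 - a1) / K%:R.

Let mul_l K (i : 'I_n) : mu a1 a2 K (lshift m i) = a1 + h K * i%:R.
Proof. by rewrite /mu /= ltn_ord mulrAC. Qed.

(** The row index is n + i in the second block, so its progression starts at a_2 + h n. *)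
Let mul_r K (i : 'I_m) : mu a1 a2 K (rshift n i) = (a2 + h K * n%:R) + h K * i%:R.
Proof.
by rewrite /mu /= ltnNge leq_addr /= natrD mulrDr mulrDl addrA mulrAC [X in _ + X]mulrAC.
Qed.

(* Divided differences of the rows, which converge to derivatives. *)
Let T K : 'M[R]_(n + m) := block_mx
  (\matrix_(a, i) ((h K)^-1 ^+ a * @fdiff_coef R a i)) 0
  0 (\matrix_(a, i) ((h K)^-1 ^+ a * @fdiff_coef R a i)).

Let TE K p (f : 'I_p -> R -> R) (M : 'M[R]_(n + m, p)) :
  (forall i j, M i j = f j (mu a1 a2 K i)) -> forall i j, (T K *m M) i j =
  match fintype.split i with
  | inl k => (h K)^-1 ^+ k * fdiff (h K) k (f j) a1
  | inr k => (h K)^-1 ^+ k * fdiff (h K) k (f j) (a2 + h K * n%:R)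
  end.
Proof.
move=> Mf i j; rewrite mxE big_split_ord /=; case: split_ordP => k ->.
  rewrite [X in _ + X]big1 ?addr0 => [|c _]; last by rewrite block_mxEur mxE mul0r.
  rewrite (fdiffE _ _ _ (ltn_ord k)) mulr_sumr; apply: eq_bigr => c _.
  by rewrite block_mxEul mxE Mf mul_l mulrA.
rewrite [X in X + _]big1 ?add0r => [|c _]; last by rewrite block_mxEdl mxE mul0r.
rewrite (fdiffE _ _ _ (ltn_ord k)) mulr_sumr; apply: eq_bigr => c _.
by rewrite block_mxEdr mxE Mf mul_r mulrA.
Qed.

(** Only for K >= 1: at K = 0 the convention on division by zero gives h = 0. *)
Let h_gt0 : \forall K \near \oo, 0 < h K.
Proof. by exists 1 => // K /= K0; rewrite divr_gt0 ?subr_gt0 // ltr0n. Qed.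

Let h_cvg : h K @[K --> \oo] --> (0 : R).
Proof.
rewrite -(cvg_shiftS h).
have lim : (a2 - a1) * (K.+1%:R : R)^-1 @[K --> \oo] --> (a2 - a1) * 0.
  by apply: cvgMl_tmp; exact: cvg_inv_natr.
by rewrite mulr0 in lim.
Qed.

Let base_cvg : a2 + h K * n%:R @[K --> \oo] --> a2.
Proof.
have lim : a2 + h K * n%:R @[K --> \oo] --> a2 + 0 * n%:R.
  by apply: cvgD; [exact: cvg_cst|apply: cvgMr_tmp; exact: h_cvg].
by rewrite mul0r addr0 in lim.
Qed.

Let TB_cvg i j : (T K *m B K) i j @[K --> \oo] --> confluent_mx a1 a2 nu i j.
Proof.
pose f j (k : nat) (y : R) := nu j ^+ k * expR (y * nu j).
have df k (y : R) : is_derive y 1 (f j k) (f j k.+1 y).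
  have dl : is_derive y 1 (fun z : R => z * nu j) (nu j).
    by apply: is_derive_eq; rewrite /GRing.scale /=; ring.
  have de := is_derive1_comp (g := fun z : R => z * nu j) (is_derive_expR _) dl.
  by apply: is_derive_eq; rewrite /f exprS /GRing.scale /=; ring.
have E K : (T K *m B K) i j = match fintype.split i with
  | inl k => (h K)^-1 ^+ k * fdiff (h K) k (f j 0) a1
  | inr k => (h K)^-1 ^+ k * fdiff (h K) k (f j 0) (a2 + h K * n%:R)
  end by apply: (TE (f := fun j => f j 0)) => i' j'; rewrite mxE /f expr0 mul1r.
under eq_fun do rewrite E; rewrite mxE; case: fintype.split => k /=.
  exact: (@cvg_fdiff _ (f j) k a1 h (fun=> a1) df h_gt0 h_cvg (cvg_cst _)).
exact: (@cvg_fdiff _ (f j) k a2 h (fun K => a2 + h K * n%:R) df h_gt0 h_cvg base_cvg).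
Qed.

Let TG_cvg i j : (T K *m G K) i j @[K --> \oo] -->
  @confluent_col R n m (gmean al (a1 - w0)) (gmean al (a2 - w0)) i j.
Proof.
pose f (k : nat) (y : R) := gmoment al k (y - w0).
have df k (y : R) : is_derive y 1 (f k) (f k.+1 y).
  have dl : is_derive y 1 (fun z : R => z - w0) 1 by apply: is_derive_eq; rewrite subr0.
  have := is_derive1_comp (g := fun z : R => z - w0) (is_derive_gmoment al0 k _) dl.
  by rewrite mulr1.
have E K : (T K *m G K) i j = match fintype.split i with
  | inl k => (h K)^-1 ^+ k * fdiff (h K) k (f 0) a1
  | inr k => (h K)^-1 ^+ k * fdiff (h K) k (f 0) (a2 + h K * n%:R)
  end by apply: (TE (f := fun=> f 0)) => i' j'; rewrite mxE /f gmoment0.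
under eq_fun do rewrite E; rewrite mxE; case: fintype.split => k; rewrite gmeanXn.
  exact: (@cvg_fdiff _ (f) k a1 h (fun=> a1) df h_gt0 h_cvg (cvg_cst _)).
exact: (@cvg_fdiff _ (f) k a2 h (fun K => a2 + h K * n%:R) df h_gt0 h_cvg base_cvg).
Qed.

Let a12 : a1 != a2. Proof. by rewrite lt_eqF. Qed.

Let TB_unit : \forall K \near \oo, T K *m B K \in unitmx.
Proof. by apply: near_unitmx TB_cvg; exact: confluent_unit. Qed.

Let x_ K := invmx (B K) *m G K.

(** Applying [T K] to both sides does not change the solution of the system, but makes its matrix
    and its right-hand side converge. *)
Let x_cvg k : x_ K k 0 @[K --> \oo] --> node_weight k.
Proof.
have lim : (invmx (T K *m B K) *m (T K *m G K)) k 0 @[K --> \oo] --> node_weight k.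
  apply: cvg_mulmx => [i j|i j]; last exact: TG_cvg.
  by apply: cvg_invmx => [|i' j']; [exact: confluent_unit|exact: TB_cvg].
apply: cvg_trans lim; apply: near_eq_cvg.
apply: filterS TB_unit => K TBu; have := TBu; rewrite unitmx_mul => /andP[Tu Bu].
have -> : T K *m G K = (T K *m B K) *m x_ K by rewrite -mulmxA /x_ mulKVmx.
by rewrite mulKmx.
Qed.

Let heat1E (x y : R) : heat 1 x y =
  (Num.sqrt (2 * pi * 1))^-1 * expR (- x ^+ 2 / 2) * expR (x * y) * expR (- y ^+ 2 / 2).
Proof.
rewrite /heat ltr01 -!mulrA; congr (_ * _); rewrite -!expRD; congr expR.
by field.
Qed.

Let kap : R := expR (v ^+ 2 / (2 * (1 - t))) * (Num.sqrt (2 * pi * t))^-1 *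
  (2 * Num.sqrt (pi * al)).

(** Completing the square with 1 / (4 al) = (1 - t) / (2 t) and w0 = v / (1 - t). The factor exp (-
    x^2 / 2) is the one that [heat 1] also contributes to the row of x. *)
Let heattE (x : R) : heat t x v = kap * expR (- x ^+ 2 / 2) * gauss_dual al (x - w0).
Proof.
rewrite /heat t0 /kap /gauss_dual.
have sq : Num.sqrt (pi * al) != 0 by rewrite gt_eqF // sqrtr_gt0 mulr_gt0 ?pi_gt0.
have -> : expR (- (x - v) ^+ 2 / (2 * t)) = expR (v ^+ 2 / (2 * (1 - t))) *
    expR (- x ^+ 2 / 2) * expR (- ((x - w0) ^+ 2 / (4 * al))).
  rewrite -!expRD; congr expR; rewrite /w0 /al; field.
  by rewrite !gt_eqF.
have st : Num.sqrt (2 * pi * t) != 0 by rewrite gt_eqF // sqrtr_gt0 !mulr_gt0 ?pi_gt0.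
by field; rewrite sq st.
Qed.

Let c0 : R := (Num.sqrt (2 * pi * 1))^-1.

Let c0_gt0 : 0 < c0.
Proof. by rewrite invr_gt0 sqrtr_gt0 !mulr_gt0 ?pi_gt0. Qed.

(** A is B between two diagonal matrices. The row factors exp (- mu^2 / 2) cancel those of the heat
    factor; the column factors are inverted and give exp (nu_k^2 / 2). *)
Let A_inv K : B K \in unitmx -> forall k,
  \sum_(j < n + m) invmx (A_mx a1 a2 nu K) k j * heat t (mu a1 a2 K j) v =
  kap / c0 * expR (nu k ^+ 2 / 2) * x_ K k 0.
Proof.
move=> Bu k.
pose D : 'rV[R]_(n + m) := \row_i (c0 * expR (- mu a1 a2 K i ^+ 2 / 2)).
pose E : 'rV[R]_(n + m) := \row_j expR (- nu j ^+ 2 / 2).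
have AE : A_mx a1 a2 nu K = diag_mx D *m B K *m diag_mx E.
  apply/matrixP => i j; rewrite mul_mx_diag mul_diag_mx !mxE heat1E -/c0; ring.
have Au : A_mx a1 a2 nu K \in unitmx.
  rewrite AE !unitmx_mul Bu andbT !unitmxE !det_diag !unitfE; apply/andP; split.
    apply/prodf_neq0 => i _; rewrite mxE gt_eqF // mulr_gt0 ?expR_gt0 //.
  by apply/prodf_neq0 => i _; rewrite mxE gt_eqF // expR_gt0.
pose X : 'cV[R]_(n + m) := \col_k (kap / c0 * expR (nu k ^+ 2 / 2) * x_ K k 0).
pose H : 'cV[R]_(n + m) := \col_j heat t (mu a1 a2 K j) v.
have AX : A_mx a1 a2 nu K *m X = H.
  apply/matrixP => i j; rewrite ord1 [RHS]mxE heattE mxE.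
  have xG : (B K *m x_ K) i 0 = gauss_dual al (mu a1 a2 K i - w0).
    by rewrite /x_ mulKVmx // mxE.
  have BxE : (B K *m x_ K) i 0 = \sum_l expR (mu a1 a2 K i * nu l) * x_ K l 0.
    by rewrite mxE; apply: eq_bigr => l _; rewrite [B _ _ _]mxE.
  rewrite -xG BxE mulr_sumr; apply: eq_bigr => l _.
  rewrite [A_mx _ _ _ _ _ _]mxE [X _ _]mxE heat1E -/c0; move: (x_ K l 0) => x.
  have e1 : expR (- nu l ^+ 2 / 2) * expR (nu l ^+ 2 / 2) = 1.
    by rewrite -expRD mulNr addNr expR0.
  have cc : c0 / c0 = 1 by rewrite divff // gt_eqF.
  transitivity (kap * expR (- mu a1 a2 K i ^+ 2 / 2) * (expR (mu a1 a2 K i * nu l) * x) *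
     (expR (- nu l ^+ 2 / 2) * expR (nu l ^+ 2 / 2)) * (c0 / c0)); first ring.
  by rewrite e1 cc !mulr1.
transitivity ((invmx (A_mx a1 a2 nu K) *m H) k 0).
  by rewrite mxE; apply: eq_bigr => j _; rewrite [H _ _]mxE.
by rewrite -AX mulKmx // mxE.
Qed.

Let const_eq : (Num.sqrt (2 * pi * (1 - s)))^-1 * ((Num.sqrt (2 * pi * t))^-1 *
  (2 * Num.sqrt (pi * al))) * Num.sqrt (2 * pi * 1) = (Num.sqrt ((1 - s) * (1 - t)))^-1.
Proof.
have p2 : 0 < 2 * pi :> R by rewrite mulr_gt0 ?pi_gt0.
have sp : Num.sqrt (2 * pi) != 0 :> R by rewrite gt_eqF // sqrtr_gt0.
have st : Num.sqrt (2 * pi * t) != 0 :> R by rewrite gt_eqF // sqrtr_gt0 mulr_gt0.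
have ss : Num.sqrt (1 - s) != 0 by rewrite gt_eqF // sqrtr_gt0.
have sst : Num.sqrt (1 - t) != 0 by rewrite gt_eqF // sqrtr_gt0.
have -> : 2 * Num.sqrt (pi * al) = Num.sqrt (2 * pi * t) / Num.sqrt (1 - t).
  rewrite -[2 in LHS]ger0_norm // -sqrtr_sqr -sqrtrM ?sqr_ge0 // -sqrtrV ?ltW //.
  rewrite -sqrtrM ?(ltW (mulr_gt0 _ _)) //; congr Num.sqrt.
  by rewrite /al; field; rewrite gt_eqF.
rewrite mulr1 (sqrtrM _ (ltW p2)) (sqrtrM _ (ltW s1)); field.
by rewrite sp st ss sst.
Qed.

(** The conjugation removes exactly the terms in u^2 and v^2, leaving a weight in y that does not
    depend on v. *)
Let weight_eq (y : R) : conj_factor s u t v * heat (1 - s) u y *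
    (kap / c0 * expR (y ^+ 2 / 2)) = (Num.sqrt ((1 - s) * (1 - t)))^-1 *
    expR (- (s / (2 * (1 - s))) * y ^+ 2 + u * y / (1 - s)).
Proof.
rewrite -const_eq /heat s1 /kap /c0 invrK /conj_factor.
have <- : expR (u ^+ 2 / (2 * (1 - s)) - v ^+ 2 / (2 * (1 - t))) *
    expR (- (u - y) ^+ 2 / (2 * (1 - s))) * expR (v ^+ 2 / (2 * (1 - t))) *
    expR (y ^+ 2 / 2) = expR (- (s / (2 * (1 - s))) * y ^+ 2 + u * y / (1 - s)).
  by rewrite -!expRD; congr expR; field; rewrite !gt_eqF.
move: (Num.sqrt (2 * pi * (1 - s)))^-1 (Num.sqrt (2 * pi * t))^-1 (Num.sqrt (2 * pi * 1))
  (Num.sqrt (pi * al)) => k1 k2 k3 k4; ring.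
Qed.

Lemma LK_kernel_cvg : LK_kernel a1 a2 nu K s u t v @[K --> \oo] -->
  - q_kernel s u t v + (Num.sqrt ((1 - s) * (1 - t)))^-1 * \sum_k
    expR (- (s / (2 * (1 - s))) * nu k ^+ 2 + u * nu k / (1 - s)) * node_weight k.
Proof.
pose Z k := expR (- (s / (2 * (1 - s))) * nu k ^+ 2 + u * nu k / (1 - s)).
have lim : - q_kernel s u t v + (Num.sqrt ((1 - s) * (1 - t)))^-1 * \sum_k
    Z k * x_ K k 0 @[K --> \oo] --> - q_kernel s u t v +
    (Num.sqrt ((1 - s) * (1 - t)))^-1 * \sum_k Z k * node_weight k.
  apply: cvgD; first exact: cvg_cst.
  apply: cvgMl_tmp; apply: cvg_sum_seq => k; apply: cvgMl_tmp; exact: x_cvg.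
apply: cvg_trans lim; apply: near_eq_cvg.
apply: filterS TB_unit => K; rewrite unitmx_mul => /andP[_ Bu].
apply/esym; rewrite /LK_kernel /LK_tilde mulrDr mulrN; congr (_ + _).
rewrite exchange_big /= !mulr_sumr; apply: eq_bigr => k _.
under eq_bigr do rewrite -mulrA.
rewrite -mulr_sumr A_inv // /Z [RHS]mulrA -(weight_eq (nu k)) !mulrA //.
Qed.

End PrelimitConvergence.

(** * Residues at the nodes *)

Section Lagrange.
Context {R : realType}.
Variables (n : nat) (x : 'I_n -> R).
Hypotheses (x0 : forall i, x i != 0) (x_inj : injective x).

Definition node_poly : {poly R} := \prod_(k < n) (1 - (x k)^-1 *: 'X).

Definition lag_den (i : 'I_n) : R := \prod_(k < n | k != i) (1 - x i / x k).

Definition lag (i : 'I_n) : {poly R} :=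
  (lag_den i)^-1 *: \prod_(k < n | k != i) (1 - (x k)^-1 *: 'X).

(* the residue of [1 / node_poly] at [x i] *)
Definition res (i : 'I_n) : R := - x i / lag_den i.

Lemma horner_factor (k : 'I_n) (y : R) : (1 - (x k)^-1 *: 'X : {poly R}).[y] = 1 - y / x k.
Proof. by rewrite hornerD hornerN hornerZ hornerX hornerC mulrC. Qed.

Lemma lag_den_neq0 i : lag_den i != 0.
Proof.
apply/prodf_neq0 => k ki; rewrite subr_eq0 eq_sym -subr_eq0.
rewrite -[1](divff (x0 k)) -mulrBl mulf_neq0 ?invr_eq0 // subr_eq0.
by apply: contra ki => /eqP /x_inj ->.
Qed.

Lemma res_neq0 i : res i != 0.
Proof. by rewrite mulf_neq0 ?oppr_eq0 // invr_eq0 lag_den_neq0. Qed.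

Lemma size_factor (k : 'I_n) : (size (1 - (x k)^-1 *: 'X : {poly R})%R <= 2)%N.
Proof.
apply: leq_trans (size_polyD _ _) _; rewrite size_poly1 size_polyN geq_max /=.
by apply: leq_trans (size_scale_leq _ _) _; rewrite size_polyX.
Qed.

Lemma size_prod_le (I : eqType) (r : seq I) (P : pred I) (f : I -> {poly R}) :
  (forall i, (size (f i) <= 2)%N) ->
  (size (\prod_(i <- r | P i) f i)%R <= (count P r).+1)%N.
Proof.
move=> f2; elim: r => [|i r ih]; first by rewrite big_nil size_poly1.
rewrite big_cons /=; case: (P i) => //=; rewrite add1n.
apply: leq_trans (size_polyMleq _ _) _.
apply: leq_trans (_ : _ <= (2 + (count P r).+1).-1)%N _ => //.
by rewrite -!subn1 leq_sub2r // leq_add.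
Qed.

Lemma size_lag i : (size (lag i) <= n)%N.
Proof.
apply: leq_trans (size_scale_leq _ _) _.
apply: leq_trans (size_prod_le _ _ size_factor) _.
have -> : count (fun k => k != i) (index_enum 'I_n) = #|predC1 i|.
  by rewrite cardE /enum_mem size_filter /index_enum; congr count; apply/funext => k.
by rewrite cardC1 card_ord prednK // (leq_ltn_trans _ (ltn_ord i)).
Qed.

Lemma lag_node i j : (lag i).[x j] = (i == j)%:R.
Proof.
rewrite hornerZ horner_prod; case: eqVneq => [->|ij].
  rewrite -[lag_den j]/(\prod_(k < n | k != j) (1 - x j / x k)).
  under [X in _ * X]eq_bigr do rewrite horner_factor.
  by rewrite mulVf // lag_den_neq0.
rewrite (bigD1 j) 1?eq_sym //= horner_factor divff // subrr mul0r mulr0 //.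
Qed.

Lemma node_polyE i : node_poly = (res i)^-1 *: (('X - (x i)%:P) * lag i).
Proof.
rewrite /node_poly (bigD1 i) //= /lag /res invf_div -scalerAr scalerA.
have -> : lag_den i / - x i * (lag_den i)^-1 = - (x i)^-1.
  by rewrite invrN; field; rewrite x0 lag_den_neq0.
rewrite scalerAl; congr (_ * _).
by rewrite scalerBr -alg_polyC scalerA mulNr mulVf // !scaleNr scale1r opprK addrC.
Qed.

(** The difference has size at most n and vanishes at n distinct nodes. *)
Lemma sum_lag : (0 < n)%N -> \sum_i lag i = 1.
Proof.
move=> n0; apply/eqP; rewrite -subr_eq0; apply/eqP.
apply: (@poly_roots_eq0 _ _ [seq x i | i <- enum 'I_n]).
- by rewrite map_inj_uniq ?enum_uniq.
- rewrite size_map size_enum_ord; apply: leq_trans (size_polyD _ _) _.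
  rewrite size_polyN size_poly1 geq_max n0 andbT.
  by apply: leq_trans (size_sum _ _ _) _; apply/bigmax_leqP => i _; exact: size_lag.
- move=> y /mapP[j _ ->]; rewrite !hornerE horner_sum.
  rewrite (bigD1 j) //= lag_node eqxx big1 ?addr0 ?subrr // => i ij.
  by rewrite lag_node (negPf ij).
Qed.

Lemma horner_node_poly i (y : R) : node_poly.[y] = (y - x i) * (lag i).[y] / res i.
Proof. by rewrite (node_polyE i) hornerZ hornerM hornerXsubC mulrC. Qed.

Local Notation mapC := (map_poly (real_complex R)).

Lemma horner_node_polyC (z : R[i]) : (mapC node_poly).[z] = \prod_(k < n) (1 - z / (x k)%:C).
Proof.
rewrite rmorph_prod horner_prod; apply: eq_bigr => k _.
rewrite rmorphB /= rmorph1 map_polyZ map_polyX !hornerE.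
by rewrite mulrC fmorphV.
Qed.

Lemma horner_lagC i (z : R[i]) : z != (x i)%:C ->
  (mapC (lag i)).[z] = (res i)%:C / (z - (x i)%:C) * \prod_(k < n) (1 - z / (x k)%:C).
Proof.
move=> zx; rewrite -horner_node_polyC; move: (lag i) (node_polyE i) => L ->.
rewrite map_polyZ [map_poly _ (_ * _)]rmorphM /= [map_poly _ (_ - _)]rmorphB /= map_polyX map_polyC /=.
have r0 : (res i)%:C != 0 :> R[i] by rewrite (fmorph_eq0 (real_complex R)) res_neq0.
rewrite hornerZ hornerM hornerXsubC fmorphV /=.
by field; rewrite subr_eq0 zx r0.
Qed.

Lemma node_polyC_neq0 (z : R[i]) : (forall i, z != (x i)%:C) ->
  \prod_(k < n) (1 - z / (x k)%:C) != 0.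
Proof.
move=> zx; apply/prodf_neq0 => k _; rewrite subr_eq0 eq_sym -subr_eq0.
have xk : (x k)%:C != 0 :> R[i] by rewrite (fmorph_eq0 (real_complex R)).
by rewrite -[1](divff xk) -mulrBl mulf_neq0 ?invr_eq0 // subr_eq0.
Qed.

(** This is the identity of the sum of the Lagrange polynomials with 1, divided by the node
    polynomial. *)
Lemma node_polyC_inv (z : R[i]) : (0 < n)%N -> (forall i, z != (x i)%:C) ->
  (\prod_(k < n) (1 - z / (x k)%:C))^-1 = \sum_i (res i)%:C / (z - (x i)%:C).
Proof.
move=> n0 zx; apply: (mulIf (node_polyC_neq0 zx)).
rewrite mulVf ?node_polyC_neq0 // mulr_suml.
have e : (mapC (\sum_i lag i)).[z] = 1 by rewrite sum_lag // rmorph1 hornerE.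
by rewrite -[LHS]e rmorph_sum horner_sum; apply: eq_bigr => i _; rewrite horner_lagC.
Qed.

End Lagrange.

Section Residues.
Context {R : realType}.

Definition is_entire (F : R[i] -> R[i]) := exists F', entire F F'.

Lemma eq_is_entire F G : F =1 G -> is_entire F -> is_entire G.
Proof. by move=> FG [F' eF]; exists F'; apply: eq_entire eF. Qed.

Lemma is_entireM F G : is_entire F -> is_entire G -> is_entire (fun z => F z * G z).
Proof. by move=> [F' eF] [G' eG]; eexists; exact: (entireM eF eG). Qed.

Lemma is_entire_cst (k : R[i]) : is_entire (fun=> k).
Proof. by eexists; exact: (entire_cst k). Qed.

Lemma is_entire_node_prod n (x : 'I_n -> R) :
  is_entire (fun z => \prod_(k < n) (1 - z / (x k)%:C)).
Proof.
apply: entire_prod => k; eexists; apply: eq_entire (entire_linear 1 (- ((x k)%:C)^-1)) => // z.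
by rewrite mulNr mulrC.
Qed.

Lemma is_entire_cexp_linear (k l : R[i]) : is_entire (fun z => cexp (k * z + l)).
Proof.
eexists; apply: eq_entire (entire_comp (entire_linear l k) entire_cexp) => // z.
by rewrite addrC.
Qed.

(** What the residue computations use of a contour. The sign [sg] selects the half plane, so that
    both contours obey the same lemmas. *)
Record encircles (sg : R) n (x : 'I_n -> R) (g : R -> R[i]) : Prop := Encircles {
  enc_C1 : piecewise_C1 g;
  enc_cont : ccont `[0, 1] g;
  enc_closed : g 0 = g 1;
  enc_side : forall y, y \in `[0, 1] -> 0 < sg * Re (g y);
  enc_node_side : forall i, 0 < sg * x i;
  enc_node : forall i y, y \in `[0, 1] -> g y != (x i)%:C;
  enc_index : forall i, contour_integral g (fun z => (z - (x i)%:C)^-1) = twopii }.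

Lemma eq_contour_on (g : R -> R[i]) (f f' : R[i] -> R[i]) :
  (forall y, y \in `[0, 1] -> f (g y) = f' (g y)) ->
  contour_integral g f = contour_integral g f'.
Proof. by move=> ff'; apply: eq_Cintegral => y y01; rewrite ff'. Qed.

Section OneContour.
Variables (sg : R) (n : nat) (x : 'I_n -> R) (g : R -> R[i]).
Hypotheses (n0 : (0 < n)%N) (x_inj : injective x) (enc : encircles sg x g).

Let x0 i : x i != 0.
Proof. by apply: contraTneq (enc_node_side enc i) => ->; rewrite mulr0 ltxx. Qed.

Local Notation P z := (\prod_(k < n) (1 - z / (x k)%:C)).

(** The imaginary axis is included, since q will be a point of a vertical line, possibly of abscissa
    0, as well as a point of the other contour. *)
Lemma off_side_neq (q : R[i]) : sg * Re q <= 0 ->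
  (forall y, y \in `[0, 1] -> Re (g y) != Re q) /\ (forall i, (x i)%:C != q).
Proof.
move=> qs; split => [y /(enc_side enc)|i].
  by apply: contraTneq => ->; rewrite -leNgt.
apply: contraTneq (enc_node_side enc i) => e; rewrite -leNgt.
by rewrite -[x i]/(Re (x i)%:C) e.
Qed.

Lemma residue_sum (F : R[i] -> R[i]) (q : R[i]) : is_entire F -> sg * Re q <= 0 ->
  contour_integral g (fun z => F z * (P z)^-1 / (z - q)) =
  twopii * \sum_i (res x i)%:C * F (x i)%:C / ((x i)%:C - q).
Proof.
move=> [F' eF] qs; have [gq xq] := off_side_neq qs.
rewrite -(contour_partial_fractions (enc_C1 enc) (enc_cont enc) (enc_closed enc)
  (fun i => (res x i)%:C) eF _ xq (enc_node enc) _ (enc_index enc)); last 2 first.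
- by move=> y /gq; apply: contraNneq => ->.
- exact: (contour_inv_eq0 (enc_C1 enc) (enc_cont enc) (enc_closed enc)).
apply: eq_contour_on => y y01; rewrite (node_polyC_inv x0 x_inj n0); last first.
  by move=> i; exact: (enc_node enc).
by rewrite mulrCA mulrA.
Qed.

Lemma residue_ccont (F : R[i] -> R[i]) (q : R[i]) : is_entire F -> sg * Re q <= 0 ->
  ccont `[0, 1] (fun y => F (g y) * (P (g y))^-1 / (g y - q)).
Proof.
move=> [F' eF] qs; have [gq xq] := off_side_neq qs.
have [P' eP] := is_entire_node_prod x.
have cg := enc_cont enc.
apply: ccontM; first apply: ccontM.
- exact: (entire_cont eF).
- apply: ccontV; first exact: (entire_cont eP).
  by move=> y y01; apply: (node_polyC_neq0 x0) => i; exact: (enc_node enc).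
- apply: ccontV; first by apply: ccontD => //; exact: (ccont_cst _ (- q)).
  by move=> y /gq; apply: contraNneq => /eqP; rewrite subr_eq0 => /eqP ->.
Qed.

Lemma contour_residue_sum (I : finType) (F : R[i] -> R[i]) (k : I -> R[i]) (q : I -> R[i]) :
  is_entire F -> (forall j, sg * Re (q j) <= 0) ->
  contour_integral g (fun z => \sum_j k j * (F z * (P z)^-1 / (z - q j))) =
  twopii * \sum_j k j * \sum_i (res x i)%:C * F (x i)%:C / ((x i)%:C - q j).
Proof.
move=> eF qs.
have ci j := contour_integrable (enc_C1 enc) (residue_ccont eF (qs j)).
transitivity (Cintegral `[0, 1] (fun y => \sum_j
    k j * (F (g y) * (P (g y))^-1 / (g y - q j) * Cderive g y))).
  by apply: eq_Cintegral => y _; rewrite mulr_suml; apply: eq_bigr => j _; rewrite [RHS]mulrA.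
rewrite Cintegral_sum //; last by move=> j _; exact: cintegrableZl (ci j).
rewrite mulr_sumr; apply: eq_bigr => j _; rewrite (CintegralZl _ _ (ci j)) //.
have := residue_sum eF (qs j); rewrite /contour_integral => ->.
by rewrite mulrCA.
Qed.

(** P w times the residue at x_i divided by w - x_i is the Lagrange polynomial: the integral
    interpolates F at the nodes, as a polynomial in w. *)
Lemma lagrange_residue (F : R[i] -> R[i]) (k w : R[i]) : is_entire F -> sg * Re w <= 0 ->
  contour_integral g (fun z => k * P w * F z * (P z)^-1 / (z - w)) =
  - twopii * (k * \sum_i F (x i)%:C * (map_poly (real_complex R) (lag x i)).[w]).
Proof.
move=> eF ws; have [_ xw] := off_side_neq ws.
rewrite (residue_sum (is_entireM (is_entire_cst (k * P w)) eF)) // mulNr -mulrN.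
rewrite [k * \sum_(_ < _) _]mulr_sumr -sumrN; congr (_ * _).
apply: eq_bigr => i _; rewrite (horner_lagC x0 x_inj); last by rewrite eq_sym.
by field; rewrite !subr_eq0 xw eq_sym xw.
Qed.

End OneContour.

(** For z on the first contour, the point z is outside the second one, so only the y_j contribute;
    the inner result has simple factors 1 / (z - y_j), whose poles are outside the first contour in
    turn. *)
Lemma double_residue_sum (sg : R) n m (x : 'I_n -> R) (y : 'I_m -> R) (g g' : R -> R[i])
    (F G : R[i] -> R[i]) : (0 < n)%N -> (0 < m)%N -> injective x -> injective y ->
  encircles (- sg) x g -> encircles sg y g' -> is_entire F -> is_entire G ->
  contour_integral g (fun z => contour_integral g' (fun w =>
    F z * (\prod_(k < n) (1 - z / (x k)%:C))^-1 *
    (G w * (\prod_(k < m) (1 - w / (y k)%:C))^-1 / (w - z)))) =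
  twopii ^+ 2 * \sum_j \sum_i (res x i)%:C * (res y j)%:C * F (x i)%:C * G (y j)%:C /
    ((y j)%:C - (x i)%:C).
Proof.
move=> n0 m0 x_inj y_inj eg eg' eF eG.
transitivity (contour_integral g (fun z => \sum_j - (twopii * ((res y j)%:C * G (y j)%:C)) *
    (F z * (\prod_(k < n) (1 - z / (x k)%:C))^-1 / (z - (y j)%:C)))).
  apply: eq_contour_on => r r01; set z := g r; set P := (X in F z * X^-1).
  have zs : sg * Re z <= 0 by rewrite -oppr_ge0 -mulNr ltW // (enc_side eg).
  rewrite -(@eq_contour_on g' (fun w => (F z / P * G w) *
    (\prod_(k < m) (1 - w / (y k)%:C))^-1 / (w - z))); last by move=> w _; rewrite !mulrA.
  rewrite (residue_sum m0 y_inj eg' (is_entireM (is_entire_cst _) eG) zs) mulr_sumr.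
  apply: eq_bigr => j _; have [_ /(_ j) yz] := off_side_neq eg' zs.
  rewrite -[z - _]opprB invrN; ring.
rewrite (contour_residue_sum n0 x_inj eg _ eF); last first.
  by move=> j /=; rewrite mulNr oppr_le0 ltW // (enc_node_side eg').
rewrite expr2 -mulrA; congr (_ * _); rewrite mulr_sumr; apply: eq_bigr => j _.
rewrite !mulr_sumr; apply: eq_bigr => i _; rewrite -[(y j)%:C - _]opprB invrN; ring.
Qed.

End Residues.

Section Weights.
Context {R : realType}.
Variables (s t u v : R) (ht : 0 < t < 1).

Let al : R := t / (2 * (1 - t)).
Let w0 : R := v / (1 - t).

Lemma gauss_rate_gt0 : 0 < t / (2 * (1 - t)).
Proof. by case/andP: ht => t0 t1; rewrite divr_gt0 // mulr_gt0 // subr_gt0. Qed.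

Lemma weight_wE b (w : R[i]) :
  weight_w b t v w = cexp (al%:C * w ^+ 2 + (b - w0)%:C * w).
Proof.
rewrite /weight_w; congr cexp; rewrite -addrA; congr (_ + _).
have -> : (b - w0)%:C = b%:C - v%:C / (1 - t)%:C :> R[i].
  by rewrite rmorphB /= [(v / _)%:C]rmorphM /= fmorphV.
by rewrite mulrBl mulrAC.
Qed.

Lemma weight_w_shift b k (w : R[i]) :
  weight_w b t v w * cexp (k%:C * w) = weight_w (b + k) t v w.
Proof. by rewrite !weight_wE -cexpD !rmorphB !rmorphD /=; congr cexp; ring. Qed.

Definition weight_z_real b (x : R) : R :=
  expR (- (s / (2 * (1 - s))) * x ^+ 2 - b * x + u * x / (1 - s)).

Lemma weight_z_realE b (x : R) : weight_z b s u x%:C = (weight_z_real b x)%:C.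
Proof.
rewrite /weight_z /weight_z_real -cexp_real; congr cexp.
rewrite [RHS](rmorphD (real_complex R)) [X in _ = X + _](rmorphB (real_complex R)).
rewrite !(rmorphM (real_complex R)) !(fmorphV (real_complex R)) rmorphN.
by rewrite !(rmorphM (real_complex R)) !(fmorphV (real_complex R)) !(rmorphM (real_complex R)).
Qed.

Lemma is_entire_weight_z b : is_entire (weight_z b s u).
Proof.
have [F' eF] := entire_exp_quadratic (- (s / (2 * (1 - s)))%:C)
  (- b%:C + u%:C / (1 - s)%:C).
by exists F'; apply: eq_entire eF => // z; rewrite /weight_z; congr cexp; ring.
Qed.

Section Lines.
Variables (n m : nat) (x : 'I_n -> R) (y : 'I_m -> R) (g g' : R -> R[i]) (sg : R).
Hypotheses (n0 : (0 < n)%N) (m0 : (0 < m)%N) (x_inj : injective x) (y_inj : injective y).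
Hypotheses (eg : encircles (- sg) x g) (eg' : encircles sg y g').

Lemma node_prod_real p (z : 'I_p -> R) (r : R) :
  \prod_(k < p) (1 - r%:C / (z k)%:C) = ((node_poly z).[r])%:C.
Proof. by rewrite -horner_node_polyC horner_map. Qed.

(** The inner contour integral is an interpolation polynomial in w, and the line then takes its
    Gaussian mean. The sign condition puts the line on the axis or on the side away from the
    contour. *)
Lemma line_lagrange b c (F : R[i] -> R[i]) (f : 'I_n -> R) : 0 <= sg * c ->
  is_entire F -> (forall i, F (x i)%:C = (f i)%:C) ->
  vline_integral c (fun w => contour_integral g (fun z =>
    weight_w b t v w * \prod_(k < n) (1 - w / (x k)%:C) * F z *
    (\prod_(k < n) (1 - z / (x k)%:C))^-1 / (z - w))) =
  - twopii ^+ 2 * (gmean al (b - w0) (\sum_i f i *: lag x i))%:C.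
Proof.
move=> cs eF Ff.
have -> : - twopii ^+ 2 = (- twopii) * twopii :> R[i] by rewrite mulNr.
rewrite -(gauss_line_integral gauss_rate_gt0 _ c).
rewrite /vline_integral; congr (_ * _); apply: eq_Cintegral => r _.
rewrite (lagrange_residue n0 x_inj eg) //; last by rewrite mulNr oppr_le0.
rewrite weight_wE; do 2 congr (_ * _).
rewrite rmorph_sum horner_sum; apply: eq_bigr => i _.
by rewrite Ff; move: (lag x i) => L; rewrite /= map_polyZ hornerZ.
Qed.

Lemma line_shift b k c (p : {poly R}) :
  vline_integral c (fun w => weight_w b t v w * cexp (k%:C * w) *
    (map_poly (real_complex R) p).[w]) = twopii * (gmean al (b + k - w0) p)%:C.
Proof.
rewrite -[twopii in RHS]mul1r -(gauss_line_integral gauss_rate_gt0 1 c).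
rewrite /vline_integral; congr (_ * _); apply: eq_Cintegral => r _.
by rewrite weight_w_shift weight_wE mul1r.
Qed.

Lemma double_contour_real (F G : R[i] -> R[i]) (f : 'I_n -> R) (k : 'I_m -> R) :
  is_entire F -> is_entire G ->
  (forall i, F (x i)%:C = (f i)%:C) -> (forall j, G (y j)%:C = (k j)%:C) ->
  contour_integral g (fun z => contour_integral g' (fun w =>
    F z * (\prod_(k < n) (1 - z / (x k)%:C))^-1 *
    (G w * (\prod_(k < m) (1 - w / (y k)%:C))^-1 / (w - z)))) =
  twopii ^+ 2 *
    (\sum_j \sum_i res x i * res y j * f i * k j / (y j - x i))%:C.
Proof.
move=> eF eG Ff Gk; rewrite (double_residue_sum n0 m0 x_inj y_inj eg eg' eF eG).
congr (_ * _); rewrite rmorph_sum; apply: eq_bigr => j _.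
rewrite rmorph_sum; apply: eq_bigr => i _.
rewrite Ff Gk; move: (res x i) (res y j) => r r'.
by rewrite !(rmorphM (real_complex R)) (fmorphV (real_complex R)) (rmorphB (real_complex R)).
Qed.

End Lines.
End Weights.

(** * Reduction of the Fredholm determinants *)

Section HalfLine.
Context {R : realType}.
Notation mu := (@lebesgue_measure R).
Implicit Types (k : R).

Local Notation half := `[(1 : R), +oo[%classic.

Lemma expR_halfline_integrable k : 0 < k -> rintegrable half (fun z => expR (- (k * z))).
Proof.
move=> k0.
have i1 : rintegrable half (exponential_pdf k).
  apply: (@integrableS _ _ _ _ setT) => //.
  exact: integrable_exponential_pdf.
apply: eq_rintegrable (rintegrableZl k^-1 _ i1) => // z /=.
rewrite in_itv /= andbT => z1; rewrite /exponential_pdf patchE mem_set /=;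
  last by rewrite in_itv /= andbT (le_trans ler01).
by rewrite mulrA mulVf ?mul1r ?mulNr // gt_eqF.
Qed.

Lemma cvg_expR_nat k : 0 < k -> expR (- (k * (1 + i%:R))) @[i --> \oo] --> (0 : R).
Proof.
move=> k0; apply: (@cvg0_norm_le _ _ (fun i => k^-1 * i.+1%:R^-1)) => [i|].
  rewrite ger0_norm ?expR_ge0 // -invfM expRN -[1 + _](natrD R 1 i) add1n.
  rewrite lef_pV2 ?posrE ?mulr_gt0 ?ltr0n ?expR_gt0 //.
  apply: le_trans (expR_ge1Dx _); rewrite lerDr //.
have lim : k^-1 * (i.+1%:R : R)^-1 @[i --> \oo] --> k^-1 * 0.
  by apply: cvgMl_tmp; exact: cvg_inv_natr.
by rewrite mulr0 in lim.
Qed.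

Lemma is_derive_expR_linear k (z : R) :
  is_derive z 1 (fun z => expR (- (k * z))) (- k * expR (- (k * z))).
Proof.
have dl : is_derive z 1 (fun z : R => - (k * z)) (- k).
  by apply: is_derive_eq; rewrite /GRing.scale /=; ring.
have de := is_derive1_comp (g := fun z : R => - (k * z)) (is_derive_expR _) dl.
by apply: is_derive_eq; rewrite mulrC.
Qed.

Lemma continuous_expR_linear k : continuous (fun z : R => expR (- (k * z))).
Proof. exact: is_derive_continuous (is_derive_expR_linear k). Qed.

Lemma Rintegral_expR_halfline k : 0 < k ->
  \int[mu]_(z in half) expR (- (k * z)) = expR (- k) / k.
Proof.
move=> k0; have kn : k != 0 by rewrite gt_eqF.
have d (z : R) : is_derive z 1 (fun z => - k^-1 * expR (- (k * z))) (expR (- (k * z))).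
  have d := is_derive_expR_linear k z.
  by apply: is_derive_eq; rewrite /GRing.scale /=; field.
rewrite (Rintegral_derive_halfline (@continuous_expR_linear k) (expR_halfline_integrable k0) d).
  by rewrite mulr1 mulNr opprK mulrC.
have lim : - k^-1 * expR (- (k * (1 + i%:R))) @[i --> \oo] --> - k^-1 * 0.
  by apply: cvgMl_tmp; exact: cvg_expR_nat.
by rewrite mulr0 in lim.
Qed.

End HalfLine.

Section Laplace.
Context {R : realType}.
Notation mu := (@lebesgue_measure R).
Variables (al : R) (al0 : 0 < al) (l h : R).

Local Notation half := `[(1 : R), +oo[%classic.

Lemma is_derive_gmean_line (p : {poly R}) (z : R) :
  is_derive z 1 (fun z => gmean al (l + h * z) p) (h * gmean al (l + h * z) ('X * p)).
Proof.
have dl : is_derive z 1 (fun z : R => l + h * z) h.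
  by apply: is_derive_eq; rewrite /GRing.scale /=; ring.
have de := is_derive1_comp (g := fun z : R => l + h * z) (is_derive_gmean al0 _ p) dl.
by apply: is_derive_eq; rewrite mulrC.
Qed.

Lemma continuous_gmean_line (p : {poly R}) : continuous (fun z => gmean al (l + h * z) p).
Proof. exact: is_derive_continuous (is_derive_gmean_line p). Qed.

Lemma gmean_halfline_integrable k (p : {poly R}) : 0 < k ->
  rintegrable half (fun z => gmean al (l + h * z) p * expR (- (k * z))).
Proof.
move=> k0; have [C C0 bound] := gmean_bounded al0 p.
apply: (@rintegrable_bounded _ _ _ _ C); first exact: measurable_itv.
- apply: measurable_funTS; apply: continuous_measurable_fun.
  exact: continuous_gmean_line.
- by move=> z _; exact: bound.
- exact: expR_halfline_integrable.
Qed.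

(* The integrand is the derivative of [exp (- h r z) gmean (l + h z) p / h]. *)
Lemma Rintegral_gmean_halfline (r : R) (p : {poly R}) : h != 0 -> 0 < h * r ->
  \int[mu]_(z in half) (gmean al (l + h * z) (('X - r%:P) * p) * expR (- (h * r * z))) =
  - (expR (- (h * r)) / h * gmean al (l + h) p).
Proof.
move=> h0 hr.
have d (z : R) : is_derive z 1 (fun z => h^-1 * (expR (- (h * r * z)) * gmean al (l + h * z) p))
    (gmean al (l + h * z) (('X - r%:P) * p) * expR (- (h * r * z))).
  have d1 := is_derive_expR_linear (h * r) z.
  have d2 := is_derive_gmean_line p z.
  apply: is_derive_eq; have -> : ('X - r%:P) * p = 'X * p + (- r) *: p.
    by rewrite mulrBl scaleNr mul_polyC.
  by rewrite gmeanD gmeanZ /GRing.scale /=; field.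
have cf : continuous (fun z => gmean al (l + h * z) (('X - r%:P) * p) * expR (- (h * r * z))).
  move=> z; apply: cvgM; first exact: continuous_gmean_line.
  exact: continuous_expR_linear.
rewrite (Rintegral_derive_halfline cf (gmean_halfline_integrable _ hr) d).
  by rewrite !mulr1 !mulrA [_ / h]mulrC.
have [C C0 bound] := gmean_bounded al0 p.
apply: (@cvg0_norm_le _ _ (fun i => (`|h^-1| * C) * expR (- (h * r * (1 + i%:R))))) => [i|].
  rewrite !normrM [X in _ * (X * _)]ger0_norm ?expR_ge0 //.
  rewrite mulrCA mulrC ler_wpM2r ?expR_ge0 // ler_wpM2l ?normr_ge0 //.
have lim : `|h^-1| * C * expR (- (h * r * (1 + i%:R))) @[i --> \oo] --> `|h^-1| * C * 0.
  by apply: cvgMl_tmp; exact: cvg_expR_nat.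
by rewrite mulr0 in lim.
Qed.

End Laplace.

Section FiniteKernels.
Context {R : realType}.
Variables (al l h : R) (n m : nat) (x : 'I_n -> R) (y : 'I_m -> R) (Z : 'I_n -> R).

(* The functions B, beta, C and M_0 evaluated by residues, up to constant factors;
   [h] is [a] for the kernel L and [- a] for its hatted counterpart. *)

Definition finite_B (r : R) : R :=
  - gmean al l (\sum_i ((node_poly y).[x i] * expR (h * x i * r)) *: lag x i).

Definition finite_beta (r : R) : R := gmean al (l + h * r) (node_poly y).

Definition finite_C (r : R) : R := \sum_j \sum_i res x i * res y j * Z i *
  ((node_poly x).[y j] * expR (- (h * y j * r))) / (y j - x i).

Definition finite_M (r r' : R) : R := - h * \sum_j \sum_i res x i * res y j *
  ((node_poly y).[x i] * expR (h * x i * r)) *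
  ((node_poly x).[y j] * expR (- (h * y j * r'))) / (y j - x i).

End FiniteKernels.

(** * The ratio of determinants as a rank one update *)

Section RankReduction.
Context {R : realType}.
Notation leb := (@lebesgue_measure R).
Variables (al : R) (al0 : 0 < al) (l b h : R) (h0 : h != 0).
Variables (n m : nat) (x : 'I_n -> R) (y : 'I_m -> R).
Hypotheses (x0 : forall i, x i != 0) (y0 : forall j, y j != 0).
Hypotheses (x_inj : injective x) (y_inj : injective y).
Hypotheses (hxy : forall i j, 0 < h * (y j - x i)) (hy : forall j, 0 < h * y j).
Variables (Yx : 'I_n -> R) (Yy : 'I_m -> R) (Z : 'I_n -> R).

Local Notation ev := (exp_poly_ev b (b + h)).
Local Notation P := (node_poly x).
Local Notation Q := (node_poly y).
Local Notation half := `[(1 : R), +oo[%classic.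

Hypothesis quadrature : forall p q : {poly R}, (size p <= n)%N -> (size q <= m)%N ->
  gmean al l p + gmean al (l + h) q =
  \sum_i ev p q (x i) * Yx i + \sum_j ev p q (y j) * Yy j.
Hypothesis ev_inj : forall p q : {poly R}, (size p <= n)%N -> (size q <= m)%N ->
  (forall i, ev p q (x i) = 0) -> (forall j, ev p q (y j) = 0) -> p = 0 /\ q = 0.

(** The integral of exp (- h (y_j - x_i) r) over [1, oo). *)
Let E i j : R := expR (- (h * (y j - x i))) / (h * (y j - x i)).

(** Gram matrix of - M_0, written as a sum of m products of a function of r and exp (- h y_k r');
    hence W below represents I - M_0. *)
Let N : 'M[R]_m := \matrix_(k, j) \sum_i
  h * (res x i * res y k * Q.[x i] * P.[y k] / (y k - x i)) * E i j.

Let W := 1%:M + N.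

Let p j : {poly R} := - \sum_i (Q.[x i] * E i j) *: lag x i.
(** Since Q = (X - y_j) lag_j / res_j, the Laplace transform of [finite_beta] at h y_j is the
    boundary term at r = 1 of [Rintegral_gmean_halfline]. Likewise [p j] encodes the Laplace
    transform of [finite_B]. *)
Let q j : {poly R} := - (expR (- (h * y j)) / (h * res y j)) *: lag y j.

Let pn j : (size (p j) <= n)%N.
Proof.
rewrite size_polyN; apply: leq_trans (size_sum _ _ _) _; apply/bigmax_leqP => i _.
exact: leq_trans (size_scale_leq _ _) (size_lag _ _).
Qed.

Let qm j : (size (q j) <= m)%N.
Proof. exact: leq_trans (size_scale_leq _ _) (size_lag _ _). Qed.

Let yx i j : y j - x i != 0.
Proof. by apply: contraTneq (hxy i j) => ->; rewrite mulr0 ltxx. Qed.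

Let xy i j : x i - y j != 0.
Proof. by rewrite -opprB oppr_eq0. Qed.

Let p_horner j r : (p j).[r] = - \sum_i Q.[x i] * E i j * (lag x i).[r].
Proof. by rewrite /p hornerN horner_sum; congr (- _); apply: eq_bigr => i _; rewrite hornerZ. Qed.

Let q_horner j r : (q j).[r] = - (expR (- (h * y j)) / (h * res y j)) * (lag y j).[r].
Proof. by rewrite /q hornerZ. Qed.

(* The exponential polynomial (p_j, q_j), whose Gaussian mean is the Laplace
   coefficient B_j, vanishes on the first family of nodes and restricts to a
   multiple of the j-th column of 1 - M_0 on the second one. *)
Let ev_x i j : ev (p j) (q j) (x i) = 0.
Proof.
rewrite /exp_poly_ev p_horner q_horner (bigD1 i) //= lag_node // eqxx mulr1.
rewrite big1 ?addr0 => [|k ki]; last by rewrite lag_node // (negPf ki) mulr0.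
rewrite (horner_node_poly y0 y_inj j) /E.
have -> : expR (- (h * (y j - x i))) = expR (- (h * y j)) * expR (h * x i).
  by rewrite -expRD; congr expR; ring.
rewrite [(b + h) * _]mulrDl expRD; field.
by rewrite res_neq0 // h0 yx.
Qed.

Let ev_y k j : ev (p j) (q j) (y k) = - (expR (b * y k) / (h * res y k)) * W k j.
Proof.
rewrite /exp_poly_ev p_horner q_horner lag_node // !mxE mulrDr addrC [(b + h) * _]mulrDl expRD.
congr (_ + _).
  case: (eqVneq j k) => [->|jk]; last by rewrite !(mulr0, mul0r).
  rewrite !mulr1.
  have e : expR (h * y k) * expR (- (h * y k)) = 1 by rewrite -expRD subrr expR0.
  transitivity (- (expR (b * y k) / (h * res y k)) * (expR (h * y k) * expR (- (h * y k)))).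
    by ring.
  by rewrite e mulr1.
rewrite mulNr mulr_suml -sumrN mulr_sumr; apply: eq_bigr => i _.
rewrite (horner_node_poly x0 x_inj i); field.
by rewrite !res_neq0 // h0 yx.
Qed.

Let c k : R := expR (b * y k) * Yy k / (h * res y k).

Let B : 'rV[R]_m := \row_j (gmean al l (p j) + gmean al (l + h) (q j)).

(** The quadrature rule evaluates B_j at the nodes, where the first family contributes 0 and the
    second one the entries of W. *)
Let BE : B = - \row_k c k *m W.
Proof.
apply/rowP => j; rewrite mxE quadrature // big1 ?add0r => [|i _]; last by rewrite ev_x mul0r.
rewrite mulNmx !mxE -sumrN; apply: eq_bigr => k _; rewrite ev_y [X in _ = - (X * _)]mxE /c; ring.
Qed.

(** If W r = 0, the combination of the (p_j, q_j) with coefficients r_j vanishes at all nodes, hence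
    is zero; evaluating its second polynomial at y_j gives r_j = 0. *)
Let W_unit : W \in unitmx.
Proof.
rewrite -unitmx_tr -row_free_unit; apply: inj_row_free => r rW.
have rW0 k : \sum_j r 0 j * W k j = 0.
  have /rowP/(_ k) := rW; rewrite !mxE => e; rewrite -[RHS]e.
  by apply: eq_bigr => j _; rewrite [in RHS]mxE.
pose pr := \sum_j r 0 j *: p j; pose qr := \sum_j r 0 j *: q j.
have evr z : ev pr qr z = \sum_j r 0 j * ev (p j) (q j) z.
  rewrite /exp_poly_ev /pr /qr !horner_sum !mulr_suml -big_split; apply: eq_bigr => j _ /=.
  by rewrite !hornerZ mulrDr !mulrA.
have [||||_ qr0] := @ev_inj pr qr.
- apply: leq_trans (size_sum _ _ _) _; apply/bigmax_leqP => j _.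
  exact: leq_trans (size_scale_leq _ _) (pn j).
- apply: leq_trans (size_sum _ _ _) _; apply/bigmax_leqP => j _.
  exact: leq_trans (size_scale_leq _ _) (qm j).
- by move=> i; rewrite evr big1 // => j _; rewrite ev_x mulr0.
- move=> k; rewrite evr; under eq_bigr do rewrite ev_y mulrCA.
  by rewrite -mulr_sumr rW0 mulr0.
apply/rowP => j; rewrite [RHS]mxE.
have := congr1 (fun q : {poly R} => q.[y j]) qr0; rewrite horner0 /qr horner_sum.
rewrite (bigD1 j) //= big1 ?addr0 => [|k kj]; last first.
  by rewrite hornerZ q_horner lag_node // (negPf kj) !mulr0.
rewrite hornerZ q_horner lag_node // eqxx mulr1 => /eqP.
rewrite mulf_eq0 oppr_eq0 mulf_eq0 invr_eq0 mulf_eq0 (negPf h0) (negPf (res_neq0 _ _ _)) //.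
by rewrite (gt_eqF (expR_gt0 _)) !orbF => /eqP.
Qed.

(** Coefficient of exp (- h y_k r) in [finite_C]. *)
Let z k : R := \sum_i res x i * res y k * Z i * P.[y k] / (y k - x i).

(** As B = - c W, the updated matrix is (1 - kap z c) W, and W cancels in the ratio. *)
Let det_ratio kap : \det (1%:M + (N + (\col_k (kap * z k)) *m B)) / \det W =
  1 - kap * \sum_k c k * z k.
Proof.
have -> : 1%:M + (N + (\col_k (kap * z k)) *m B) =
    (1%:M + (\col_k (kap * z k)) *m - \row_k c k) *m W.
  by rewrite addrA -/W BE mulmxDl mul1mx mulmxA.
rewrite det_mulmx det_1add_rank1 mulfK; last by have := W_unit; rewrite unitmxE unitfE.
congr (_ + _); rewrite mulNmx !mxE; congr (- _); rewrite mulr_sumr; apply: eq_bigr => k _.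
by rewrite !mxE mulrCA.
Qed.

Let det_identity kap :
  kap / h * gmean al l (\sum_i Z i *: lag x i) +
  \det (1%:M + (N + (\col_k (kap * z k)) *m B)) / \det W - 1 =
  kap / h * \sum_i Z i * expR (b * x i) * Yx i.
Proof.
rewrite det_ratio.
(* The quadrature rule with second polynomial 0: a Lagrange polynomial keeps one node of its own
   family and all nodes of the other. The latter terms are those cancelled by the determinant
   ratio. *)
have lagE i : gmean al l (lag x i) = expR (b * x i) * Yx i +
    \sum_k res x i * P.[y k] / (y k - x i) * expR (b * y k) * Yy k.
  have s0 : (size (0%R : {poly R}) <= m)%N by rewrite size_poly0.
  have := quadrature (size_lag x i) s0; rewrite gmean0 addr0 => ->; congr (_ + _).
    rewrite (bigD1 i) //= big1 ?addr0 => [|k ki].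
      by rewrite /exp_poly_ev horner0 mul0r addr0 lag_node // eqxx mul1r.
    by rewrite /exp_poly_ev horner0 mul0r addr0 lag_node // eq_sym (negPf ki) !mul0r.
  apply: eq_bigr => k _; rewrite /exp_poly_ev horner0 mul0r addr0; do 2 congr (_ * _).
  by rewrite (horner_node_poly x0 x_inj i); field; rewrite res_neq0 // yx.
rewrite gmean_sum; under eq_bigr do rewrite gmeanZ lagE mulrDr mulrA.
rewrite big_split mulrDr -!addrA -[RHS]addr0; congr (_ + _).
rewrite [1 + _]addrC addrNK; apply/eqP; rewrite subr_eq0; apply/eqP.
rewrite -mulrA; congr (_ * _).
transitivity (h^-1 * \sum_k \sum_i Z i * (res x i * P.[y k] / (y k - x i) * expR (b * y k) * Yy k)).
  by rewrite exchange_big; congr (_ * _); apply: eq_bigr => i _; rewrite mulr_sumr.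
rewrite mulr_sumr; apply: eq_bigr => k _; rewrite /c /z !mulr_sumr; apply: eq_bigr => i _.
by field; rewrite h0 res_neq0 // yx.
Qed.

(** With [f] and [g] below, the kernel - M + kap phi (x) psi is the sum over k of f_k (r) g_k (r'):
    the rank one term is absorbed, so the rank stays m. *)
Let coef kap k i : R := h * (res x i * res y k * Q.[x i] * P.[y k] / (y k - x i)) -
  kap * z k * (Q.[x i] * gmean al l (lag x i)).
Let f kap k r : R := \sum_i coef kap k i * expR (h * x i * r) +
  kap * z k * gmean al (l + h * r) Q.
Let g j r : R := expR (- (h * y j * r)).

Let fgE kap k j r : f kap k r * g j r =
  \sum_i coef kap k i * expR (- (h * (y j - x i) * r)) +
  kap * z k * (gmean al (l + h * r) Q * expR (- (h * y j * r))).
Proof.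
rewrite mulrDl mulr_suml; congr (_ + _); last by rewrite [RHS]mulrA.
by apply: eq_bigr => i _; rewrite -[LHS]mulrA -expRD; congr (_ * expR _); ring.
Qed.

Let exp_int kap k i j : rintegrable half (fun r => coef kap k i * expR (- (h * (y j - x i) * r))).
Proof. by apply: rintegrableZl => //; exact: expR_halfline_integrable. Qed.

Let gm_int kap k j : rintegrable half (fun r =>
  kap * z k * (gmean al (l + h * r) Q * expR (- (h * y j * r)))).
Proof. by apply: rintegrableZl => //; exact: gmean_halfline_integrable. Qed.

Let fg_int kap k j : rintegrable half (fun r => f kap k r * g j r).
Proof.
apply: (@eq_rintegrable _ _ (fun r => \sum_i coef kap k i * expR (- (h * (y j - x i) * r)) +
  kap * z k * (gmean al (l + h * r) Q * expR (- (h * y j * r))))) => //.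
by apply: rintegrableD => //; apply: rintegrable_sum.
Qed.

Let gram kap k j : \int[leb]_(r in half) (f kap k r * g j r) =
  (N + (\col_k (kap * z k)) *m B) k j.
Proof.
under eq_Rintegral do rewrite fgE.
rewrite RintegralD //; [|by apply: rintegrable_sum|exact: gm_int].
rewrite Rintegral_sum //.
rewrite RintegralZl //; last exact: gmean_halfline_integrable.
have -> : \int[leb]_(r in half) (gmean al (l + h * r) Q * expR (- (h * y j * r))) =
    gmean al (l + h) (q j).
  rewrite [in LHS](node_polyE y0 y_inj j).
  under eq_Rintegral do rewrite gmeanZ -[_ * expR _]mulrA.
  rewrite RintegralZl //; last exact: gmean_halfline_integrable.
  rewrite (Rintegral_gmean_halfline al0 _ _ h0 (hy j)) [RHS]gmeanZ; field.
  by rewrite h0 res_neq0.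
have -> : \sum_i \int[leb]_(r in half) (coef kap k i * expR (- (h * (y j - x i) * r))) =
    \sum_i coef kap k i * E i j.
  apply: eq_bigr => i _; rewrite RintegralZl //; last exact: expR_halfline_integrable.
  by rewrite Rintegral_expR_halfline.
have -> : (N + (\col_k (kap * z k)) *m B) k j = N k j + kap * z k *
    (gmean al l (p j) + gmean al (l + h) (q j)).
  by rewrite [LHS]mxE; congr (_ + _); rewrite mxE big_ord1 !mxE.
rewrite mulrDr addrA; congr (_ + _); rewrite [N _ _]mxE.
have -> : gmean al l (p j) = - \sum_i Q.[x i] * E i j * gmean al l (lag x i).
  rewrite /p -scaleN1r gmeanZ gmean_sum mulN1r; congr (- _).
  by apply: eq_bigr => i _; exact: gmeanZ.
rewrite mulrN mulr_sumr -sumrN -big_split; apply: eq_bigr => i _ /=.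
by rewrite /coef; ring.
Qed.

Local Notation M := (finite_M h x y).
Local Notation phi r := (finite_B al l h x y r + finite_beta al l h y r).
Local Notation psi := (finite_C h x y Z).

Lemma rank_reduction kap :
  (kap / h * gmean al l (\sum_i Z i *: lag x i))%:C +
  fredholm_det half (fun r r' => (- M r r' + kap * (phi r * psi r'))%:C) /
  fredholm_det half (fun r r' => (- M r r')%:C) - 1 =
  (kap / h * \sum_i Z i * expR (b * x i) * Yx i)%:C :> R[i].
Proof.
have kernelE k0 r r' : - M r r' + k0 * (phi r * psi r') = \sum_j f k0 j r * g j r'.
  pose S := \sum_i (Q.[x i] * expR (h * x i * r)) * gmean al l (lag x i).
  have -> : phi r = - S + gmean al (l + h * r) Q.
    by rewrite /finite_B gmean_sum; congr (- _ + _); apply: eq_bigr => i _; rewrite gmeanZ.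
  have -> : psi r' = \sum_j z j * g j r'.
    apply: eq_bigr => j _; rewrite mulr_suml; apply: eq_bigr => i _; rewrite /g; ring.
  pose T j := \sum_i h * (res x i * res y j * Q.[x i] * P.[y j] / (y j - x i)) *
    expR (h * x i * r).
  have -> : - M r r' = \sum_j T j * g j r'.
    rewrite /finite_M mulNr opprK mulr_sumr; apply: eq_bigr => j _.
    by rewrite mulr_sumr mulr_suml; apply: eq_bigr => i _; rewrite /g; ring.
  rewrite !mulr_sumr -big_split; apply: eq_bigr => j _ /=.
  have -> : f k0 j r = T j - k0 * z j * S + k0 * z j * gmean al (l + h * r) Q.
    rewrite /f; congr (_ + _); rewrite /T /S mulr_sumr -sumrB.
    by apply: eq_bigr => i _; rewrite /coef; ring.
  ring.
have fredE k0 : fredholm_det half (fun r r' => (- M r r' + k0 * (phi r * psi r'))%:C) =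
    (\det (1%:M + (N + (\col_k (k0 * z k)) *m B)))%:C.
  transitivity (fredholm_det half (fun r r' => (\sum_j f k0 j r * g j r')%:C)).
    by congr fredholm_det; apply/funext => r; apply/funext => r'; rewrite kernelE.
  rewrite fredholm_det_finite_rank //; congr ((\det (1%:M + _))%:C).
  by apply/matrixP => k j; rewrite mxE gram.
(* The denominator is the case of a zero multiple of the rank one term. *)
have fredE0 : fredholm_det half (fun r r' => (- M r r')%:C) = (\det W)%:C.
  transitivity (fredholm_det half (fun r r' => (- M r r' + 0 * (phi r * psi r'))%:C)).
    by congr fredholm_det; apply/funext => r; apply/funext => r'; rewrite mul0r addr0.
  rewrite fredE; congr ((\det (1%:M + _))%:C).
  have -> : \col_k (0 * z k) = 0 by apply/colP => k; rewrite !mxE mul0r.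
  by rewrite mul0mx addr0.
rewrite fredE fredE0 -det_identity.
by rewrite rmorphB rmorphD /= rmorph1 [X in _ = _ + X - 1](rmorphM (real_complex R)) fmorphV.
Qed.

End RankReduction.

(** * Evaluation of the functions of the limit kernel *)

Section Prefactors.
Context {R : realType}.

Lemma twopii_neq0 : twopii != 0 :> R[i].
Proof. by rewrite eq_complex /= eqxx /= mulf_neq0 // gt_eqF // pi_gt0. Qed.

Lemma twopii_cancel k (p r z : R) :
  p%:C / (twopii ^+ k * r%:C) * (twopii ^+ k * z%:C) = (p / r * z)%:C.
Proof.
have c0 : twopii ^+ k != 0 :> R[i] by rewrite expf_neq0 // twopii_neq0.
rewrite !(rmorphM (real_complex R)) (fmorphV (real_complex R)) invfM /=.
transitivity (p%:C / r%:C * z%:C * ((twopii ^+ k)^-1 * twopii ^+ k)); first by ring.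
by rewrite mulVf // mulr1.
Qed.

Lemma prod_sub1 p (x : 'I_p -> R) (w : R[i]) :
  \prod_(j < p) (w / (x j)%:C - 1) = ((-1) ^+ p)%:C * \prod_(j < p) (1 - w / (x j)%:C).
Proof.
under eq_bigr do rewrite -opprB.
by rewrite prodrN card_ord rmorphXn rmorphN rmorph1.
Qed.

Lemma prod_frac p (x : 'I_p -> R) (w z : R[i]) :
  \prod_(j < p) ((1 - w / (x j)%:C) / (1 - z / (x j)%:C)) =
  \prod_(j < p) (1 - w / (x j)%:C) * (\prod_(j < p) (1 - z / (x j)%:C))^-1.
Proof. by rewrite big_split prodfV. Qed.

Lemma prod_frac_sub1 p (x : 'I_p -> R) (w z : R[i]) :
  \prod_(j < p) ((w / (x j)%:C - 1) / (z / (x j)%:C - 1)) =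
  \prod_(j < p) (1 - w / (x j)%:C) * (\prod_(j < p) (1 - z / (x j)%:C))^-1.
Proof.
rewrite -prod_frac; apply: eq_bigr => j _.
by rewrite -opprB -[z / _ - 1]opprB invrN mulrNN.
Qed.

Lemma is_entire_node_exp p (x : 'I_p -> R) (k l : R) :
  is_entire (fun z => k%:C * (\prod_(j < p) (1 - z / (x j)%:C) * cexp (l%:C * z))).
Proof.
apply: is_entireM; first exact: is_entire_cst.
apply: is_entireM; first exact: is_entire_node_prod.
by apply: eq_is_entire (is_entire_cexp_linear l%:C 0) => z; rewrite addr0.
Qed.

Lemma node_exp_real p (x : 'I_p -> R) (k l r : R) :
  k%:C * (\prod_(j < p) (1 - r%:C / (x j)%:C) * cexp (l%:C * r%:C)) =
  (k * ((node_poly x).[r] * expR (l * r)))%:C.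
Proof.
by rewrite node_prod_real -(rmorphM (real_complex R)) cexp_real -!(rmorphM (real_complex R)).
Qed.

Lemma gmeanZ_sum al l p (k : R) (f : 'I_p -> R) (q : 'I_p -> {poly R}) :
  gmean al l (\sum_i (k * f i) *: q i) = k * gmean al l (\sum_i f i *: q i).
Proof.
by rewrite -gmeanZ scaler_sumr; congr gmean; apply: eq_bigr => i _; rewrite scalerA.
Qed.

Lemma eq_contour (g : R -> R[i]) (f f' : R[i] -> R[i]) : f =1 f' ->
  contour_integral g f = contour_integral g f'.
Proof. by move=> /funext ->. Qed.

Lemma eq_vline c (f f' : R[i] -> R[i]) : f =1 f' -> vline_integral c f = vline_integral c f'.
Proof. by move=> /funext ->. Qed.

End Prefactors.

Section LeftValues.
Context {R : realType}.
Variables (n m : nat) (a1 a2 : R) (nu : 'I_(n + m) -> R) (gamma1 gamma2 : R -> R[i]).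
Variables (d1 d2 s t u v : R).
Hypotheses (n0 : (0 < n)%N) (m0 : (0 < m)%N) (ht : 0 < t < 1).

Local Notation x := (fun i : 'I_n => nu (lshift m i)).
Local Notation y := (fun j : 'I_m => nu (rshift n j)).
Local Notation a := (a2 - a1).
Local Notation al := (t / (2 * (1 - t))).
Local Notation l := (a1 - v / (1 - t)).
Local Notation P := (node_poly x).
Local Notation Q := (node_poly y).
Local Notation Z := (weight_z_real s u a1).

Hypotheses (x_inj : injective x) (y_inj : injective y).
Hypotheses (e1 : encircles (- 1) x gamma1) (e2 : encircles 1 y gamma2).

Lemma calB_value c r : 0 <= c -> calB a1 a2 nu gamma1 d2 c v t r =
  (d2 * Num.sqrt a / Num.sqrt (1 - t) *
   finite_B al l a x y r)%:C.
Proof.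
rewrite /finite_B => c0; have cs : 0 <= 1 * c by rewrite mul1r.
have Ff i := node_exp_real y 1 (a * r) (x i).
rewrite -(twopii_cancel 2) rmorphN mulrN -mulNr; congr (_ * _).
under eq_bigr => i _ do rewrite mulrAC -[_ * expR _]mul1r.
rewrite -(line_lagrange v ht n0 x_inj e1 a1 cs (is_entire_node_exp y 1 (a * r)) Ff).
apply: eq_vline => w; apply: eq_contour => z; rewrite prod_frac_sub1; ring.
Qed.

Lemma beta_value r : beta a1 a2 nu d2 v t r =
  (d2 * Num.sqrt a / Num.sqrt (1 - t) * finite_beta al l a y r)%:C.
Proof.
rewrite /finite_beta; rewrite -(twopii_cancel 1) expr1; congr (_ * _).
rewrite addrAC -(line_shift v ht _ _ 0); apply: eq_vline => w.
by rewrite horner_node_polyC.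
Qed.

Lemma calC_value r : calC a1 a2 nu gamma1 gamma2 d1 u s r =
  (d1 * Num.sqrt a / Num.sqrt (1 - s) *
   finite_C a x y (fun i => Z (x i)) r)%:C.
Proof.
rewrite /finite_C; have Ff i := weight_z_realE s u a1 (x i).
have Gk j := node_exp_real x 1 (- (a * r)) (y j).
have dc := double_contour_real n0 m0 x_inj y_inj e1 e2 (is_entire_weight_z s u a1)
  (is_entire_node_exp x 1 (- (a * r))) Ff Gk.
rewrite /calC; refine (etrans (congr1 ( *%R _) (etrans (eq_contour _ _) dc)) _).
  move=> z; apply: eq_contour => w; rewrite prod_frac_sub1 prodfV rmorphN; ring.
rewrite twopii_cancel; congr ((_ * _)%:C); apply: eq_bigr => j _; apply: eq_bigr => i _.
by rewrite mul1r mulNr [a * r * _]mulrAC.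
Qed.

Lemma M0_value r r' : M0 a1 a2 nu gamma1 gamma2 r r' =
  (finite_M a x y r r')%:C.
Proof.
(* The factor -1 turns 1 / (zeta - omega) into the 1 / (w - z) of [double_contour_real]. *)
rewrite /finite_M; have Ff i := node_exp_real y (-1) (a * r) (x i).
have Gk j := node_exp_real x 1 (- (a * r')) (y j).
have dc := double_contour_real n0 m0 x_inj y_inj e1 e2
  (is_entire_node_exp y (-1) (a * r)) (is_entire_node_exp x 1 (- (a * r'))) Ff Gk.
rewrite /M0; have -> : a%:C / twopii ^+ 2 = a%:C / (twopii ^+ 2 * 1%:C) by rewrite mulr1.
refine (etrans (congr1 ( *%R _) (etrans (eq_contour _ _) dc)) _).
  move=> z; apply: eq_contour => w; rewrite !prod_frac cexpD.
  by rewrite -[z - w]opprB invrN !rmorphN -mulNr; ring.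
rewrite twopii_cancel divr1 mulNr -mulrN -sumrN; congr ((_ * _)%:C); apply: eq_bigr => j _.
rewrite -sumrN; apply: eq_bigr => i _.
by rewrite !mulNr [a * r * _]mulrAC [a * r' * _]mulrAC; ring.
Qed.

Lemma first_term_value :
  (d1 * d2)%:C / (twopii ^+ 2 * (Num.sqrt ((1 - s) * (1 - t)))%:C) *
  vline_integral 0 (fun w => contour_integral gamma1 (fun z =>
    (w - z)^-1 * (weight_z a1 s u z * weight_w a1 t v w) *
    \prod_(j < n) ((1 - w / (x j)%:C) / (1 - z / (x j)%:C)))) =
  (d1 * d2 / Num.sqrt ((1 - s) * (1 - t)) *
   gmean al l (\sum_i Z (x i) *: lag x i))%:C.
Proof.
(* The factor -1 compensates for 1 / (w - z) here against 1 / (z - w) in [line_lagrange]. *)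
have Ff i : (-1)%:C * weight_z a1 s u (x i)%:C = (-1 * Z (x i))%:C.
  by rewrite weight_z_realE rmorphM.
have eF := is_entireM (is_entire_cst (-1)%:C) (is_entire_weight_z s u a1).
have cs : 0 <= 1 * 0 :> R by rewrite mulr0.
rewrite -(twopii_cancel 2); congr (_ * _).
have gE := gmeanZ_sum al l (-1) (fun i => Z (x i)) (lag x); rewrite mulN1r in gE.
rewrite -[gmean _ _ _]opprK -gE rmorphN mulrN -mulNr.
rewrite -(line_lagrange v ht n0 x_inj e1 a1 cs eF Ff).
apply: eq_vline => w; apply: eq_contour => z; rewrite prod_frac.
by rewrite -[w - z]opprB invrN rmorphN; ring.
Qed.

End LeftValues.

Section RightValues.
Context {R : realType}.
Variables (n m : nat) (a1 a2 : R) (nu : 'I_(n + m) -> R) (gamma1 gamma2 : R -> R[i]).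
Variables (d1 d2 s t u v : R).
Hypotheses (n0 : (0 < n)%N) (m0 : (0 < m)%N) (ht : 0 < t < 1).

Local Notation x := (fun i : 'I_m => nu (rshift n i)).
Local Notation y := (fun j : 'I_n => nu (lshift m j)).
Local Notation a := (a2 - a1).
Local Notation al := (t / (2 * (1 - t))).
Local Notation l := (a2 - v / (1 - t)).
Local Notation P := (node_poly x).
Local Notation Q := (node_poly y).
Local Notation Z := (weight_z_real s u a2).
(* the sign relating the products of [zeta / nu - 1] to those of [1 - zeta / nu] *)
Local Notation eps := ((-1) ^+ n : R).

Hypotheses (x_inj : injective x) (y_inj : injective y).
Hypotheses (e2 : encircles 1 x gamma2) (e1 : encircles (- 1) y gamma1).

(** The general lemmas take a contour of sign - sg around x; with the two families exchanged, sg is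
    -1. *)
Let e2' : encircles (- - 1) x gamma2. Proof. by rewrite opprK. Qed.

Lemma calB_hat_value c r : c <= 0 -> calB_hat a1 a2 nu gamma2 d2 c v t r =
  (eps * (d2 * Num.sqrt a / Num.sqrt (1 - t)) *
   finite_B al l (- a) x y r)%:C.
Proof.
move=> c0; have cs : 0 <= - 1 * c by rewrite mulN1r oppr_ge0.
have Ff i := node_exp_real y eps (- (a * r)) (x i).
have ll := line_lagrange v ht m0 x_inj e2' a2 cs (is_entire_node_exp y eps (- (a * r))) Ff.
rewrite /calB_hat; refine (etrans (congr1 ( *%R _) (etrans (eq_vline _ _) ll)) _).
  by move=> w; apply: eq_contour => z; rewrite prod_frac_sub1 prod_sub1 rmorphN; ring.
rewrite /finite_B mulNr -mulrN -rmorphN twopii_cancel gmeanZ_sum -[eps * _ * - _]mulrA mulrN.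
rewrite mulrCA -!mulrN; congr ((_ * (_ * - gmean _ _ _))%:C); apply: eq_bigr => i _.
by congr ((_ * expR _) *: _); ring.
Qed.

Lemma beta_hat_value r : beta_hat a1 a2 nu d2 v t r =
  (eps * (d2 * Num.sqrt a / Num.sqrt (1 - t)) * finite_beta al l (- a) y r)%:C.
Proof.
rewrite /finite_beta; have ls := line_shift v ht a2 (- a * r) 0 (eps *: Q).
have -> : l + - a * r = a2 + - a * r - v / (1 - t) by rewrite addrAC.
rewrite [eps * _]mulrC -[_ * eps * _]mulrA -gmeanZ -(twopii_cancel 1) expr1; congr (_ * _).
rewrite -ls; apply: eq_vline => w; rewrite prod_sub1 -horner_node_polyC.
by move: (node_poly y) => q; rewrite map_polyZ hornerZ [- a * r]mulNr rmorphN.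
Qed.

Lemma calC_hat_value r : calC_hat a1 a2 nu gamma1 gamma2 d1 u s r =
  (- eps * (d1 * Num.sqrt a / Num.sqrt (1 - s)) *
   finite_C (- a) x y (fun i => Z (x i)) r)%:C.
Proof.
rewrite /finite_C; have Ff i := weight_z_realE s u a2 (x i).
(* The sign [eps] comes from the product over the left nodes, the minus sign from 1 / (z -
   omega). *)
have Gk j := node_exp_real x (- eps) (a * r) (y j).
have dc := double_contour_real m0 n0 x_inj y_inj e2' e1 (is_entire_weight_z s u a2)
  (is_entire_node_exp x (- eps) (a * r)) Ff Gk.
rewrite /calC_hat; refine (etrans (congr1 ( *%R _) (etrans (eq_contour _ _) dc)) _).
  move=> z; apply: eq_contour => w; rewrite prod_frac prodfV prod_sub1 invfM.
  have -> : (eps%:C)^-1 = eps%:C :> R[i] by rewrite -fmorphV invr_sign.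
  by rewrite -[z - w]opprB invrN rmorphN; ring.
rewrite twopii_cancel [- eps * _]mulrC -[_ * - eps * _]mulrA [- eps * _]mulr_sumr.
congr ((_ * _)%:C); apply: eq_bigr => j _; rewrite mulr_sumr; apply: eq_bigr => i _.
have -> : - (- a * y j * r) = a * r * y j by ring.
ring.
Qed.

Lemma M0_hat_value r r' : M0_hat a1 a2 nu gamma1 gamma2 r r' =
  (finite_M (- a) x y r r')%:C.
Proof.
rewrite /finite_M; have Ff i := node_exp_real y 1 (- (a * r)) (x i).
have Gk j := node_exp_real x 1 (a * r') (y j).
have dc := double_contour_real m0 n0 x_inj y_inj e2' e1
  (is_entire_node_exp y 1 (- (a * r))) (is_entire_node_exp x 1 (a * r')) Ff Gk.
rewrite /M0_hat; have -> : a%:C / twopii ^+ 2 = a%:C / (twopii ^+ 2 * 1%:C) by rewrite mulr1.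
refine (etrans (congr1 ( *%R _) (etrans (eq_contour _ _) dc)) _).
  by move=> z; apply: eq_contour => w; rewrite !prod_frac cexpD rmorphN; ring.
rewrite twopii_cancel divr1 opprK; congr ((_ * _)%:C); apply: eq_bigr => j _.
apply: eq_bigr => i _.
by rewrite !mulNr opprK [a * r * _]mulrAC [a * r' * _]mulrAC; ring.
Qed.

Lemma first_term_hat_value :
  (d1 * d2)%:C / (twopii ^+ 2 * (Num.sqrt ((1 - s) * (1 - t)))%:C) *
  vline_integral 0 (fun w => contour_integral gamma2 (fun z =>
    (w - z)^-1 * (weight_z a2 s u z * weight_w a2 t v w) *
    \prod_(j < m) ((1 - w / (x j)%:C) / (1 - z / (x j)%:C)))) =
  (d1 * d2 / Num.sqrt ((1 - s) * (1 - t)) *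
   gmean al l (\sum_i Z (x i) *: lag x i))%:C.
Proof.
have Ff i : (-1)%:C * weight_z a2 s u (x i)%:C = (-1 * Z (x i))%:C.
  by rewrite weight_z_realE rmorphM.
have eF := is_entireM (is_entire_cst (-1)%:C) (is_entire_weight_z s u a2).
have cs : 0 <= - 1 * 0 :> R by rewrite mulr0.
rewrite -(twopii_cancel 2); congr (_ * _).
have gE := gmeanZ_sum al l (-1) (fun i => Z (x i)) (lag x); rewrite mulN1r in gE.
rewrite -[gmean _ _ _]opprK -gE rmorphN mulrN -mulNr.
rewrite -(line_lagrange v ht m0 x_inj e2' a2 cs eF Ff).
apply: eq_vline => w; apply: eq_contour => z; rewrite prod_frac.
by rewrite -[w - z]opprB invrN rmorphN; ring.
Qed.

End RightValues.

(** * Assembly of the limit kernel *)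

Section Assembly.
Context {R : realType}.

Lemma contour_encircles (sg : R) n (x : 'I_n -> R) (g : R -> R[i]) :
  simple_closed_contour g -> counterclockwise g ->
  (forall z, trace g z -> 0 < sg * Re z) -> (forall i, 0 < sg * x i) ->
  (forall i, inside g (x i)%:C) -> encircles sg x g.
Proof.
move=> [cg gP g01 _] ccw side xs ins; split => //.
- exact: within_ccont.
- by move=> y y01; apply: side; exists y.
- move=> i y y01; have [ntr _] := ins i; apply/eqP => e; apply: ntr.
  by exists y.
- by move=> i; exact: ccw.
Qed.

Section Reduction.
Variables (al l b h : R) (n m : nat) (x : 'I_n -> R) (y : 'I_m -> R).
Variables (Yx : 'I_n -> R) (Yy : 'I_m -> R) (Z : 'I_n -> R).
Hypotheses (al0 : 0 < al) (h0 : h != 0) (x_inj : injective x) (y_inj : injective y).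
Hypotheses (hx : forall i, h * x i < 0) (hy : forall j, 0 < h * y j).
Hypothesis quadrature : forall p q : {poly R}, (size p <= n)%N -> (size q <= m)%N ->
  gmean al l p + gmean al (l + h) q =
  \sum_i exp_poly_ev b (b + h) p q (x i) * Yx i +
  \sum_j exp_poly_ev b (b + h) p q (y j) * Yy j.
Hypothesis ev_inj : forall p q : {poly R}, (size p <= n)%N -> (size q <= m)%N ->
  (forall i, exp_poly_ev b (b + h) p q (x i) = 0) ->
  (forall j, exp_poly_ev b (b + h) p q (y j) = 0) -> p = 0 /\ q = 0.

(** Isolates what the two kernels share: their functions are constant multiples of the finite ones,
    and only the product of the constants matters. *)
Lemma fredholm_reduction (kB kC : R) (B be C : R -> R[i]) (M : R -> R -> R[i]) (T : R[i]) :
  (forall r, B r = (kB * finite_B al l h x y r)%:C) ->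
  (forall r, be r = (kB * finite_beta al l h y r)%:C) ->
  (forall r, C r = (kC * finite_C h x y Z r)%:C) ->
  (forall r r', M r r' = (finite_M h x y r r')%:C) ->
  T = (kB * kC / h * gmean al l (\sum_i Z i *: lag x i))%:C ->
  T + fredholm_det `[1, +oo[ (fun r r' => - M r r' + (B r + be r) * C r') /
    fredholm_det `[1, +oo[ (fun r r' => - M r r') - 1 =
  (kB * kC / h * \sum_i Z i * expR (b * x i) * Yx i)%:C.
Proof.
move=> BE beE CE ME ->.
have x0 i : x i != 0 by apply: contraTneq (hx i) => ->; rewrite mulr0 ltxx.
have y0 j : y j != 0 by apply: contraTneq (hy j) => ->; rewrite mulr0 ltxx.
have hxy i j : 0 < h * (y j - x i).
  by rewrite mulrBr subr_gt0 (lt_trans (hx i) (hy j)).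
rewrite -(rank_reduction al0 h0 x0 y0 x_inj y_inj hxy hy Z quadrature ev_inj (kB * kC)).
have -> : (fun r r' => - M r r') = (fun r r' => (- finite_M h x y r r')%:C).
  by apply/funext => r; apply/funext => r'; rewrite ME -rmorphN.
have -> // : (fun r r' => - M r r' + (B r + be r) * C r') = (fun r r' => (- finite_M h x y r r' +
    kB * kC * ((finite_B al l h x y r + finite_beta al l h y r) * finite_C h x y Z r'))%:C).
apply/funext => r; apply/funext => r'; rewrite BE beE CE ME -rmorphN.
rewrite -!(rmorphD (real_complex R)) -!(rmorphM (real_complex R)) -!(rmorphD (real_complex R)).
by congr (_%:C); ring.
Qed.

End Reduction.
End Assembly.

Section LimitValues.
Context {R : realType}.
Variables (n m : nat) (a1 a2 : R) (nu : 'I_(n + m) -> R) (gamma1 gamma2 : R -> R[i]).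
Variables (d1 d2 s t u v : R).
Hypotheses (n0 : (0 < n)%N) (m0 : (0 < m)%N) (ha : a1 < a2).
Hypothesis nu_incr : forall i j : 'I_(n + m), (i < j)%N -> nu i < nu j.
Hypotheses (nu_neg : forall j, nu (lshift m j) < 0) (nu_pos : forall j, 0 < nu (rshift n j)).
Hypotheses (hd1 : d1 != 0) (hd2 : d2 != 0) (hs : 0 < s < 1) (ht : 0 < t < 1).
Hypotheses (e1 : encircles (- 1) (fun i => nu (lshift m i)) gamma1)
  (e2 : encircles 1 (fun j => nu (rshift n j)) gamma2).

Local Notation a := (a2 - a1).
Local Notation al := (t / (2 * (1 - t))).
Local Notation x := (fun i : 'I_n => nu (lshift m i)).
Local Notation y := (fun j : 'I_m => nu (rshift n j)).
Local Notation Y := (node_weight a1 a2 nu t v).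
Local Notation Z r := (expR (- (s / (2 * (1 - s))) * r ^+ 2 + u * r / (1 - s))).
Local Notation ev := (exp_poly_ev a1 a2).

Let a0 : 0 < a. Proof. by rewrite subr_gt0. Qed.
Let a12 : a1 != a2. Proof. by rewrite lt_eqF. Qed.

Let nu_inj : injective nu.
Proof.
move=> i j e; apply/val_inj; case: (ltngtP i j) => // /nu_incr; rewrite e ltxx //.
Qed.

Let x_inj : injective x. Proof. by move=> i j /nu_inj /lshift_inj. Qed.
Let y_inj : injective y. Proof. by move=> i j /nu_inj /rshift_inj. Qed.

Let quadrature (p q : {poly R}) : (size p <= n)%N -> (size q <= m)%N ->
  gmean al (a1 - v / (1 - t)) p + gmean al (a2 - v / (1 - t)) q =
  \sum_i ev p q (x i) * Y (lshift m i) + \sum_j ev p q (y j) * Y (rshift n j).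
Proof.
move=> pn qm; rewrite (confluent_quadrature a12 nu_incr _ _ pn qm) ?big_split_ord //.
  by move=> {}p {}pn; exact: gmean_coefs.
by move=> {}q {}qm; exact: gmean_coefs.
Qed.

Let ev_inj (p q : {poly R}) : (size p <= n)%N -> (size q <= m)%N ->
  (forall i, ev p q (x i) = 0) -> (forall j, ev p q (y j) = 0) -> p = 0 /\ q = 0.
Proof.
move=> pn qm ex ey; apply: (exp_poly_ev_inj a12 nu_incr pn qm) => k.
by case: (split_ordP k) => j ->.
Qed.

Let sqrtM : Num.sqrt ((1 - s) * (1 - t)) = Num.sqrt (1 - s) * Num.sqrt (1 - t).
Proof. by rewrite sqrtrM // subr_ge0; case/andP: hs => _ /ltW. Qed.

Let s1 : Num.sqrt (1 - s) != 0.
Proof. by rewrite gt_eqF // sqrtr_gt0 subr_gt0; case/andP: hs. Qed.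

Let t1 : Num.sqrt (1 - t) != 0.
Proof. by rewrite gt_eqF // sqrtr_gt0 subr_gt0; case/andP: ht. Qed.

(** The exponential of the quadrature rule removes the dependence on b, so L and its hatted version
    carry the same weights and add up to one sum over all nodes. *)
Let weightE b r : weight_z_real s u b r * expR (b * r) = Z r.
Proof. by rewrite -expRD; congr expR; ring. Qed.

Let constE : d2 * Num.sqrt a / Num.sqrt (1 - t) * (d1 * Num.sqrt a / Num.sqrt (1 - s)) / a =
  d1 * d2 / Num.sqrt ((1 - s) * (1 - t)).
Proof.
have sa : Num.sqrt a * Num.sqrt a = a by rewrite -expr2 sqr_sqrtr // ltW.
have sa0 : Num.sqrt a != 0 by rewrite gt_eqF // sqrtr_gt0.
by rewrite sqrtM -[X in _ / X]sa; field; rewrite s1 t1 sa0.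
Qed.

Let d12K (z : R) : (d1 * d2)%:C^-1 * (d1 * d2 / Num.sqrt ((1 - s) * (1 - t)) * z)%:C =
  ((Num.sqrt ((1 - s) * (1 - t)))^-1 * z)%:C.
Proof.
rewrite -(fmorphV (real_complex R)) -(rmorphM (real_complex R)); congr (_%:C).
by rewrite sqrtM; field; rewrite s1 t1 hd1 hd2.
Qed.

Lemma Lmn_value c : 0 <= c -> Lmn a1 a2 nu gamma1 gamma2 d1 d2 c s u t v =
  ((Num.sqrt ((1 - s) * (1 - t)))^-1 * \sum_i Z (x i) * Y (lshift m i))%:C.
Proof.
move=> c0; rewrite /Lmn.
have a0' : a != 0 by rewrite gt_eqF.
have hx i : a * x i < 0 by rewrite pmulr_rlt0.
have hy j : 0 < a * y j by rewrite mulr_gt0.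
have ba : a1 + a = a2 by rewrite addrC subrK.
have la : a1 - v / (1 - t) + a = a2 - v / (1 - t) by rewrite addrAC ba.
have quad (p q : {poly R}) : (size p <= n)%N -> (size q <= m)%N ->
    gmean al (a1 - v / (1 - t)) p + gmean al (a1 - v / (1 - t) + a) q =
    \sum_i exp_poly_ev a1 (a1 + a) p q (x i) * Y (lshift m i) +
    \sum_j exp_poly_ev a1 (a1 + a) p q (y j) * Y (rshift n j).
  by rewrite la ba; exact: quadrature.
have inj (p q : {poly R}) : (size p <= n)%N -> (size q <= m)%N ->
    (forall i, exp_poly_ev a1 (a1 + a) p q (x i) = 0) ->
    (forall j, exp_poly_ev a1 (a1 + a) p q (y j) = 0) -> p = 0 /\ q = 0.
  by rewrite ba; exact: ev_inj.
rewrite (fredholm_reduction (gauss_rate_gt0 ht) a0' x_inj y_inj hx hy quad inj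
  (fun r => calB_value a1 a2 d2 v n0 ht x_inj e1 r c0) (beta_value a1 a2 nu d2 v ht)
  (calC_value a1 a2 d1 s u n0 m0 x_inj y_inj e1 e2)
  (M0_value a1 a2 n0 m0 x_inj y_inj e1 e2)).
  rewrite constE d12K; congr ((_ * _)%:C); apply: eq_bigr => i _.
  by rewrite weightE.
by rewrite constE; exact: first_term_value.
Qed.

(** The same reduction with the two families of nodes exchanged, b = a_2 and h = - a. Both the
    quadrature rule and the injectivity are symmetric under this exchange. *)
Lemma Lmn_hat_value c : c <= 0 -> Lmn_hat a1 a2 nu gamma1 gamma2 d1 d2 c s u t v =
  ((Num.sqrt ((1 - s) * (1 - t)))^-1 * \sum_j Z (y j) * Y (rshift n j))%:C.
Proof.
move=> c0; rewrite /Lmn_hat.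
have a0' : - a != 0 by rewrite oppr_eq0 gt_eqF.
have hx j : - a * y j < 0 by rewrite mulNr oppr_lt0 mulr_gt0.
have hy i : 0 < - a * x i by rewrite mulNr oppr_gt0 pmulr_rlt0.
have ba : a2 + - a = a1 by rewrite opprB addrC subrK.
have la : a2 - v / (1 - t) + - a = a1 - v / (1 - t) by rewrite addrAC ba.
have evC p q r : exp_poly_ev a2 a1 p q r = ev q p r by rewrite /exp_poly_ev addrC.
have quad (p q : {poly R}) : (size p <= m)%N -> (size q <= n)%N ->
    gmean al (a2 - v / (1 - t)) p + gmean al (a2 - v / (1 - t) + - a) q =
    \sum_j exp_poly_ev a2 (a2 + - a) p q (y j) * Y (rshift n j) +
    \sum_i exp_poly_ev a2 (a2 + - a) p q (x i) * Y (lshift m i).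
  move=> pm qn; rewrite la ba addrC quadrature // addrC.
  by congr (_ + _); apply: eq_bigr => k _; rewrite evC.
have inj (p q : {poly R}) : (size p <= m)%N -> (size q <= n)%N ->
    (forall j, exp_poly_ev a2 (a2 + - a) p q (y j) = 0) ->
    (forall i, exp_poly_ev a2 (a2 + - a) p q (x i) = 0) -> p = 0 /\ q = 0.
  rewrite ba => pm qn ey ex; have [||q0 p0] // := @ev_inj q p qn pm.
    by move=> i; rewrite -evC.
  by move=> j; rewrite -evC.
(* The signs eps of the hatted B, - eps of the hatted C and -1 of h multiply to 1. *)
have constN : (-1) ^+ n * (d2 * Num.sqrt a / Num.sqrt (1 - t)) *
    (- (-1) ^+ n * (d1 * Num.sqrt a / Num.sqrt (1 - s))) / - a =
    d1 * d2 / Num.sqrt ((1 - s) * (1 - t)).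
  have en : (-1) ^+ n * (-1) ^+ n = 1 :> R by rewrite -expr2 sqrr_sign.
  rewrite -constE invrN; move: (_ / Num.sqrt (1 - t)) (_ / Num.sqrt (1 - s)) => A B.
  transitivity ((-1) ^+ n * (-1) ^+ n * (A * B / a)); first by ring.
  by rewrite en mul1r.
rewrite (fredholm_reduction (gauss_rate_gt0 ht) a0' y_inj x_inj hx hy quad inj
  (fun r => calB_hat_value a1 a2 d2 v m0 ht y_inj e2 r c0) (beta_hat_value a1 a2 nu d2 v ht)
  (calC_hat_value a1 a2 d1 s u n0 m0 y_inj x_inj e2 e1)
  (M0_hat_value a1 a2 n0 m0 y_inj x_inj e2 e1)).
  rewrite constN d12K; congr ((_ * _)%:C); apply: eq_bigr => j _.
  by rewrite weightE.
by rewrite constN; exact: first_term_hat_value.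
Qed.

Lemma L_kernel_value c c' : 0 <= c -> c' <= 0 ->
  L_kernel a1 a2 nu gamma1 gamma2 d1 d2 c c' s u t v =
  (- q_kernel s u t v + (Num.sqrt ((1 - s) * (1 - t)))^-1 *
    \sum_k Z (nu k) * node_weight a1 a2 nu t v k)%:C.
Proof.
move=> hc hc'; rewrite /L_kernel Lmn_value // Lmn_hat_value //.
rewrite -(rmorphD (real_complex R)) -(rmorphB (real_complex R)); congr (_%:C).
by rewrite big_split_ord [_^-1 * (_ + _)]mulrDr [RHS]addrC.
Qed.

End LimitValues.

Section RealComplexCvg.
Context {R : realType}.

Lemma cvg_real_complex (f : nat -> R) (z : R) :
  f i @[i --> \oo] --> z -> (fun i => (f i)%:C : R[i]^o) @ \oo --> (z%:C : R[i]^o).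
Proof.
move=> fz; apply/cvgrPdist_lt => e e0.
(* In the partial order of the complex numbers a positive e is real, so it is a legitimate real
   tolerance. *)
have [re ie] : 0 < Re e /\ Im e = 0.
  by move: e0; rewrite ltcE /= => /andP[/eqP -> ->].
near=> i.
have -> : z%:C - (f i)%:C = (z - f i)%:C :> R[i] by rewrite rmorphB.
rewrite normc_def /= expr0n addr0 sqrtr_sqr ltcE /= ie eqxx /=.
by near: i; move/cvgrPdist_lt : fz; exact.
Unshelve. all: by end_near. Qed.

End RealComplexCvg.

Theorem theorem1p4 (R : realType) (n m : nat) (hn : (1 <= n)%N) (hm : (1 <= m)%N)
  (a1 a2 : R) (ha : a1 < a2)
  (nu : 'I_(n + m) -> R)
  (nu_incr : forall i j : 'I_(n + m), (i < j)%N -> nu i < nu j)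
  (nu_neg : forall j : 'I_n, nu (lshift m j) < 0)
  (nu_pos : forall j : 'I_m, 0 < nu (rshift n j))
  (d1 d2 : R) (hd1 : d1 != 0) (hd2 : d2 != 0)
  (gamma1 gamma2 : R -> R[i])
  (gamma1_contour : simple_closed_contour gamma1)
  (gamma1_ccw : counterclockwise gamma1)
  (gamma1_left : forall z, trace gamma1 z -> complex.Re z < 0)
  (gamma1_nu : forall j : 'I_n, inside gamma1 (nu (lshift m j))%:C)
  (gamma2_contour : simple_closed_contour gamma2)
  (gamma2_ccw : counterclockwise gamma2)
  (gamma2_right : forall z, trace gamma2 z -> 0 < complex.Re z)
  (gamma2_nu : forall j : 'I_m, inside gamma2 (nu (rshift n j))%:C)
  (c c' : R) (hc : 0 <= c) (hc' : c' <= 0)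
  (s t u v : R) (hs : 0 < s < 1) (ht : 0 < t < 1) :
  (fun K : nat => (LK_kernel a1 a2 nu K s u t v)%:C : R[i]^o) @ \oo -->
  L_kernel a1 a2 nu gamma1 gamma2 d1 d2 c c' s u t v.
Proof.
have e1 : encircles (- 1) (fun i => nu (lshift m i)) gamma1.
  apply: contour_encircles => // [z /gamma1_left|i]; by rewrite mulN1r oppr_gt0.
have e2 : encircles 1 (fun j => nu (rshift n j)) gamma2.
  by apply: contour_encircles => // [z /gamma2_right|j]; rewrite mul1r.
rewrite (L_kernel_value u v hn hm ha nu_incr nu_neg nu_pos hd1 hd2 hs ht e1 e2 hc hc').
apply: cvg_real_complex; exact: LK_kernel_cvg.
Qed.
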